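(* Let $E\subset\mathbb{C}$ be a compact set with $\mathrm{cap}(E)>0$. If the sets of points $Z_n=\{z_{k,n}\}_{k=1}^n\subset\mathbb{C}$, $n\ge 2$, satisfy $$\lim_{n\to\infty}\hat I[\tau(Z_n)]=V_E \qquad\text{and}\qquad \lim_{n\to\infty} m_E(Z_n)=0,$$ then both of the following hold: (i) $\tau(Z_n)\stackrel{*}{\rightarrow}\mu_E$ as $n\to\infty$; (ii) $\displaystyle\lim_{R\to\infty}\lim_{n\to\infty}\frac1n\sum_{|z_{k,n}|\ge R}\log|z_{k,n}|=0$. Conversely, if $Z_n=\{z_{k,n}\}_{k=1}^n\subset\mathbb{C}$, $n\in\mathbb{N}$, is any sequence of sets of points satisfying both (i) and (ii), then $\lim_{n\to\infty}m_E(Z_n)=0$.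
   Context: For a Borel measure $\mu$ with compact support in $\mathbb{C}$, its energy is $I[\mu]=\iint\log\frac{1}{|z-t|}\,d\mu(t)\,d\mu(z)$. For compact $E\subset\mathbb{C}$, let $\mathcal{M}(E)$ be the set of all Borel probability measures supported on $E$; Robin's constant is $V_E=\inf_{\mu\in\mathcal{M}(E)}I[\mu]$ and the capacity is $\mathrm{cap}(E)=e^{-V_E}$. If $\mathrm{cap}(E)>0$, the infimum is attained by a unique measure $\mu_E\in\mathcal{M}(E)$, the equilibrium measure of $E$. $\Omega_E$ is the unbounded connected component of $\overline{\mathbb{C}}\setminus E$, and $g_E(z,\infty)$ is the Green function of $\Omega_E$ with pole at $\infty$; for $z\in\Omega_E\setminus\{\infty\}$ it equals $g_E(z,\infty)=V_E-\int\log\frac{1}{|z-t|}\,d\mu_E(t)$. For a set of $n$ points $Z_n=\{z_{k,n}\}_{k=1}^n$ (points listed with possible repetition), the counting measure is $\tau(Z_n)=\frac1n\sum_{k=1}^n\delta_{z_{k,n}}$, where $\delta_z$ is the unit point mass at $z$. For $n\ge2$ the discrete energy is $$\hat I[\tau(Z_n)]=\frac{2}{n(n-1)}\sum_{1\le j<k\le n}\log\frac{1}{|z_{j,n}-z_{k,n}|},$$ which is finite if and only if the points are distinct (and is $+\infty$ otherwise). Also $$m_E(Z_n)=\frac1n\sum_{z_{k,n}\in\Omega_E}g_E(z_{k,n},\infty),$$ with $m_E(Z_n)=0$ if $Z_n\cap\Omega_E=\emptyset$. $\tau(Z_n)\stackrel{*}{\rightarrow}\mu_E$ means $\int\phi\,d\tau(Z_n)\to\int\phi\,d\mu_E$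 for every continuous $\phi:\mathbb{C}\to\mathbb{R}$ with compact support. In (ii), the inner limit is understood to exist for all sufficiently large $R$. *)

(* Defs.v *)
From HB Require Import structures.
From mathcomp Require Import all_boot all_order all_algebra.
From mathcomp Require Import complex.
From mathcomp Require Import all_classical all_reals all_analysis.

Set Implicit Arguments.
Unset Strict Implicit.
Unset Printing Implicit Defensive.

Import Order.TTheory GRing.Theory Num.Theory.
Import numFieldNormedType.Exports.

Local Open Scope classical_set_scope.
Local Open Scope ring_scope.
Local Open Scope ereal_scope.

(* The complex plane is R[i] with the topology of its modulus and its Borel
   sigma-algebra. *)
HB.instance Definition _ (R : realType) :=
  NormedModule.copy R[i] ((R[i] : numClosedFieldType)^o).

HB.instance Definition _ (R : realType) :=
  Measurable.copy R[i] (g_sigma_algebraType (@open R[i])).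

(* The real-valued modulus; the norm `|z| of R[i] lives in R[i]. *)
Local Notation modulus z := (Normc.normc z) (only parsing).

Section potential_theory.
Context {R : realType}.
Implicit Types (E : set R[i]) (mu : probability R[i] R) (s : seq R[i]).

(* log (1 / |z - t|), equal to +oo on the diagonal since lne 0 = -oo *)
Definition log_kernel (z t : R[i]) : \bar R := - lne (modulus (z - t))%:E.

Definition energy (mu : {measure set R[i] -> \bar R}) : \bar R :=
  \int[mu]_z \int[mu]_t log_kernel z t.

(* E is meant to be closed, so that "supp mu is included in E" amounts to the
   complement of E being mu-null. *)
Definition probabilities_on E : set (probability R[i] R) :=
  [set mu | mu (~` E) = 0].

Definition robin E : \bar R :=
  ereal_inf [set energy mu | mu in probabilities_on E].

Definition capacity E : \bar R := expeR (- robin E).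

Definition equilibrium_measure E mu : Prop :=
  probabilities_on E mu /\ energy mu = robin E.

(* Omega_E in the Riemann sphere; None is the point at infinity. *)
Local Notation sphere := (one_point_compactification R[i]).

Definition outer_domain E : set sphere :=
  connected_component (~` ((Some : R[i] -> sphere) @` E)) (None : sphere).

(* g_E(z, oo) for finite z in Omega_E, where muE is the equilibrium measure *)
Definition green E (muE : probability R[i] R) (z : R[i]) : \bar R :=
  robin E - \int[muE]_t log_kernel z t.

(* A finite family of points, with repetitions, is a sequence; `tau s` is its
   normalised counting measure. *)
Definition tau s : {measure set R[i] -> \bar R} :=
  mscale ((size s)%:R^-1)%:nng%R (msum (fun k => \d_(s`_k)) (size s)).

Definition discrete_energy s : \bar R :=
  (2 / ((size s)%:R * ((size s).-1)%:R))%:E *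
  \sum_(k < size s) \sum_(j < size s | (j < k)%N) log_kernel s`_j s`_k.

Definition green_mean E (muE : probability R[i] R) s : \bar R :=
  ((size s)%:R^-1)%:E *
  \sum_(z <- s | (Some z : sphere) \in outer_domain E) green E muE z.

Definition log_tail s (r : R) : R :=
  ((size s)%:R^-1 * \sum_(z <- s | r <= modulus z) ln (modulus z))%R.

Definition weak_star_cvg (mu_ : nat -> {measure set R[i] -> \bar R})
    (mu : {measure set R[i] -> \bar R}) : Prop :=
  forall phi : R[i] -> R, continuous phi ->
    compact (closure [set z | phi z != 0%R]) ->
    (\int[mu_ n]_z (phi z)%:E) @[n --> \oo] --> \int[mu]_z (phi z)%:E.

(* The iterated limit over n, then r, is 0; the inner limit is required to exist
   only for large r (lim is a junk value otherwise). *)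
Definition log_tail_vanishes (Z : forall n, n.-tuple R[i]) : Prop :=
  (\forall r \near +oo%R, cvgn (fun n => log_tail (Z n) r)) /\
  limn (fun n => log_tail (Z n) r) @[r --> +oo%R] --> 0%R.

End potential_theory.

(* Main.v *)
(* The numbers 1 - |z - t|^2 / ((1 + |z|^2) (1 + |t|^2)) are inner products of
   points of the sphere S^3, so that log (1 / |z - t|) is, up to terms depending
   on z alone and on t alone, a power series in them with positive coefficients.
   Energies are then positive combinations of squares of moments. Hence the
   energy of a weak limit of point configurations is at most the limit of their
   discrete energies, and mu = mu_E is the only measure tau with I[tau] <= V and
   int U dtau >= V, where U is the potential of mu and V = V_E. A variation of
   mu within the measures on E shows that U >= V holds tau-almost everywhere on E
   when tau has finite energy, and that U = V mu-almost everywhere.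
   Almost minimal point configurations on E converge to mu. Interpolating the
   constant 1 at these points yields U <= V off E; the maximum principle for the
   polynomials vanishing at all but one of them yields U >= V on the bounded
   components of the complement of E. Thus g = V - U is nonnegative on the outer
   domain, and it is comparable to log |z| near infinity.
   If m_E(Z_n) tends to 0, the logarithmic tails vanish and every weak limit tau
   is carried by the set U >= V; if also the discrete energies tend to V, then
   tau = mu by uniqueness. Conversely, truncating the series of U gives
   continuous majorants of g whose mu-integrals tend to 0. *)
Require Import Defs.
From HB Require Import structures.
From mathcomp Require Import all_boot all_order all_algebra.
From mathcomp Require Import complex.
From mathcomp Require Import all_classical all_reals all_analysis.
From mathcomp Require Import measurable_realfun.
From mathcomp Require Import ring lra zify.

Set Implicit Arguments.
Unset Strict Implicit.
Unset Printing Implicit Defensive.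

Import Order.TTheory GRing.Theory Num.Theory.
Import numFieldNormedType.Exports.
Import complex ComplexField.

Local Open Scope classical_set_scope.
Local Open Scope ring_scope.

(** * The topology and the Borel sets of the plane *)

Section plane.
Context {R : realType}.
Local Notation C := R[i].
Local Notation normc := Normc.normc.
Implicit Types (z w t : C) (A : set C).

(** The kernel is unbounded above and below and the points may run to infinity, so neither its
    integrals nor its signs come for free. In the chordal form the singularity sits in a series of
    nonnegative terms and the growth in [lnw], a continuous function of one variable: sums and
    integrals commute on the first, and only [lnw] has to be integrable. The integral of each term
    is a finite sum of products of moments, which makes mutual energies symmetric and compares them
    through squares, without signed measures. On [E] the potential may stay below V on a small
    exceptional set. That set is only known to be null for measures of finite energy, hence the
    order of the argument: the energy of a weak limit is bounded before its location is examined.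
    Off [E] no theory of harmonic functions enters. A potential there is a limit of means of the
    kernel over almost minimal points, and these means are logarithms of moduli of polynomials; this
    is why polynomial interpolation and a polynomial maximum principle give both inequalities
    between U and V. *)

Lemma normc_sqr z : normc z ^+ 2 = Re z ^+ 2 + Im z ^+ 2.
Proof. by case: z => x y /=; rewrite sqr_sqrtr// addr_ge0// sqr_ge0. Qed.

Lemma normc_ge0 z : 0 <= normc z.
Proof. by case: z => x y /=; rewrite sqrtr_ge0. Qed.

Lemma normrE z : `|z| = (normc z)%:C%C.
Proof. by rewrite normc_def; case: z. Qed.

Lemma Re_le_normc z : `|Re z| <= normc z.
Proof.
by rewrite -(ler_sqr _ _) ?nnegrE ?normr_ge0 ?normc_ge0// real_normK ?num_real// normc_sqr lerDl
  sqr_ge0.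
Qed.

Lemma Im_le_normc z : `|Im z| <= normc z.
Proof.
by rewrite -(ler_sqr _ _) ?nnegrE ?normr_ge0 ?normc_ge0// real_normK ?num_real// normc_sqr lerDr
  sqr_ge0.
Qed.

Lemma normc_le_ReIm z : normc z <= `|Re z| + `|Im z|.
Proof.
rewrite -(ler_sqr _ _) ?nnegrE ?addr_ge0 ?normr_ge0 ?normc_ge0// normc_sqr.
rewrite sqrrD !real_normK ?num_real// -addrA lerD2l lerDr.
by rewrite mulrn_wge0// mulr_ge0.
Qed.

Lemma normc_distC z w : normc (z - w) = normc (w - z).
Proof. by rewrite -opprB normcN. Qed.

Lemma normc_distD z w t : normc (z - t) <= normc (z - w) + normc (w - t).
Proof. by rewrite -[z - t](subrKA w) le_normcD. Qed.

Lemma nbhs_normcP z A :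
  nbhs z A <-> exists2 e : R, 0 < e & forall w, normc (w - z) < e -> A w.
Proof.
split.
  move=> /nbhs_ballP[e /= e0 eA]; exists (Re e).
    by move: e0; rewrite ltcE /= => /andP[].
  move=> w we; apply: eA; rewrite -ball_normE /= normrE ltcE /=.
  move: e0; rewrite ltcE/= => /andP[-> _] /=.
  by rewrite normc_distC.
move=> [e e0 eA]; apply/nbhs_ballP; exists e%:C%C => /=.
  by rewrite ltcR.
move=> w; rewrite -ball_normE /= normrE ltcR => we; apply: eA.
by rewrite normc_distC.
Qed.

Lemma continuous_normcP (phi : C -> R) z :
  {for z, continuous phi} <-> forall e, 0 < e -> exists2 d, 0 < d &
    forall w, normc (w - z) < d -> `|phi w - phi z| < e.
Proof.
split.
  move=> /(@cvgrPdist_lt _ _ _ (nbhs z) (nbhs_filter z)) + e e0 => /(_ e e0) /nbhs_normcP[d d0 dP].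
  by exists d => // w /dP; rewrite distrC.
move=> H; apply/(@cvgrPdist_lt _ _ _ (nbhs z) (nbhs_filter z)) => e e0; apply/nbhs_normcP.
by have [d d0 dP] := H e e0; exists d => // w /dP; rewrite distrC.
Qed.

Lemma lip_continuous (phi : C -> R) :
  (forall z w, `|phi w - phi z| <= normc (w - z)) -> continuous phi.
Proof.
by move=> H z; apply/continuous_normcP => e e0; exists e => // w; exact: le_lt_trans.
Qed.

Lemma continuous_Re : continuous (@Re R : C -> R).
Proof.
apply: lip_continuous => z w; apply: le_trans (Re_le_normc _).
by case: z w => [a b] [c d].
Qed.

Lemma continuous_Im : continuous (@Im R : C -> R).
Proof.
apply: lip_continuous => z w; apply: le_trans (Im_le_normc _).
by case: z w => [a b] [c d].
Qed.

Lemma continuous_normc : continuous (@Normc.normc R : C -> R).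
Proof.
apply: lip_continuous => z w; rewrite ler_norml; apply/andP; split.
  rewrite lerBrDl lerBlDr -[X in X <= _]/(normc z) addrC.
  by have := normc_distD z w 0; rewrite !subr0 normc_distC.
by rewrite lerBlDr; have := normc_distD w z 0; rewrite !subr0.
Qed.

Lemma measurable_fun_continuous (phi : C -> R) :
  continuous phi -> measurable_fun setT phi.
Proof.
move=> cphi; apply: (measurability _ (RGenOpens.measurableE R)).
move=> _ [_ [a [b ->] <-]]; rewrite setTI.
apply: sub_sigma_algebra.
by apply: open_comp; [move=> *; exact: cphi|exact: interval_open].
Qed.

(** Half-open, so that a box is a Boolean combination of half-planes [Re z < a] and [Im z < a]; with
    rational corners there are countably many. *)
Definition rat_box (q : rat * rat * rat * rat) : set C :=
  [set z | (ratr q.1.1.1 <= Re z < ratr q.1.1.2) /\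
           (ratr q.1.2 <= Im z < ratr q.2)].

Lemma rat_box_in_ball z (e : R) : 0 < e -> exists2 q, rat_box q z &
  forall w, rat_box q w -> normc (w - z) < e.
Proof.
move=> e0.
have e2 : 0 < e / 2 by rewrite divr_gt0.
have lo (x : R) : exists q, x - e / 2 / 2 < ratr q < x.
  have [|q] := @rat_in_itvoo R (x - e / 2 / 2) x; first lra.
  by rewrite in_itv /= => ?; exists q.
have hi (x : R) : exists q, x < ratr q < x + e / 2 / 2.
  have [|q] := @rat_in_itvoo R x (x + e / 2 / 2); first lra.
  by rewrite in_itv /= => ?; exists q.
have [a /andP[a1 a2]] := lo (Re z); have [b /andP[b1 b2]] := hi (Re z).
have [c /andP[c1 c2]] := lo (Im z); have [d /andP[d1 d2]] := hi (Im z).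
exists (a, b, c, d) => [|w []] /=; first by split; rewrite ltW//= .
move=> /andP[h1 h2] /andP[h3 h4].
apply: le_lt_trans (normc_le_ReIm _) _.
have -> : Re (w - z) = Re w - Re z by case: w z {a1 a2 b1 b2 c1 c2 d1 d2 h1 h2 h3 h4} => ? ? [].
have -> : Im (w - z) = Im w - Im z by case: w z {a1 a2 b1 b2 c1 c2 d1 d2 h1 h2 h3 h4} => ? ? [].
rewrite [e]splitr ltrD// ltr_norml; apply/andP; split; lra.
Qed.

Lemma open_bigcup_rat_box A : open A ->
  A = \bigcup_n (if unpickle n is Some q then
                   (if `[< rat_box q `<=` A >] then rat_box q else set0)
                 else set0).
Proof.
move=> oA; apply/seteqP; split=> z.
  move=> Az; have /nbhs_normcP[e e0 eA] : nbhs z A by exact: open_nbhs_nbhs.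
  have [q qz qe] := rat_box_in_ball z e0.
  have := pickleK q; move: (pickle q) => n nq; exists n; first by [].
  by rewrite nq asboolT// => w /qe; exact: eA.
by move=> [n _]; case: (unpickle n) => [q|//]; case: asboolP => // qA /qA.
Qed.

(** Open sets are countable unions of rational boxes, so the half-planes generate the Borel sets.
    This is the induction principle behind the measurability of plane-valued maps and the recovery
    of a measure from its moments. *)
Lemma borel_plane_ind (S : set (set C)) : sigma_algebra setT S ->
  (forall a : R, S [set z | Re z < a]) -> (forall a : R, S [set z | Im z < a]) ->
  forall A, measurable A -> S A.
Proof.
move=> sS SRe SIm A mA.
have [S0 SC SU] := sS.
have SI X Y : S X -> S Y -> S (X `&` Y).
  move=> SX SY; rewrite -[_ `&` _]setCK setCI -setTD; apply: (SC).
  rewrite -bigcup2E; apply: (SU) => -[|[|n]] //=; by rewrite -setTD; apply: (SC).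
have Sbox q : S (rat_box q).
  have -> : rat_box q = ([set z | Re z < ratr q.1.1.2] `&` ~` [set z | Re z < ratr q.1.1.1])
     `&` ([set z | Im z < ratr q.2] `&` ~` [set z | Im z < ratr q.1.2]).
    apply/seteqP; split=> z /=.
      move=> [/andP[a b] /andP[c d]]; split; split=> //; apply/negP; by rewrite -leNgt.
    by move=> [[z1 /negP z2] [z3 /negP z4]]; rewrite /rat_box /= z1 z3 !andbT !leNgt.
  apply: (SI); apply: (SI) => //; by rewrite -setTD; apply: (SC).
suff : <<s open >> `<=` S by apply.
apply: smallest_sub => // U oU.
rewrite (open_bigcup_rat_box oU); apply: SU => n.
by case: (unpickle n) => [q|//]; case: asboolP.
Qed.

Lemma measurable_plane_open A : open A -> measurable A.
Proof. exact: sub_sigma_algebra. Qed.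

Lemma measurable_plane_closed A : closed A -> measurable A.
Proof.
by move=> cA; rewrite -[A]setCK; apply: measurableC; apply: measurable_plane_open;
  exact: closed_openC.
Qed.

Lemma measurable_fun_plane d (T : measurableType d) (f : T -> C) :
  measurable_fun setT (fun x => Re (f x)) -> measurable_fun setT (fun x => Im (f x)) ->
  measurable_fun setT f.
Proof.
move=> mR mI _ A mA; rewrite setTI.
move: A mA; apply: borel_plane_ind.
- split=> [|A mA|F mF].
  + by rewrite preimage_set0.
  + by rewrite setTD preimage_setC; exact: measurableC.
  + by rewrite preimage_bigcup; exact: bigcup_measurable.
- move=> a; have := mR measurableT `]-oo, a[%classic (measurable_itv _).
  by rewrite setTI /preimage /=; under eq_set do rewrite in_itv/=.
- move=> a; have := mI measurableT `]-oo, a[%classic (measurable_itv _).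
  by rewrite setTI /preimage /=; under eq_set do rewrite in_itv/=.
Qed.

(** Lindelof argument: each point of [A] lies in a null rational box, and there are only countably
    many boxes. *)
Lemma negligible_local (mu : {measure set C -> \bar R}) A :
  measurable A -> (forall z, A z -> exists2 e, 0 < e &
    exists2 B, measurable B /\ mu B = 0%E & forall w, normc (w - z) < e -> B w) ->
  mu A = 0%E.
Proof.
move=> mA H.
pose F n := if unpickle n is Some q then
  (if `[< mu.-negligible (rat_box q) >] then rat_box q else set0) else set0.
have nF : mu.-negligible (\bigcup_n F n).
  apply: negligible_bigcup => n; rewrite /F; case: (unpickle n) => [q|];
    last exact: negligible_set0.
  by case: asboolP => // _; exact: negligible_set0.
suff AF : A `<=` \bigcup_n F n.
  by apply/negligibleP => //; exact: negligibleS nF.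
move=> z /H[e e0 [B [mB B0] Bz]].
have [q qz qe] := rat_box_in_ball z e0.
have := pickleK q; move: (pickle q) => n nq; exists n; first by [].
rewrite /F nq asboolT//.
by exists B; split=> // w /qe; exact: Bz.
Qed.

Lemma hausdorff_plane : hausdorff_space C.
Proof. exact: norm_hausdorff. Qed.

Lemma compact_plane_closed A : compact A -> closed A.
Proof. exact: (compact_closed hausdorff_plane). Qed.

Lemma compact_plane_bounded A : compact A -> exists M : R, forall z, A z -> normc z <= M.
Proof.
move=> cA.
have cn : {within A, continuous (@Normc.normc R : C -> R)}.
  by apply: continuous_subspaceT; exact: continuous_normc.
have := compact_bounded (continuous_compact cn cA).
move=> [M [_ MA]]; exists (M + 1) => z Az.
have := MA (M + 1); rewrite ltrDl ltr01 => /(_ isT (normc z)) /=.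
rewrite ger0_norm ?normc_ge0//; apply; by exists z.
Qed.

Lemma closed_normc_ball (M : R) : closed [set z : C | normc z <= M].
Proof.
have := (continuous_closedP (@Normc.normc R : C -> R)).1 continuous_normc.
by move=> /(_ [set x | x <= M]); apply; exact: closed_le.
Qed.

Lemma bounded_closed_plane_compact (M : R) A :
  closed A -> (forall z, A z -> normc z <= M) -> compact A.
Proof.
move=> cA AM.
pose I := `[- M, M]%classic : set R.
have cI : compact (I `*` I) by apply: compact_setX; exact: segment_compact.
pose f (x : R * R) : C := Complex x.1 x.2.
have cf : continuous f.
  move=> x U /nbhs_normcP[e e0 eU].
  apply/nbhs_ballP; exists (e / 2) => /=; first by rewrite divr_gt0.
  move=> y [/= y1 y2]; apply: eU; apply: le_lt_trans (normc_le_ReIm _) _ => /=.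
  rewrite [e]splitr; apply: ltrD.
    by rewrite distrC; exact: y1.
  by rewrite distrC; exact: y2.
apply: (subclosed_compact cA (continuous_compact (continuous_subspaceT cf) cI)).
move=> z /AM zM; exists (Re z, Im z); last by case: z {zM}.
split=> /=; rewrite /I /= in_itv/= -ler_norml; apply: le_trans zM;
  [exact: Re_le_normc|exact: Im_le_normc].
Qed.

End plane.

(** * Taylor series of the logarithm *)

Section log_series.
Context {R : realType}.
Implicit Types x : R.

(** Mean value theorem on [0, x] for [ln (1 - y)] plus its truncated series [P]: the derivative
    collapses to [- (y ^+ n / (1 - y))] by the geometric sum. *)
Lemma ln_partial_series (n : nat) x : 0 <= x < 1 ->
  \sum_(k < n) x ^+ k.+1 / k.+1%:R <= - ln (1 - x) <=
  \sum_(k < n) x ^+ k.+1 / k.+1%:R + x ^+ n / (1 - x).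
Proof.
move=> /andP[x0 x1].
pose P : {poly R} := \sum_(k < n) (k.+1%:R)^-1 *: 'X^(k.+1).
have PE y : P.[y] = \sum_(k < n) y ^+ k.+1 / k.+1%:R.
  by rewrite /P horner_sum; apply: eq_bigr => i _; rewrite hornerZ hornerXn mulrC.
have dP y : P^`().[y] = \sum_(k < n) y ^+ k.
  rewrite /P raddf_sum horner_sum; apply: eq_bigr => i _.
  rewrite /= derivZ derivXn hornerZ hornerMn hornerXn /= -(mulr_natl (y ^+ i)) mulrA mulVf ?mul1r//.
pose f (y : R) := ln (1 - y) + P.[y].
have df (y : R) : y < 1 -> is_derive y (1 : R) f (- (y ^+ n / (1 - y))).
  move=> y1.
  have y1' : 0 < 1 - y by rewrite subr_gt0.
  have d1 : is_derive y (1 : R) (fun t : R => ln (1 - t)) (- (1 - y)^-1).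
    have dl := is_derive1_ln y1'.
    have d2 : is_derive y (1 : R) (fun t : R => 1 - t) (0 - 1).
      exact: is_deriveB.
    have := @is_derive1_comp _ (@ln R) (fun t : R => 1 - t) y _ _ dl d2.
    by rewrite sub0r mulrN mulr1.
  suff <- : - (1 - y)^-1 + P^`().[y] = - (y ^+ n / (1 - y)).
    exact: (@is_deriveD _ _ _ (fun t : R => ln (1 - t)) (horner P)).
  rewrite dP.
  have := subrX1 y n; rewrite -[y - 1]opprB mulNr -[y ^+ n - 1]opprB => /oppr_inj e.
  apply: (mulfI (lt0r_neq0 y1')); rewrite mulrDr -e mulrN mulfV ?gt_eqF//.
  by rewrite mulrN mulrCA mulfV ?gt_eqF// mulr1 addrC; ring.
have [x00|xp] := eqVneq x 0.
  rewrite x00 subr0 ln1 oppr0 big1 ?add0r ?lexx ?divr1 ?exprn_ge0//.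
  by move=> i _; rewrite expr0n mul0r.
have xgt : 0 < x by rewrite lt_neqAle eq_sym xp.
have [||c] := MVT xgt (df := fun y => - (y ^+ n / (1 - y))) (f := f).
- by move=> y; rewrite in_itv/= => /andP[_ yx]; apply: df; exact: lt_trans x1.
- apply: derivable_within_continuous => y.
  rewrite in_itv /= => /andP[_ yx].
  by case: (df y (le_lt_trans yx x1)).
rewrite in_itv/= => /andP[c0 cx] fE.
have P0 : P.[0] = 0 by rewrite PE big1// => i _; rewrite expr0n mul0r.
move: fE; rewrite /f P0 !subr0 ln1 !addr0 PE => fE.
have cl : 0 < 1 - c by rewrite subr_gt0 (lt_trans cx).
have -> : - ln (1 - x) = \sum_(k < n) x ^+ k.+1 / k.+1%:R + c ^+ n / (1 - c) * x.
  by move: fE; rewrite mulNr => /(congr1 -%R); rewrite opprK => <-; ring.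
rewrite lerDl lerD2l; apply/andP; split.
  by rewrite mulr_ge0// divr_ge0 ?exprn_ge0// ltW.
apply: le_trans (_ : c ^+ n / (1 - c) <= _).
  by rewrite ler_piMr ?(ltW x1)// divr_ge0 ?exprn_ge0// ltW.
apply: ler_pM; rewrite ?exprn_ge0 ?invr_ge0 ?(ltW c0) ?(ltW cl)//.
  by apply: lerXn2r; rewrite ?nnegrE ltW.
by rewrite lef_pV2 ?posrE ?subr_gt0 ?(lt_trans cx)// lerD2l lerN2 ltW.
Qed.

Local Open Scope ereal_scope.

Lemma nneseries_ln x : (0 <= x < 1)%R ->
  \sum_(0 <= k <oo) (x ^+ k.+1 / k.+1%:R)%:E = (- ln (1 - x))%:E.
Proof.
move=> x01; have /andP[x0 x1] := x01.
have -> : (fun n => \sum_(0 <= k < n) (x ^+ k.+1 / k.+1%:R)%:E) =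
   EFin \o (fun n => \sum_(k < n) x ^+ k.+1 / k.+1%:R)%R.
  by apply/funext => n /=; rewrite big_mkord sumEFin.
apply/cvg_lim => //; apply: cvg_EFin; first exact: nearW.
apply: (@squeeze_cvgr _ _ _ _ (fun n => - ln (1 - x) - x ^+ n / (1 - x))%R (fun=> - ln (1 - x))%R).
- apply: nearW => n /=; have /andP[-> h2] := ln_partial_series n x01.
  by rewrite lerBlDr h2.
- rewrite -[X in _ --> X]subr0; apply: cvgB; first exact: cvg_cst.
  rewrite -[X in _ --> X](mul0r ((1 - x)^-1)%R); apply: cvgMl.
  by apply: cvg_expr; rewrite ger0_norm.
- exact: cvg_cst.
Qed.

(** The harmonic series dominates the series at [x = 1 - expR (- M)], whose sum is [M]. It gives the
    value of the chordal series on the diagonal. *)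
Lemma nneseries_harmonic : \sum_(0 <= k <oo) ((k.+1%:R : R)^-1)%:E = +oo.
Proof.
apply/eqyP => M M0.
pose x : R := (1 - expR (- M))%R.
have e1 : (0 < expR (- M) < 1)%R by rewrite expR_gt0 expR_lt1 oppr_lt0.
have x01 : (0 <= x < 1)%R by rewrite /x; lra.
have <- : \sum_(0 <= k <oo) (x ^+ k.+1 / k.+1%:R)%:E = M%:E.
  by rewrite nneseries_ln// /x opprB addrC subrK expRK opprK.
apply: lee_nneseries => k _.
  by rewrite lee_fin divr_ge0// exprn_ge0//; case/andP: x01.
by rewrite lee_fin ler_piMl ?invr_ge0// exprn_ile1//; case/andP: x01 => // _ /ltW.
Qed.

End log_series.

(** * The chordal expansion of the logarithmic kernel *)

Section chordal_kernel.
Context {R : realType}.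
Local Notation C := R[i].
Local Notation normc := Normc.normc.
Implicit Types (z w t : C) (i : 'I_4).

Definition nsq z : R := Re z ^+ 2 + Im z ^+ 2.

Definition nsq1 z : R := 1 + nsq z.

(* The unit vector of the sphere S^3 in R^4 attached to z is chosen so that
   <sphere z, sphere t> = 1 - |z - t|^2 / ((1 + |z|^2) (1 + |t|^2)). *)
Definition sphere i z : R :=
  [:: 1; Num.sqrt 2 * Re z; Num.sqrt 2 * Im z; nsq z]`_i / nsq1 z.

Definition chord z t : R := \sum_i sphere i z * sphere i t.

Lemma nsq_normc z : nsq z = normc z ^+ 2.
Proof. by rewrite normc_sqr. Qed.

Lemma nsq_ge0 z : 0 <= nsq z.
Proof. by rewrite nsq_normc sqr_ge0. Qed.

Lemma nsq1_ge1 z : 1 <= nsq1 z.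
Proof. by rewrite lerDl nsq_ge0. Qed.

Lemma nsq1_gt0 z : 0 < nsq1 z.
Proof. exact: lt_le_trans (nsq1_ge1 z). Qed.

Lemma nsq1_neq0 z : nsq1 z != 0.
Proof. by rewrite gt_eqF// nsq1_gt0. Qed.

Lemma chordE z t : chord z t = 1 - nsq (z - t) / (nsq1 z * nsq1 t).
Proof.
rewrite /chord !big_ord_recl big_ord0 /sphere /=.
have s2 : Num.sqrt 2 ^+ 2 = 2 :> R by rewrite sqr_sqrtr.
have hz := nsq1_neq0 z; have ht := nsq1_neq0 t.
have -> : nsq (z - t) = (Re z - Re t) ^+ 2 + (Im z - Im t) ^+ 2.
  by case: z t {hz ht} => a b [c d].
apply: (mulIf (mulf_neq0 hz ht)).
rewrite mulrBl divfK ?mulf_neq0//.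
have e (a b : R) : a / nsq1 z * (b / nsq1 t) * (nsq1 z * nsq1 t) = a * b.
  by field; rewrite hz ht.
have e2 (a b : R) : Num.sqrt 2 * a * (Num.sqrt 2 * b) = 2 * (a * b).
  by rewrite mulrACA -expr2 s2.
rewrite addr0 !(mulrDl _ _ (nsq1 z * nsq1 t)) !e !e2 /nsq1 /nsq. ring.
Qed.

Lemma chordC z t : chord z t = chord t z.
Proof. by apply: eq_bigr => i _; rewrite mulrC. Qed.

Lemma chordzz z : chord z z = 1.
Proof. by rewrite chordE subrr /nsq /= expr0n /= addr0 mul0r subr0. Qed.

(** The numerator is the square of the modulus of 1 + conj(z) t, split into real and imaginary
    parts. *)
Lemma chord_ge0 z t : 0 <= chord z t.
Proof.
rewrite chordE subr_ge0 ler_pdivrMr ?mulr_gt0 ?nsq1_gt0// mul1r.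
have -> : nsq (z - t) = (Re z - Re t) ^+ 2 + (Im z - Im t) ^+ 2.
  by case: z t => a b [c d].
rewrite /nsq1 /nsq -subr_ge0.
have -> : (1 + (Re z ^+ 2 + Im z ^+ 2)) * (1 + (Re t ^+ 2 + Im t ^+ 2)) -
  ((Re z - Re t) ^+ 2 + (Im z - Im t) ^+ 2) =
  (1 + (Re z * Re t + Im z * Im t)) ^+ 2 + (Re z * Im t - Im z * Re t) ^+ 2 by ring.
by rewrite addr_ge0// sqr_ge0.
Qed.

Lemma chord_lt1 z t : z != t -> chord z t < 1.
Proof.
move=> zt; rewrite chordE gtrBl divr_gt0 ?mulr_gt0 ?nsq1_gt0//.
rewrite nsq_normc exprn_gt0// lt_neqAle normc_ge0 andbT.
by apply: contra zt => /eqP/esym/Normc.eq0_normc/eqP; rewrite subr_eq0.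
Qed.

Lemma sphere_bound i z : `|sphere i z| <= 1.
Proof.
have := chordzz z; rewrite /chord (bigD1 i)//= => e.
rewrite -(ler_sqr _ _) ?nnegrE// expr1n real_normK ?num_real// -e expr2 lerDl.
by apply: sumr_ge0 => j _; rewrite -expr2 sqr_ge0.
Qed.

Lemma continuous_planeM (f g : C -> R) :
  continuous f -> continuous g -> continuous (fun z => f z * g z).
Proof. by move=> cf cg z; exact: cvgM (cf z) (cg z). Qed.

Lemma continuous_planeD (f g : C -> R) :
  continuous f -> continuous g -> continuous (fun z => f z + g z).
Proof. by move=> cf cg z; exact: cvgD (cf z) (cg z). Qed.

Lemma continuous_plane_cst (a : R) : continuous (fun _ : C => a).
Proof. exact: cst_continuous. Qed.

Lemma continuous_plane_sum (I : Type) (s : seq I) (f : I -> C -> R) :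
  (forall j : I, continuous (f j)) -> continuous (fun z => \sum_(k <- s) f k z).
Proof.
move=> cf; elim: s => [|j s ih].
  rewrite (_ : (fun z => _) = (fun=> 0)); first exact: continuous_plane_cst.
  by apply/funext => z; rewrite big_nil.
rewrite (_ : (fun z => _) = (fun z => f j z + \sum_(k <- s) f k z)).
  exact: continuous_planeD (cf j) ih.
by apply/funext => z; rewrite big_cons.
Qed.

Lemma continuous_plane_prod (I : Type) (s : seq I) (f : I -> C -> R) :
  (forall j : I, continuous (f j)) -> continuous (fun z => \prod_(k <- s) f k z).
Proof.
move=> cf; elim: s => [|j s ih].
  rewrite (_ : (fun z => _) = (fun=> 1)); first exact: continuous_plane_cst.
  by apply/funext => z; rewrite big_nil.
rewrite (_ : (fun z => _) = (fun z => f j z * \prod_(k <- s) f k z)).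
  exact: continuous_planeM (cf j) ih.
by apply/funext => z; rewrite big_cons.
Qed.

Lemma continuous_nsq : continuous nsq.
Proof.
move=> z.
have h1 : {for z, continuous (fun z : C => Re z ^+ 2)}.
  apply: (@continuous_comp _ _ _ (@Re R : C -> R) (fun x : R => x ^+ 2));
    first exact: continuous_Re.
  exact: exprn_continuous.
have h2 : {for z, continuous (fun z : C => Im z ^+ 2)}.
  apply: (@continuous_comp _ _ _ (@Im R : C -> R) (fun x : R => x ^+ 2));
    first exact: continuous_Im.
  exact: exprn_continuous.
exact: cvgD h1 h2.
Qed.

Lemma continuous_nsq1 : continuous nsq1.
Proof.
have h := @continuous_planeD (fun=> 1) nsq (@continuous_plane_cst 1) continuous_nsq.
exact: h.
Qed.

Lemma continuous_sphere i : continuous (sphere i).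
Proof.
apply: continuous_planeM; last first.
  by move=> z; exact: cvgV (nsq1_neq0 z) (@continuous_nsq1 z).
case: i => -[|[|[|[|//]]]] h /=.
- exact: continuous_plane_cst.
- by apply: continuous_planeM; [exact: continuous_plane_cst|exact: continuous_Re].
- by apply: continuous_planeM; [exact: continuous_plane_cst|exact: continuous_Im].
- exact: continuous_nsq.
Qed.

(** Monomials are indexed by words rather than exponents: a power of the inner product is then a
    plain sum of products, without multinomial coefficients. *)
Definition sphere_mono k (f : {ffun 'I_k -> 'I_4}) z : R := \prod_j sphere (f j) z.

Lemma chordX k z t : chord z t ^+ k =
  \sum_(f : {ffun 'I_k -> 'I_4}) sphere_mono f z * sphere_mono f t.
Proof.
rewrite -[in LHS](card_ord k) -prodr_const /chord bigA_distr_bigA /=.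
by apply: eq_bigr => f _; rewrite -big_split.
Qed.

Lemma sphere_mono_bound k (f : {ffun 'I_k -> 'I_4}) z : `|sphere_mono f z| <= 1.
Proof.
rewrite /sphere_mono normr_prod [leRHS](_ : _ = \prod_(j < k) 1); last by rewrite big1_eq.
by apply: ler_prod => i _; rewrite normr_ge0 sphere_bound.
Qed.

Lemma continuous_sphere_mono k (f : {ffun 'I_k -> 'I_4}) : continuous (sphere_mono f).
Proof.
by apply: continuous_plane_prod => i; exact: continuous_sphere.
Qed.

Lemma measurable_sphere_mono k (f : {ffun 'I_k -> 'I_4}) :
  measurable_fun setT (sphere_mono f).
Proof. by apply: measurable_fun_continuous; exact: continuous_sphere_mono. Qed.

Definition lnw z : R := ln (nsq1 z) / 2.

Lemma lnw_ge0 z : 0 <= lnw z.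
Proof. by rewrite divr_ge0// ln_ge0// nsq1_ge1. Qed.

Lemma continuous_lnw : continuous lnw.
Proof.
apply: continuous_planeM; last exact: continuous_plane_cst.
move=> z; apply: (@continuous_comp _ _ _ nsq1 (@ln R)); first exact: continuous_nsq1.
exact: continuous_ln (nsq1_gt0 z).
Qed.

(** The coefficient of [x ^+ k.+1] in [- ln (1 - x) / 2]; the shift of the index reflects the
    missing constant term. *)
Definition kcoef k : R := (k.+1%:R * 2)^-1.

Lemma kcoef_gt0 k : 0 < kcoef k.
Proof. by rewrite invr_gt0 mulr_gt0. Qed.

Lemma kcoef_ge0 k : 0 <= kcoef k.
Proof. exact: ltW (kcoef_gt0 k). Qed.

Lemma chord_term_ge0 k z t : 0 <= kcoef k * chord z t ^+ k.+1.
Proof. by rewrite mulr_ge0 ?kcoef_ge0// exprn_ge0// chord_ge0. Qed.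

Definition chord_series n z t : R := \sum_(k < n) kcoef k * chord z t ^+ k.+1.

Definition chord_log z t : \bar R :=
  (\sum_(0 <= k <oo) (kcoef k * chord z t ^+ k.+1)%:E)%E.

Local Open Scope ereal_scope.

Lemma chord_logE z t :
  chord_log z t = 2^-1%:E * \sum_(0 <= k <oo) (chord z t ^+ k.+1 / k.+1%:R)%:E.
Proof.
rewrite -nneseriesZl; last first.
  by move=> k _; rewrite lee_fin divr_ge0// exprn_ge0// chord_ge0.
by apply: eq_eseriesr => k _; rewrite -EFinM /kcoef invfM; congr EFin; ring.
Qed.

(** Since [1 - chord z t] is the squared distance divided by [nsq1 z * nsq1 t], half of minus its
    logarithm is the kernel plus the two weights. On the diagonal both sides are infinite by the
    divergence of the harmonic series. *)
Lemma log_kernelE z t : log_kernel z t = chord_log z t - (lnw z + lnw t)%:E.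
Proof.
rewrite chord_logE /log_kernel; have [->|zt] := eqVneq z t.
  rewrite chordzz subrr Normc.normc0 le0_lneNy//.
  under eq_eseriesr do rewrite expr1n mul1r.
  by rewrite nneseries_harmonic gt0_muley.
have nzt : (0 < normc (z - t))%R.
  rewrite lt_neqAle normc_ge0 andbT; apply: contra zt => /eqP/esym/Normc.eq0_normc/eqP.
  by rewrite subr_eq0.
rewrite nneseries_ln ?chord_ge0 ?chord_lt1// lne_EFin//.
rewrite -EFinM -EFinB; congr EFin.
rewrite chordE subKr ln_div ?posrE ?mulr_gt0 ?nsq1_gt0//; last first.
  by rewrite nsq_normc exprn_gt0.
rewrite lnM ?posrE ?nsq1_gt0// nsq_normc lnXn// /lnw; by field.
Qed.

Lemma log_kernel_real z t : z != t -> log_kernel z t = (- ln (normc (z - t)))%:E.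
Proof.
move=> zt; rewrite /log_kernel lne_EFin// lt_neqAle normc_ge0 andbT.
by apply: contra zt => /eqP/esym/Normc.eq0_normc/eqP; rewrite subr_eq0.
Qed.

Lemma chord_log_ge0 z t : 0 <= chord_log z t.
Proof.
by apply: nneseries_ge0 => k _ _; rewrite lee_fin chord_term_ge0.
Qed.

Lemma chord_series_le n z t : (chord_series n z t)%:E <= chord_log z t.
Proof.
rewrite /chord_series -sumEFin -(big_mkord xpredT (fun k => (kcoef k * chord z t ^+ k.+1)%:E)).
by apply: nneseries_lim_ge => k _ _; rewrite lee_fin chord_term_ge0.
Qed.

End chordal_kernel.

(** * Integration of differences and of bounded functions *)

Section integration.
Local Open Scope ereal_scope.
Context d (T : measurableType d) {R : realType}.

(** The integral of [f] may be infinite. In that case the negative part of [f - g] is at most the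
    absolute value of [g], while its positive part, which together with that absolute value
    dominates [f], has infinite integral. *)
Lemma integral_ge0B (mu : {measure set T -> \bar R}) (f : T -> \bar R) (g : T -> R) :
  measurable_fun setT f -> (forall x, 0 <= f x) ->
  mu.-integrable setT (EFin \o g) ->
  \int[mu]_x (f x - (g x)%:E) = \int[mu]_x f x - \int[mu]_x (g x)%:E.
Proof.
move=> mf f0 ig.
have mg : measurable_fun setT (EFin \o g) by case/integrableP : ig.
have [fy|fy] := ltP (\int[mu]_x f x) +oo.
  have if_ : mu.-integrable setT f.
    apply/integrableP; split => //.
    by under eq_integral do rewrite gee0_abs//.
  exact: (integralB measurableT if_ ig).
have {}fy : \int[mu]_x f x = +oo by apply/eqP; rewrite eq_le fy leey.
have iag : mu.-integrable setT (fun x => `|(g x)%:E|) by exact: integrable_abse.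
have gfin : \int[mu]_x (g x)%:E \is a fin_num by exact: integrable_fin_num.
have agy : \int[mu]_x `|(g x)%:E| < +oo by case/integrableP : ig.
have mfg : measurable_fun setT (fun x => f x - (g x)%:E) by exact: emeasurable_funB.
rewrite fy addye; last by move: gfin; rewrite -fin_numN fin_numE => /andP[].
rewrite integralE.
set h := (fun x => f x - (g x)%:E) in mfg *.
have hm : \int[mu]_x h^\- x < +oo.
  apply: le_lt_trans agy; apply: ge0_le_integral => //.
  - exact: measurable_funeneg.
  - by apply: measurableT_comp.
  - move=> x _; rewrite funenegE ge_max abse_ge0 andbT /h oppeB//; last first.
      by rewrite fin_num_adde_defl.
    apply: le_trans (lee_abs _); rewrite -[leRHS]add0e leeD2r// oppe_le0//.
have hp : \int[mu]_x h^\+ x = +oo.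
  apply/eqP; rewrite eq_le leey /= -fy.
  have : \int[mu]_x f x <= \int[mu]_x (h^\+ x + `|(g x)%:E|).
    apply: ge0_le_integral => //.
    - apply: emeasurable_funD; [exact: measurable_funepos|exact: measurableT_comp].
    - move=> x _; rewrite -[leLHS](@subeK _ _ (g x)%:E)//.
      by apply: leeD; [rewrite funeposE le_max lexx|exact: lee_abs].
  rewrite ge0_integralD//; [|exact: measurable_funepos|exact: measurableT_comp].
  rewrite fy leye_eq => /eqP e; rewrite leye_eq; apply/eqP; move: e.
  have : \int[mu]_x `|(g x)%:E| \is a fin_num by rewrite ge0_fin_numE// integral_ge0.
  case: (\int[mu]_x `|(g x)%:E|) => // r _.
  have : 0 <= \int[mu]_x h^\+ x by apply: integral_ge0 => x _; exact: funepos_ge0.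
  by case: (\int[mu]_x h^\+ x).
rewrite hp addye//.
have h0 : 0 <= \int[mu]_x h^\- x by apply: integral_ge0 => x _; exact: funeneg_ge0.
by case: (\int[mu]_x h^\- x) hm h0.
Qed.

(* The total mass, stated for the underlying measure so that it rewrites the
   output of the integration lemmas. *)
Lemma measure_probT (mu : probability T R) :
  (mu : {measure set T -> \bar R}) setT = 1.
Proof. exact: probability_setT. Qed.

Lemma bounded_integrable (mu : probability T R) (g : T -> R) (M : R) :
  measurable_fun setT g -> (forall x, `|g x| <= M)%R -> mu.-integrable setT (EFin \o g).
Proof.
move=> mg gM; apply: measurable_bounded_integrable => //.
  by rewrite -ge0_fin_numE// fin_num_measure.
exists M; split; first exact: num_real.
by move=> y My x _; exact: le_trans (gM x) (ltW My).
Qed.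

Lemma ae_bounded_integrable (mu : probability T R) (g : T -> R) (M : R) (A : set T) :
  measurable A -> mu (~` A) = 0 ->
  measurable_fun setT g -> (forall x, A x -> `|g x| <= M)%R ->
  mu.-integrable setT (EFin \o g).
Proof.
move=> mA A0 mg gM; apply/integrableP; split; first exact/measurable_EFinP.
apply: le_lt_trans (integral_le_bound M%:E _ _ _ _) _ => //.
- exact/measurable_EFinP.
- have [x Ax] : exists x, A x.
    apply: contrapT => nA; have : ~` A = setT by apply/seteqP; split=> // x _ Ax; apply: nA;
      exists x.
    by move=> e; move: A0; rewrite e probability_setT => /eqP; rewrite onee_eq0.
  by rewrite lee_fin (le_trans _ (gM x Ax)).
- exists (~` A); split => //; first exact: measurableC.
  move=> x /= H Ax; apply: H => _; rewrite /= lee_fin; exact: gM.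
- by rewrite measure_probT mule1 ltry.
Qed.

End integration.

(** * Moments, potentials and energies *)

Section moments.
Context {R : realType}.
Local Notation C := R[i].
Implicit Types (nu mu : probability C R) (z t : C).

Definition moment nu k (f : {ffun 'I_k -> 'I_4}) : R :=
  (\int[nu]_z sphere_mono f z)%R.

(** The double integral of [chord z t ^+ k], written as a finite sum of products of moments: its
    symmetry is commutativity of the product and needs no Fubini theorem. *)
Definition pair_moment nu mu k : R :=
  \sum_(f : {ffun 'I_k -> 'I_4}) moment nu f * moment mu f.

Definition pot_moment nu k z : R :=
  \sum_(f : {ffun 'I_k -> 'I_4}) sphere_mono f z * moment nu f.

Definition chord_pot nu z : \bar R :=
  (\sum_(0 <= k <oo) (kcoef k * pot_moment nu k.+1 z)%:E)%E.

Definition chord_energy nu mu : \bar R :=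
  (\sum_(0 <= k <oo) (kcoef k * pair_moment nu mu k.+1)%:E)%E.

Lemma integrable_sphere_mono nu k (f : {ffun 'I_k -> 'I_4}) :
  nu.-integrable setT (EFin \o sphere_mono f).
Proof.
apply: (@bounded_integrable _ _ _ _ _ 1); first exact: measurable_sphere_mono.
exact: sphere_mono_bound.
Qed.

Lemma EFin_moment nu k (f : {ffun 'I_k -> 'I_4}) :
  ((moment nu f)%:E = \int[nu]_z (sphere_mono f z)%:E)%E.
Proof.
rewrite /moment /Rintegral fineK//; apply: integrable_fin_num => //.
exact: integrable_sphere_mono.
Qed.

Lemma integral_lincomb nu k (a : {ffun 'I_k -> 'I_4} -> R) :
  (\int[nu]_t (\sum_f a f * sphere_mono f t)%:E = (\sum_f a f * moment nu f)%:E)%E.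
Proof.
under eq_integral do rewrite -sumEFin.
rewrite integral_sum//=; last first.
  by move=> f; exact: (integrableZl measurableT (a f) (integrable_sphere_mono nu f)).
rewrite -sumEFin; apply: eq_bigr => f _.
rewrite EFinM EFin_moment -integralZl//; first exact: integrable_sphere_mono.
Qed.

Lemma integral_chordX nu k z :
  (\int[nu]_t (chord z t ^+ k)%:E = (pot_moment nu k z)%:E)%E.
Proof. by under eq_integral do rewrite chordX; exact: integral_lincomb. Qed.

Lemma integral_pot_moment nu mu k :
  (\int[nu]_z (pot_moment mu k z)%:E = (pair_moment nu mu k)%:E)%E.
Proof.
rewrite /pot_moment; under eq_integral do under eq_bigr do rewrite mulrC.
by rewrite integral_lincomb; congr EFin; apply: eq_bigr => f _; rewrite mulrC.
Qed.

Lemma pot_moment_ge0 nu k z : 0 <= pot_moment nu k z.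
Proof.
rewrite -lee_fin -integral_chordX; apply: integral_ge0 => t _.
by rewrite lee_fin exprn_ge0// chord_ge0.
Qed.

Lemma pair_moment_ge0 nu mu k : 0 <= pair_moment nu mu k.
Proof.
rewrite -lee_fin -integral_pot_moment; apply: integral_ge0 => t _.
by rewrite lee_fin pot_moment_ge0.
Qed.

Lemma pair_momentC nu mu k : pair_moment nu mu k = pair_moment mu nu k.
Proof. by apply: eq_bigr => f _; rewrite mulrC. Qed.

Lemma continuous_pot_moment nu k : continuous (pot_moment nu k).
Proof.
apply: continuous_plane_sum => f.
by apply: continuous_planeM; [exact: continuous_sphere_mono|exact: continuous_plane_cst].
Qed.

Lemma measurable_pot_moment nu k : measurable_fun setT (pot_moment nu k).
Proof. by apply: measurable_fun_continuous; exact: continuous_pot_moment. Qed.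

Lemma continuous_chord z k : continuous (fun t => chord z t ^+ k).
Proof.
rewrite (_ : (fun t => _) = (fun t => \sum_(f : {ffun 'I_k -> 'I_4})
    sphere_mono f z * sphere_mono f t)); last by apply/funext => t; exact: chordX.
apply: continuous_plane_sum => f.
by apply: continuous_planeM; [exact: continuous_plane_cst|exact: continuous_sphere_mono].
Qed.

Local Open Scope ereal_scope.

Lemma measurable_chord_log z : measurable_fun setT (chord_log z).
Proof.
apply: ge0_emeasurable_sum => [k x _ _|k _]; first by rewrite lee_fin chord_term_ge0.
apply/measurable_EFinP; apply: measurable_funM => //.
by apply: measurable_fun_continuous; exact: continuous_chord.
Qed.

Lemma integral_chord_log nu z : \int[nu]_t chord_log z t = chord_pot nu z.
Proof.
rewrite /chord_log integral_nneseries//; last 2 first.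
- move=> k; apply/measurable_EFinP; apply: measurable_funM => //.
  by apply: measurable_fun_continuous; exact: continuous_chord.
- move=> k t _; by rewrite lee_fin chord_term_ge0.
apply: eq_eseriesr => k _; under eq_integral do rewrite EFinM.
rewrite ge0_integralZl//.
- by rewrite integral_chordX EFinM.
- apply/measurable_EFinP; apply: measurable_fun_continuous; exact: continuous_chord.
- by move=> t _; rewrite lee_fin exprn_ge0// chord_ge0.
- by rewrite lee_fin kcoef_ge0.
Qed.

Lemma chord_pot_ge0 nu z : 0 <= chord_pot nu z.
Proof.
apply: nneseries_ge0 => k _ _.
by rewrite lee_fin mulr_ge0 ?kcoef_ge0 ?pot_moment_ge0.
Qed.

Lemma measurable_chord_pot nu : measurable_fun setT (chord_pot nu).
Proof.
apply: ge0_emeasurable_sum => [k x _ _|k _].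
  by rewrite lee_fin mulr_ge0 ?kcoef_ge0 ?pot_moment_ge0.
by apply/measurable_EFinP; apply: measurable_funM => //; exact: measurable_pot_moment.
Qed.

Lemma integral_chord_pot nu mu : \int[nu]_z chord_pot mu z = chord_energy nu mu.
Proof.
rewrite /chord_pot integral_nneseries//; last 2 first.
- by move=> k; apply/measurable_EFinP; apply: measurable_funM => //; exact: measurable_pot_moment.
- by move=> k t _; rewrite lee_fin mulr_ge0 ?kcoef_ge0 ?pot_moment_ge0.
apply: eq_eseriesr => k _; under eq_integral do rewrite EFinM.
rewrite ge0_integralZl//.
- by rewrite integral_pot_moment EFinM.
- by apply/measurable_EFinP; exact: measurable_pot_moment.
- by move=> t _; rewrite lee_fin pot_moment_ge0.
- by rewrite lee_fin kcoef_ge0.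
Qed.

Lemma chord_energyC nu mu : chord_energy nu mu = chord_energy mu nu.
Proof. by apply: eq_eseriesr => k _; rewrite pair_momentC. Qed.

Lemma chord_energy_ge0 nu mu : 0 <= chord_energy nu mu.
Proof.
by rewrite -integral_chord_pot; apply: integral_ge0 => z _; exact: chord_pot_ge0.
Qed.

Definition lnw_mean nu : R := (\int[nu]_z lnw z)%R.

Definition lnw_integrable nu := nu.-integrable setT (EFin \o lnw).

Lemma EFin_lnw_mean nu : lnw_integrable nu -> (lnw_mean nu)%:E = \int[nu]_z (lnw z)%:E.
Proof. by move=> i; rewrite /lnw_mean /Rintegral fineK//; exact: integrable_fin_num. Qed.

Definition log_pot nu z := \int[nu]_t log_kernel z t.

Lemma log_potE nu z : lnw_integrable nu ->
  log_pot nu z = chord_pot nu z - (lnw z + lnw_mean nu)%:E.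
Proof.
move=> inu; rewrite /log_pot; under eq_integral do rewrite log_kernelE.
rewrite integral_ge0B.
- rewrite integral_chord_log; congr (_ - _).
  under eq_integral do rewrite EFinD.
  rewrite integralD//=; last exact: finite_measure_integrable_cst.
  by rewrite integral_cst// measure_probT mule1 EFinD EFin_lnw_mean.
- exact: measurable_chord_log.
- by move=> t; exact: chord_log_ge0.
- exact: (integrableD measurableT (finite_measure_integrable_cst _ (lnw z) measurableT) inu).
Qed.

Lemma measurable_log_pot nu : lnw_integrable nu -> measurable_fun setT (log_pot nu).
Proof.
move=> inu; rewrite (_ : log_pot nu = fun z => chord_pot nu z - (lnw z + lnw_mean nu)%:E).
  apply: emeasurable_funB; first exact: measurable_chord_pot.
  apply/measurable_EFinP; apply: measurable_funD => //.
  by apply: measurable_fun_continuous; exact: continuous_lnw.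
by apply/funext => z; exact: log_potE.
Qed.

Lemma integral_log_pot nu mu : lnw_integrable nu -> lnw_integrable mu ->
  \int[nu]_z log_pot mu z = chord_energy nu mu - (lnw_mean nu + lnw_mean mu)%:E.
Proof.
move=> inu imu; under eq_integral do rewrite log_potE//.
have ic : nu.-integrable setT (cst (lnw_mean mu)%:E) by exact: finite_measure_integrable_cst.
rewrite integral_ge0B.
- rewrite integral_chord_pot; congr (_ - _).
  under eq_integral do rewrite EFinD.
  by rewrite integralD//= integral_cst// measure_probT mule1 EFinD (EFin_lnw_mean inu).
- exact: measurable_chord_pot.
- by move=> t; exact: chord_pot_ge0.
- exact: (integrableD measurableT inu (finite_measure_integrable_cst _ (lnw_mean mu) measurableT)).
Qed.

Lemma energyE nu : lnw_integrable nu ->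
  energy nu = chord_energy nu nu - (lnw_mean nu + lnw_mean nu)%:E.
Proof. by move=> inu; rewrite -integral_log_pot. Qed.

End moments.

(** * Measures are determined by their moments *)

Section plateau.
Context {R : realType}.
Implicit Types s : R.

Lemma bernoulli_ge (x : R) n : -1 <= x -> 1 + n%:R * x <= (1 + x) ^+ n.
Proof.
move=> x1; elim: n => [|n ih]; first by rewrite mul0r addr0 expr0.
rewrite exprSr; apply: le_trans (ler_wpM2r _ ih); last lra.
rewrite -natr1 -subr_ge0.
have -> : (1 + n%:R * x) * (1 + x) - (1 + (n%:R + 1) * x) = n%:R * x ^+ 2 by ring.
by rewrite mulr_ge0// sqr_ge0.
Qed.

(** With [r] the square root of [q], [n%:R * r ^+ n] is below the geometric sum, hence at most
    [(1 - r)^-1]; the other factor [r ^+ n] tends to 0. *)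
Lemma cvg_natr_mul_expr (q : R) : 0 <= q < 1 -> n%:R * q ^+ n @[n --> \oo] --> (0 : R).
Proof.
move=> /andP[q0 q1].
pose r := Num.sqrt q.
have rq : r ^+ 2 = q by rewrite sqr_sqrtr.
have r0 : 0 <= r by rewrite sqrtr_ge0.
have r1 : r < 1 by rewrite -(@ltr_pXn2r _ 2)// ?nnegrE// rq expr1n.
have r1' : 0 < 1 - r by rewrite subr_gt0.
have nr n : n%:R * r ^+ n <= (1 - r)^-1.
  rewrite -[leRHS]mul1r ler_pdivlMr//.
  have -> : n%:R * r ^+ n = \sum_(i < n) r ^+ n by rewrite sumr_const card_ord mulr_natl.
  apply: le_trans (_ : (\sum_(i < n) r ^+ i) * (1 - r) <= _).
    rewrite ler_wpM2r ?(ltW r1')//; apply: ler_sum => i _.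
    by rewrite ler_wiXn2l ?(ltW r1)// ltnW.
  have := subrX1 r n; rewrite mulrC -[(r - 1)]opprB mulrN => /(congr1 -%R).
  by rewrite opprB opprK => <-; rewrite gerBl exprn_ge0.
apply: (@squeeze_cvgr _ _ _ _ (fun=> 0) (fun n => (1 - r)^-1 * r ^+ n)).
- apply: nearW => n; rewrite mulr_ge0 ?exprn_ge0//=.
  by rewrite -rq -exprM mulnC exprM expr2 mulrA ler_wpM2r ?exprn_ge0.
- exact: cvg_cst.
- rewrite -[X in _ --> X](mulr0 (1 - r)^-1); apply: cvgMr.
  by apply: cvg_expr; rewrite ger0_norm.
Qed.

(* Brosowski-Deutsch: polynomials converging to the indicator of [0, 1/2[. *)
Definition plateau n s : R := (1 - s ^+ n) ^+ (n * 2 ^ n).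

Lemma plateau_01 n s : 0 <= s <= 1 -> 0 <= plateau n s <= 1.
Proof.
move=> /andP[s0 s1].
have h1 : s ^+ n <= 1 by rewrite exprn_ile1.
have h0 : 0 <= s ^+ n by rewrite exprn_ge0.
by rewrite /plateau exprn_ge0 ?exprn_ile1//; lra.
Qed.

(** Bernoulli's inequality is used twice. Below 1/2 it bounds [1 - plateau n s] by
    [n%:R * (s * 2) ^+ n]. From 1/2 on, [plateau n s] times the same power of [1 + s ^+ n] is at
    most 1, and that power is at least [n.+1]; the factor [n] in the exponent makes this work at 1/2
    itself. *)
Lemma cvg_plateau s : 0 <= s <= 1 -> plateau n s @[n --> \oo] --> ((s < 2^-1)%R%:R : R).
Proof.
move=> s01; have /andP[s0 s1] := s01.
have [s2|s2] := ltP s 2^-1.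
  apply: (@squeeze_cvgr _ _ _ _ (fun n => 1 - n%:R * (s * 2) ^+ n) (fun=> 1)).
  - apply: nearW => n; have /andP[_ ->] := plateau_01 n s01; rewrite andbT.
    have := @bernoulli_ge (- s ^+ n) (n * 2 ^ n).
    rewrite lerN2 exprn_ile1// => /(_ isT); apply: le_trans.
    by rewrite natrM natrX exprMn [leRHS](_ : _ = 1 - n%:R * (s ^+ n * 2 ^+ n))//; ring.
  - rewrite -[X in _ --> X]subr0; apply: cvgB; first exact: cvg_cst.
    by apply: cvg_natr_mul_expr; lra.
  - exact: cvg_cst.
apply: (@squeeze_cvgr _ _ _ _ (fun=> 0) (fun n => n.+1%:R^-1)).
- apply: nearW => n; have /andP[-> _] := plateau_01 n s01; rewrite /=.
  have x0 : 0 <= s ^+ n by rewrite exprn_ge0.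
  have x1 : s ^+ n <= 1 by rewrite exprn_ile1.
  have xn : (n%:R : R) <= (n * 2 ^ n)%:R * s ^+ n.
    rewrite natrM natrX -mulrA ler_peMr// -exprMn exprn_ege1//; lra.
  have b := @bernoulli_ge (s ^+ n) (n * 2 ^ n).
  have {}b : n.+1%:R <= (1 + s ^+ n) ^+ (n * 2 ^ n).
    by apply: le_trans (b _); [rewrite -natr1 addrC lerD2l|lra].
  rewrite -[leRHS]mul1r ler_pdivlMr ?ltr0n//.
  apply: le_trans (_ : plateau n s * (1 + s ^+ n) ^+ (n * 2 ^ n) <= 1).
    by rewrite ler_wpM2l//; have /andP[] := plateau_01 n s01.
  rewrite /plateau -exprMn -subr_sqr expr1n exprn_ile1//; last by rewrite gerBl sqr_ge0.
  by rewrite subr_ge0 exprn_ile1.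
- exact: cvg_cst.
- exact: cvg_harmonic.
Qed.

End plateau.

Section measure_of_moments.
Context {R : realType}.
Local Notation C := R[i].
Context (nu mu : probability C R).
Implicit Types (g h : C -> R) (A : set C).

(** The weight [g] inside the moments makes this class stable under multiplication by the
    coordinates of the sphere, hence under multiplication by bounded pointwise limits of polynomials
    in them. *)
Definition same_moments g : Prop :=
  [/\ measurable_fun setT g, exists M : R, forall z, `|g z| <= M &
    forall k (f : {ffun 'I_k -> 'I_4}),
      (\int[nu]_z (sphere_mono f z * g z)%:E = \int[mu]_z (sphere_mono f z * g z)%:E)%E].

Lemma integrable_sphere_monoM (P : probability C R) k (f : {ffun 'I_k -> 'I_4}) g (M : R) :
  measurable_fun setT g -> (forall z, `|g z| <= M) ->
  P.-integrable setT (fun z => (sphere_mono f z * g z)%:E).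
Proof.
move=> mg gM; apply: (@bounded_integrable _ _ _ _ _ M).
  by apply: measurable_funM => //; exact: measurable_sphere_mono.
move=> z; rewrite normrM; apply: le_trans (gM z).
by rewrite ler_piMl// sphere_mono_bound.
Qed.

Lemma same_moments_lin (a b : R) g h : same_moments g -> same_moments h ->
  same_moments (fun z => a * g z + b * h z).
Proof.
move=> [mg [M gM] eg] [mh [N hN] eh].
have mlin : measurable_fun setT (fun z => a * g z + b * h z).
  by apply: measurable_funD; apply: measurable_funM.
split => //.
  exists (`|a| * M + `|b| * N) => z; apply: le_trans (ler_normD _ _) _.
  by rewrite !normrM lerD// ler_wpM2l.
move=> k f.
have E (P : probability C R) : (\int[P]_z (sphere_mono f z * (a * g z + b * h z))%:E =
  a%:E * \int[P]_z (sphere_mono f z * g z)%:E + b%:E * \int[P]_z (sphere_mono f z * h z)%:E)%E.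
  have ig := integrable_sphere_monoM P f mg gM; have ih := integrable_sphere_monoM P f mh hN.
  rewrite -!integralZl// -integralD//; [|exact: integrableZl|exact: integrableZl].
  by apply: eq_integral => z _; rewrite -!EFinM -EFinD; congr EFin; ring.
by rewrite !E eg eh.
Qed.

Lemma same_moments_sphere i g : same_moments g -> same_moments (fun z => sphere i z * g z).
Proof.
move=> [mg [M gM] eg].
have ms : measurable_fun setT (@sphere R i).
  by apply: measurable_fun_continuous; exact: continuous_sphere.
split; first exact: measurable_funM.
  by exists M => z; rewrite normrM; apply: le_trans (gM z); rewrite ler_piMl// sphere_bound.
move=> k f.
pose f' : {ffun 'I_k.+1 -> 'I_4} := [ffun j => if unlift ord0 j is Some j' then f j' else i].
have E z : sphere_mono f z * (sphere i z * g z) = sphere_mono f' z * g z.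
  rewrite mulrA [X in X * g z]mulrC /sphere_mono big_ord_recl ffunE unlift_none; congr (_ * _ * _).
  by apply: eq_bigr => j _; rewrite ffunE liftK.
by under eq_integral do rewrite E; under [RHS]eq_integral do rewrite E.
Qed.

Lemma same_moments_lim (g_ : nat -> C -> R) g (M : R) :
  (forall n, same_moments (g_ n)) -> (forall n z, `|g_ n z| <= M) ->
  (forall z, g_ n z @[n --> \oo] --> g z) -> same_moments g.
Proof.
move=> sg gM cg.
have mg_ n : measurable_fun setT (g_ n) by case: (sg n).
have mg : measurable_fun setT g.
  by apply: (measurable_fun_cvg mg_) => z _; exact: cg.
have gM' z : `|g z| <= M.
  have cn : `|g_ n z| @[n --> \oo] --> `|g z| by apply: cvg_norm; exact: cg.
  by apply: (cvgr_to_le cn); apply: nearW => n; exact: gM.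
split => //; first by exists M.
move=> k f.
have E (P : probability C R) :
  (\int[P]_z (sphere_mono f z * g_ n z)%:E)%E @[n --> \oo] -->
  (\int[P]_z (sphere_mono f z * g z)%:E)%E.
  have [|||||_ _ //] := @dominated_convergence _ _ _ P setT measurableT
    (fun n z => (sphere_mono f z * g_ n z)%:E) (fun z => (sphere_mono f z * g z)%:E) (cst M%:E).
  - move=> n; apply/measurable_EFinP; apply: measurable_funM => //.
    exact: measurable_sphere_mono.
  - apply/measurable_EFinP; apply: measurable_funM => //.
    exact: measurable_sphere_mono.
  - apply: aeW => z _; apply: cvg_EFin; first exact: nearW.
    by apply: cvgMr; exact: cg.
  - exact: finite_measure_integrable_cst.
  - apply: aeW => z n _; rewrite lee_fin normrM; apply: le_trans (gM n z).
    by rewrite ler_piMl// sphere_mono_bound.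
have e n : (\int[nu]_z (sphere_mono f z * g_ n z)%:E = \int[mu]_z (sphere_mono f z * g_ n z)%:E)%E.
  by case: (sg n) => _ _ ->.
have := E nu; under eq_cvg do rewrite e.
by move=> /cvg_lim <-//; move/cvg_lim : (E mu) => <-.
Qed.

Lemma same_momentsX (s : C -> R) n g :
  (forall h, same_moments h -> same_moments (fun z => s z * h z)) ->
  same_moments g -> same_moments (fun z => s z ^+ n * g z).
Proof.
move=> H sg; elim: n => [|n ih].
  by rewrite (_ : (fun z => _) = g)//; apply/funext => z; rewrite expr0 mul1r.
rewrite (_ : (fun z => _) = (fun z => s z * (s z ^+ n * g z))); first exact: H.
by apply/funext => z; rewrite exprS mulrA.
Qed.

(** The polynomials [plateau n] in the affine combination [s] of two coordinates converge boundedly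
    to the indicator of [s z < 2^-1]. The bound on the coefficients keeps [s] between 0 and 1. *)
Lemma same_moments_halfplane (a b : R) i j g :
  `|a| + `|b| <= 2^-1 -> same_moments g ->
  same_moments (fun z => (a * sphere i z + b * sphere j z < 0)%R%:R * g z).
Proof.
move=> ab sg.
pose s z := 2^-1 + (a * sphere i z + b * sphere j z).
have s01 z : 0 <= s z <= 1.
  have : `|a * sphere i z + b * sphere j z| <= 2^-1.
    apply: le_trans (ler_normD _ _) _; apply: le_trans ab.
    by rewrite (normrM a) (normrM b); apply: lerD; apply: ler_piMr => //; exact: sphere_bound.
  rewrite /s ler_norml => /andP[h1 h2]; lra.
have Hs h : same_moments h -> same_moments (fun z => s z * h z).
  move=> sh.
  have := same_moments_lin 2^-1 1 sh (same_moments_lin a b (same_moments_sphere i sh)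
    (same_moments_sphere j sh)).
  congr same_moments; apply/funext => z; rewrite /s; ring.
have Hp n h : same_moments h -> same_moments (fun z => plateau n (s z) * h z).
  apply: same_momentsX => u su.
  have := same_moments_lin 1 (-1) su (same_momentsX n Hs su).
  congr same_moments; apply/funext => z; ring.
have [_ [M gM] _] := sg.
apply: (@same_moments_lim (fun n z => plateau n (s z) * g z) _ M).
- by move=> n; exact: Hp.
- move=> n z; rewrite normrM; apply: le_trans (gM z); rewrite ler_piMl//.
  by have /andP[p0 p1] := plateau_01 n (s01 z); rewrite ger0_norm.
- move=> z; apply: cvgMl.
  rewrite (_ : (_ < 0)%R = (s z < 2^-1)%R); first exact: (cvg_plateau (s01 z)).
  by rewrite /s gtrDl.
Qed.

(** Quantifying over all weights [g] makes the family [S] of admissible sets closed under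
    intersection: indicators are multiplied in one after the other. Bounded limits then give
    countable unions. *)
Lemma same_moments_indic A g : measurable A -> same_moments g ->
  same_moments (fun z => (z \in A)%:R * g z).
Proof.
pose S : set (set C) := [set A : set C | forall g, same_moments g -> same_moments (fun z => (z \in
  A)%:R * g z)].
move=> mA; move: g; suff : S A by [].
have SI X Y : S X -> S Y -> S (X `&` Y).
  move=> SX SY g sg; have := SX _ (SY _ sg); congr same_moments.
  by apply/funext => z; rewrite in_setI mulrA -natrM mulnb.
have SC X : S X -> S (~` X).
  move=> SX g sg; have := same_moments_lin 1 (-1) sg (SX _ sg); congr same_moments.
  apply/funext => z; rewrite in_setC mul1r mulN1r.
  by case: (z \in X); rewrite /= ?mulr1n ?mulr0n ?mul1r ?mul0r ?subrr ?subr0.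
move: A mA; apply: borel_plane_ind.
- split.
  + move=> g sg; have := same_moments_lin 0 0 sg sg; congr same_moments.
    by apply/funext => z; rewrite in_set0 !mul0r addr0.
  + by move=> X SX; rewrite setTD; exact: SC.
  + move=> F SF g sg.
    have SU n : S (\bigcup_(k in `I_n) F k).
      elim: n => [|n ih]; last first.
        rewrite (_ : \bigcup_(k in `I_n.+1) F k = ~` (~` (\bigcup_(k in `I_n) F k) `&` ~` F n)).
          by apply: (SC); apply: (SI); apply: (SC).
        by rewrite setCI !setCK !bigcup_mkord big_ord_recr.
      rewrite II0 bigcup_set0 => h sh.
      have := same_moments_lin 0 0 sh sh; congr same_moments.
      by apply/funext => z; rewrite in_set0 !mul0r addr0.
    have [_ [M gM] _] := sg.
    apply: (same_moments_lim (g_ := fun n z => (z \in \bigcup_(k in `I_n) F k)%:R * g z) (M := M)).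
    * by move=> n; exact: SU.
    * move=> n z; rewrite normrM; apply: le_trans (gM z); rewrite ler_piMl//.
      by case: (z \in _); rewrite ?normr1 ?normr0.
    * move=> z; apply: cvgMl; apply: cvg_near_cst.
      have [[k _ Fk]|nF] := pselect ((\bigcup_k F k) z).
        exists k.+1 => // n /= kn.
        by rewrite !mem_set//; [exists k|exists k].
      apply: nearW => n; rewrite !memNset//.
      by move=> [k _ Fk]; apply: nF; exists k.
- move=> a g sg.
  (* The coordinates 1 and 0 share the denominator [nsq1 z], so the sign of [Re z - a] is that of a
     combination of them; [c] scales its coefficients to total size 1/2. *)
  pose c : R := (2 * (1 + Num.sqrt 2 * `|a|))^-1.
  have d0 : 0 < 2 * (1 + Num.sqrt 2 * `|a|) :> R by rewrite mulr_gt0// ltr_pwDl// mulr_ge0//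
    sqrtr_ge0.
  have c0 : 0 < c by rewrite invr_gt0.
  have := @same_moments_halfplane c (- (c * (Num.sqrt 2 * a))) (inord 1) ord0 g.
  have -> : `|c| + `|- (c * (Num.sqrt 2 * a))| <= 2^-1.
    rewrite normrN !normrM (ger0_norm (ltW c0)) (ger0_norm (sqrtr_ge0 _)).
    by rewrite -[X in X + _]mulr1 -mulrDr /c invfM mulfVK// gt_eqF// ltr_pwDl// mulr_ge0//
      sqrtr_ge0.
  move=> /(_ isT sg); congr same_moments; apply/funext => z; congr (_%:R * _).
  rewrite /sphere inordK//= mem_setE/=.
  have -> : c * (Num.sqrt 2 * Re z / nsq1 z) + - (c * (Num.sqrt 2 * a)) * (1 / nsq1 z) =
     (c * Num.sqrt 2 / nsq1 z) * (Re z - a) by ring.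
  by rewrite pmulr_rlt0 ?subr_lt0// divr_gt0 ?nsq1_gt0// mulr_gt0// sqrtr_gt0.
- move=> a g sg.
  pose c : R := (2 * (1 + Num.sqrt 2 * `|a|))^-1.
  have d0 : 0 < 2 * (1 + Num.sqrt 2 * `|a|) :> R by rewrite mulr_gt0// ltr_pwDl// mulr_ge0//
    sqrtr_ge0.
  have c0 : 0 < c by rewrite invr_gt0.
  have := @same_moments_halfplane c (- (c * (Num.sqrt 2 * a))) (inord 2) ord0 g.
  have -> : `|c| + `|- (c * (Num.sqrt 2 * a))| <= 2^-1.
    rewrite normrN !normrM (ger0_norm (ltW c0)) (ger0_norm (sqrtr_ge0 _)).
    by rewrite -[X in X + _]mulr1 -mulrDr /c invfM mulfVK// gt_eqF// ltr_pwDl// mulr_ge0//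
      sqrtr_ge0.
  move=> /(_ isT sg); congr same_moments; apply/funext => z; congr (_%:R * _).
  rewrite /sphere inordK//= mem_setE/=.
  have -> : c * (Num.sqrt 2 * Im z / nsq1 z) + - (c * (Num.sqrt 2 * a)) * (1 / nsq1 z) =
     (c * Num.sqrt 2 / nsq1 z) * (Im z - a) by ring.
  by rewrite pmulr_rlt0 ?subr_lt0// divr_gt0 ?nsq1_gt0// mulr_gt0// sqrtr_gt0.
Qed.

Lemma eq_measure_moment : (forall k (f : {ffun 'I_k -> 'I_4}), moment nu f = moment mu f) ->
  forall A, measurable A -> nu A = mu A.
Proof.
move=> emom A mA.
have s1 : same_moments (fun=> 1).
  split; [by []|by exists 1 => z; rewrite normr1|move=> k f].
  by under eq_integral do rewrite mulr1; under [RHS]eq_integral do rewrite mulr1;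
    rewrite -!EFin_moment emom.
have [_ _ /(_ 0 [ffun _ => ord0])] := same_moments_indic mA s1.
under eq_integral do rewrite mulr1 /sphere_mono big_ord0 mul1r.
under [RHS]eq_integral do rewrite mulr1 /sphere_mono big_ord0 mul1r.
have E (P : probability C R) : (\int[P]_z ((z \in A)%:R)%:E = P A)%E.
  transitivity (\int[P]_z (\1_A z)%:E)%E; last by rewrite integral_indic// setIT.
  by apply: eq_integral => z _; rewrite indicE.
by rewrite !E.
Qed.

End measure_of_moments.

(** * Uniqueness through positive definiteness *)

Section uniqueness.
Context {R : realType}.
Local Notation C := R[i].
Implicit Types nu mu : probability C R.
Local Open Scope ereal_scope.

Lemma nneseries_squeeze_eq (x y : nat -> R) : (forall k, 0 <= y k)%R ->
  (forall k, y k <= x k)%R -> \sum_(0 <= k <oo) (x k)%:E <= \sum_(0 <= k <oo) (y k)%:E ->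
  \sum_(0 <= k <oo) (x k)%:E < +oo -> forall k, x k = y k.
Proof.
move=> y0 yx sxy sx k.
have x0 j : (0 <= x j)%R by exact: le_trans (yx j).
pose d j := (x j - y j)%R.
have d0 j : (0 <= d j)%R by rewrite subr_ge0.
have sE : \sum_(0 <= j <oo) (x j)%:E = \sum_(0 <= j <oo) (y j)%:E + \sum_(0 <= j <oo) (d j)%:E.
  rewrite -nneseriesD; last 2 first.
  - by move=> j _ _; rewrite lee_fin.
  - by move=> j _ _; rewrite lee_fin.
  by apply: eq_eseriesr => j _; rewrite -EFinD /d addrC subrK.
have sy : \sum_(0 <= j <oo) (y j)%:E \is a fin_num.
  rewrite ge0_fin_numE; last by apply: nneseries_ge0 => j _ _; rewrite lee_fin.
  apply: le_lt_trans sx; apply: lee_nneseries => j _; by rewrite lee_fin.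
have sd : \sum_(0 <= j <oo) (d j)%:E <= 0.
  by move: sxy; rewrite sE -[leRHS]adde0 leeD2lE.
have : (d k)%:E <= 0.
  apply: le_trans sd; rewrite (@nneseriesD1 _ _ k)//; last by move=> j _; rewrite lee_fin.
  by rewrite leeDl//; apply: nneseries_ge0 => j _ _; rewrite lee_fin.
rewrite lee_fin subr_le0 => xy; apply/eqP; by rewrite eq_le xy yx.
Qed.

Lemma pair_moment_sub nu mu k :
  (pair_moment nu nu k + pair_moment mu mu k - 2 * pair_moment nu mu k =
  \sum_(f : {ffun 'I_k -> 'I_4}) (moment nu f - moment mu f) ^+ 2)%R.
Proof.
rewrite /pair_moment mulr_sumr -sumrN -!big_split /=.
by apply: eq_bigr => f _; ring.
Qed.

Lemma moment0 nu (f : {ffun 'I_0 -> 'I_4}) : moment nu f = 1%R.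
Proof.
apply: EFin_inj; rewrite EFin_moment; under eq_integral do rewrite /sphere_mono big_ord0.
by rewrite integral_cst// measure_probT mule1.
Qed.

(** The sum of both chordal energies minus twice the mutual one is a series of squares of
    differences of moments with positive weights. The means of [lnw] cancel and the hypotheses make
    this series at most 0, so all squares vanish. *)
Lemma eq_measure_energy nu mu (V : R) : lnw_integrable nu -> lnw_integrable mu ->
  energy nu <= V%:E -> energy mu <= V%:E -> V%:E <= \int[nu]_z log_pot mu z ->
  forall A, measurable A -> nu A = mu A.
Proof.
move=> inu imu; rewrite !energyE// integral_log_pot// => enu emu enm.
(* The series only sees moments of positive order; the moment of order 0 is the total mass. *)
apply: eq_measure_moment => -[|k] f; first by rewrite !moment0.
set a := lnw_mean nu in enu enm; set b := lnw_mean mu in emu enm.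
have {}enu : chord_energy nu nu <= (V + (a + a))%:E by rewrite EFinD -leeBlDr.
have {}emu : chord_energy mu mu <= (V + (b + b))%:E by rewrite EFinD -leeBlDr.
have {}enm : (V + (a + b))%:E <= chord_energy nu mu by rewrite EFinD -leeBrDr.
pose x k := (kcoef k * (pair_moment nu nu k.+1 + pair_moment mu mu k.+1))%R.
pose y k := (kcoef k * (2 * pair_moment nu mu k.+1))%R.
have sx : \sum_(0 <= k <oo) (x k)%:E = chord_energy nu nu + chord_energy mu mu.
  rewrite /chord_energy -nneseriesD; last 2 first.
  - by move=> j _ _; rewrite lee_fin mulr_ge0 ?kcoef_ge0 ?pair_moment_ge0.
  - by move=> j _ _; rewrite lee_fin mulr_ge0 ?kcoef_ge0 ?pair_moment_ge0.
  by apply: eq_eseriesr => j _; rewrite -EFinD /x mulrDr.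
have sy : \sum_(0 <= k <oo) (y k)%:E = 2%:E * chord_energy nu mu.
  rewrite /chord_energy -nneseriesZl; last first.
    by move=> j _; rewrite lee_fin mulr_ge0 ?kcoef_ge0 ?pair_moment_ge0.
  by apply: eq_eseriesr => j _; rewrite -EFinM /y mulrCA.
have : forall k, x k = y k.
  apply: nneseries_squeeze_eq.
  - by move=> j; rewrite /y !mulr_ge0 ?kcoef_ge0 ?pair_moment_ge0.
  - move=> j; rewrite ler_wpM2l ?kcoef_ge0// -subr_ge0 pair_moment_sub.
    by apply: sumr_ge0 => g _; rewrite sqr_ge0.
  - rewrite sx sy; apply: le_trans (leeD enu emu) _.
    apply: le_trans (_ : 2%:E * (V + (a + b))%:E <= _).
      by rewrite -EFinM -EFinD lee_fin; lra.
    by apply: lee_wpmul2l => //; rewrite lee_fin.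
  - by rewrite sx; apply: le_lt_trans (leeD enu emu) _; rewrite ltry.
move=> /(_ k) /eqP; rewrite /x /y (inj_eq (mulfI (lt0r_neq0 (kcoef_gt0 k)))).
rewrite -subr_eq0 pair_moment_sub psumr_eq0 => [|g _]; last exact: sqr_ge0.
by move=> /allP/(_ f); rewrite mem_index_enum => /(_ isT); rewrite sqrf_eq0 subr_eq0 => /eqP.
Qed.

End uniqueness.

(** * Weak limits of empirical measures *)

Section sorted_prefix.
Context {T : Type} (leT : rel T) (P : pred T).

(** A downward closed predicate holds on an initial segment of a sorted list, so membership of the
    [j]-th point becomes a threshold on the index [j]. *)
Lemma nth_sorted_prefix (x0 : T) s j : transitive leT -> sorted leT s ->
  (forall x y, leT x y -> P y -> P x) -> (j < size s)%N ->
  P (nth x0 s j) = (j < count P s)%N.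
Proof.
move=> leT_tr + Pdown; elim: s j => [//|x s ih] j.
rewrite /= path_sortedE// => /andP[xs ss].
have [Px|nPx] := boolP (P x).
  by case: j => [|j] /=; [rewrite Px|rewrite ltnS => js; rewrite ih// add1n ltnS].
have cs : count P s = 0%N.
  apply/eqP; rewrite eqn0Ngt -has_count; apply/negP.
  elim: s xs {ss ih} => [//|y s ih] /= /andP[xy xs] /orP[Py|]; last exact: ih.
  by move/negP : nPx; apply; exact: Pdown xy Py.
rewrite cs addn0 ltn0 => js; apply/negbTE.
case: j js => [//|j] /=; rewrite ltnS => js; move: (ih j ss js); rewrite cs ltn0 => ->//.
Qed.

End sorted_prefix.

(** * Dyadic codes of points of a square *)

Section dyadic_code.
Context {R : realType}.
Local Notation C := R[i].
Local Notation normc := Normc.normc.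
Implicit Types (x y : R) (z w : C).

Definition dyadic n x : nat := Num.truncn (2 ^+ n * x).

Lemma dyadic0 x : 0 <= x < 1 -> dyadic 0 x = 0%N.
Proof. by move=> /andP[x0 x1]; apply: truncn_def; rewrite expr0 mul1r x0. Qed.

Lemma dyadicS n x : 0 <= x -> (dyadic n.+1 x)./2 = dyadic n x.
Proof.
move=> x0; have y0 : 0 <= 2 ^+ n * x by rewrite mulr_ge0// exprn_ge0.
apply/eqP; rewrite eq_sym truncn_eq//.
have := @truncn_itv R (2 ^+ n.+1 * x); rewrite mulr_ge0 ?exprn_ge0// => /(_ isT).
rewrite -/(dyadic n.+1 x); set m := dyadic n.+1 x.
rewrite exprS -mulrA; set t := 2 ^+ n * x => /andP[h1 h2].
have e : m = (odd m + m./2.*2)%N by rewrite odd_double_half.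
have h3 : (m./2)%:R * 2 <= m%:R :> R by rewrite -natrM ler_nat; lia.
have h4 : m.+1%:R <= (m./2.+1)%:R * 2 :> R by rewrite -natrM ler_nat; case: (odd m) e; lia.
apply/andP; split; lra.
Qed.

Lemma dyadic_near n x y : 0 <= x -> 0 <= y -> dyadic n x = dyadic n y ->
  `|x - y| <= (2 ^+ n)^-1.
Proof.
move=> x0 y0 e.
have p0 : (0 : R) < 2 ^+ n by rewrite exprn_gt0.
have := @truncn_itv R (2 ^+ n * x); rewrite mulr_ge0 ?(ltW p0)// => /(_ isT).
have := @truncn_itv R (2 ^+ n * y); rewrite mulr_ge0 ?(ltW p0)// => /(_ isT).
rewrite -/(dyadic n x) -/(dyadic n y) e -natr1 => /andP[h1 h2] /andP[h3 h4].
rewrite -[leRHS]mul1r ler_pdivlMr// -(ger0_norm (ltW p0)) -normrM mulrBl ler_norml.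
rewrite ![_ * 2 ^+ n]mulrC; apply/andP; split; lra.
Qed.

(* Interleaving the dyadic digits of both coordinates orders the points of a
   square so that every dyadic cell is an interval for the order. *)
Fixpoint code (M : R) n z : nat :=
  if n is n'.+1 then
    (4 * code M n' z + (2 * odd (dyadic n ((Re z + M) / (2 * M)))
                        + odd (dyadic n ((Im z + M) / (2 * M)))))%N
  else 0%N.

Lemma code_div M n z : (code M n.+1 z %/ 4)%N = code M n z.
Proof.
rewrite /= mulnC divnMDl//.
by case: (odd _); case: (odd _); rewrite addn0.
Qed.

(** A coarse code is the quotient of a finer one by a power of 4, so a list sorted by a fine code is
    sorted by all coarser ones. *)
Lemma leq_code M n m z w : (n <= m)%N -> (code M m z <= code M m w)%N ->
  (code M n z <= code M n w)%N.
Proof.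
elim: m => [|m ih]; first by rewrite leqn0 => /eqP ->.
rewrite leq_eqVlt => /orP[/eqP -> //|]; rewrite ltnS => nm h.
by apply: ih => //; rewrite -(code_div M m z) -(code_div M m w) leq_div2r.
Qed.

Lemma code_lt M n z : (code M n z < 4 ^ n)%N.
Proof.
elim: n => [//|n ih]; rewrite expnS /=.
by case: (odd _); case: (odd _); lia.
Qed.

(** Each base-4 digit of the code holds one binary digit of either coordinate; equal codes therefore
    mean equal dyadic cells in both coordinates. *)
Lemma code_near M n z w : 0 < M -> normc z < M -> normc w < M ->
  code M n z = code M n w -> `|Re z - Re w| <= 2 * M / 2 ^+ n /\
                             `|Im z - Im w| <= 2 * M / 2 ^+ n.
Proof.
move=> M0 zM wM.
have unit (x : R) : `|x| < M -> 0 <= (x + M) / (2 * M) < 1.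
  rewrite ltr_norml => /andP[h1 h2].
  rewrite divr_ge0 ?ltr_pdivrMr ?mulr_gt0//=; [lra|lra|by rewrite mulr_ge0 ?ltW].
have uRe u : normc u < M -> 0 <= (Re u + M) / (2 * M) < 1.
  by move=> uM; apply: unit; exact: le_lt_trans (Re_le_normc u) uM.
have uIm u : normc u < M -> 0 <= (Im u + M) / (2 * M) < 1.
  by move=> uM; apply: unit; exact: le_lt_trans (Im_le_normc u) uM.
move=> ec.
have [eR eI] : dyadic n ((Re z + M) / (2 * M)) = dyadic n ((Re w + M) / (2 * M)) /\
   dyadic n ((Im z + M) / (2 * M)) = dyadic n ((Im w + M) / (2 * M)).
  elim: n ec => [_|n ih e].
    by rewrite !dyadic0//; [exact: uIm|exact: uIm|exact: uRe|exact: uRe].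
  have e0 : code M n z = code M n w by rewrite -(code_div M n z) -(code_div M n w) e.
  have {}ih := ih e0.
  have /andP[rz _] := uRe z zM; have /andP[rw _] := uRe w wM.
  have /andP[iz _] := uIm z zM; have /andP[iw _] := uIm w wM.
  have [ih1 ih2] := ih.
  move: e => /=.
  rewrite -(odd_double_half (dyadic n.+1 ((Re z + M) / (2 * M)))) -(odd_double_half (dyadic n.+1
    ((Re w + M) / (2 * M)))).
  rewrite -(odd_double_half (dyadic n.+1 ((Im z + M) / (2 * M)))) -(odd_double_half (dyadic n.+1
    ((Im w + M) / (2 * M)))).
  rewrite !dyadicS// ih1 ih2 !oddD !odd_double !addbF !oddb.
  rewrite e0 => /addnI e.
  do 4 (case: (odd _) e => /= e); split=> //; lia.
have /andP[rz _] := uRe z zM; have /andP[rw _] := uRe w wM.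
have /andP[iz _] := uIm z zM; have /andP[iw _] := uIm w wM.
have sc (x y : R) : `|(x + M) / (2 * M) - (y + M) / (2 * M)| <= (2 ^+ n)^-1 ->
    `|x - y| <= 2 * M / 2 ^+ n.
  rewrite -mulrBl opprD addrACA subrr addr0 normrM normfV (ger0_norm (_ : 0 <= 2 * M)); last lra.
  by rewrite ler_pdivrMr 1?mulrC// mulr_gt0.
by split; apply: sc; apply: dyadic_near.
Qed.

End dyadic_code.

Section diagonal.
Context {R : realType}.

(** A cluster point in the compact product of unit intervals replaces the diagonal extraction: [e k]
    is an index past [k] at which the coordinates up to [k] are within [k.+1%:R^-1] of it. No
    monotonicity of [e] is claimed; [k <= e k] suffices for limits along it. *)
Lemma bounded_diagonal (B : nat -> nat * nat -> R) :
  (forall n j, 0 <= B n j <= 1) ->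
  exists b : nat * nat -> R, exists e : nat -> nat, (forall k, (k <= e k)%N) /\
    forall j, B (e k) j @[k --> \oo] --> b j.
Proof.
move=> B01.
pose I01 (j : nat * nat) := `[0, 1]%classic : set R.
pose X := prod_topology (fun _ : nat * nat => R).
have cK : compact [set f : X | forall j, I01 j (f j)].
  by apply: (@tychonoff _ (fun _ : nat * nat => R)) => j; exact: segment_compact.
have [|b [_ clb]] := cK ((B : nat -> X) @ \oo) _.
  by exists 0%N => // n _ j; rewrite /I01 /= in_itv /=; exact: B01.
have nb (l : seq (nat * nat)) (eps : R) : 0 < eps ->
    nbhs b [set f : X | forall j, j \in l -> `|f j - b j| < eps].
  move=> eps0; elim: l => [|j l ih]; first exact: filterS filterT.
  have nj : nbhs b [set f : X | `|f j - b j| < eps].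
    have := @proj_continuous (nat * nat)%type (fun=> R) j b.
    move=> /(_ [set x | `|x - b j| < eps]) ; apply.
    by apply/nbhs_ballP; exists eps => //= x; rewrite -ball_normE /= distrC.
  apply: filterS (filterI nj ih) => f [/= fj fl] i; rewrite inE => /orP[/eqP -> //|]; exact: fl.
have ex k : exists n, (k <= n)%N /\
    forall j, (j.1 <= k)%N -> (j.2 <= k)%N -> `|B n j - b j| < k.+1%:R^-1.
  have kp : 0 < (k.+1%:R^-1 : R) by rewrite invr_gt0.
  pose l := [seq (i, w) | i <- iota 0 k.+1, w <- iota 0 k.+1].
  have tl : ((B : nat -> X) @ \oo) [set f : X | exists2 n, (k <= n)%N & f = B n].
    by exists k => // n /= kn; exists n.
  have [f [[n kn ->] fl]] := clb _ _ tl (nb l _ kp).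
  exists n; split=> // j j1 j2; apply: fl; apply/allpairsP; exists j.
  by rewrite !mem_iota /= !add0n !ltnS; split=> //; case: (j).
have [e eP] := choice ex.
exists b, e; split=> [k|j]; first by case: (eP k).
apply/cvgrPdist_lt => eps eps0.
near=> k.
rewrite distrC; apply: lt_trans (_ : k.+1%:R^-1 < eps).
  by case: (eP k) => _; apply; near: k; exact: nbhs_infty_ge.
by near: k; exact: (near_infty_natSinv_lt (PosNum eps0)).
Unshelve. all: by end_near. Qed.

End diagonal.

Section unit_interval.
Context {R : realType}.

Definition unif01 : probability (measurableTypeR R) R := uniform_prob (@ltr01 R).

Lemma unif01E (A : set R) : measurable A ->
  unif01 A = lebesgue_measure (A `&` `[0, 1]%classic).
Proof.
move=> mA.
have -> : unif01 A = (\int[unif01]_x (\1_A x)%:E)%E by rewrite integral_indic// setIT.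
rewrite integral_uniform//.
  by rewrite subr0 invr1 mul1e integral_indic.
by apply/measurable_EFinP; exact: measurable_indic.
Qed.

Lemma unif01_itvco (a b : R) : 0 <= a -> a <= b -> b <= 1 ->
  unif01 `[a, b[%classic = (b - a)%:E.
Proof.
move=> a0 ab b1; rewrite unif01E//.
have -> : `[a, b[%classic `&` `[0, 1]%classic = `[a, b[%classic :> set R.
  apply/setIidPl => x /=; rewrite !in_itv /= => /andP[ax xb].
  by rewrite (le_trans a0 ax) (ltW (lt_le_trans xb b1)).
rewrite lebesgue_measure_itv /= lte_fin; have [//|ba] := ltP a b.
by rewrite (_ : a = b) ?subrr//; apply/eqP; rewrite eq_le ab.
Qed.

Lemma unif01_itvcoC : unif01 (~` `[0, 1[%classic) = 0%E.
Proof. by rewrite probability_setC// unif01_itvco// subr0 subee. Qed.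

Lemma measurable_truncn (N : R) :
  measurable_fun setT (fun x : R => Num.truncn (N * x)).
Proof.
move=> _ Y _; rewrite setTI.
have -> : (fun x : R => Num.truncn (N * x)) @^-1` Y =
   \bigcup_(j in Y) ((fun x : R => Num.truncn (N * x)) @^-1` [set j]).
  apply/seteqP; split=> [x Yx|x [j Yj /= xj]]; first by exists (Num.truncn (N * x)).
  by rewrite /preimage /= xj.
apply: bigcup_measurable => j _.
have m1 (n : nat) : measurable [set x : R | (Num.truncn (N * x) <= n)%N].
  have -> : [set x : R | (Num.truncn (N * x) <= n)%N] = setT `&` (fun x : R => N * x) @^-1` `]-oo,
    n.+1%:R[%classic.
    by apply/seteqP; split=> x /=; rewrite in_itv /= truncn_le_nat => //; case.
  have mN : measurable_fun setT (fun x : R => N * x) by exact: measurable_funM.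
  by apply: mN.
have -> : (fun x : R => Num.truncn (N * x)) @^-1` [set j] =
    [set x : R | (Num.truncn (N * x) <= j)%N] `\`
    (if j is i.+1 then [set x : R | (Num.truncn (N * x) <= i)%N] else set0).
  apply/seteqP; split=> x /=.
    move=> e; split; first by rewrite e.
    by case: j e => [|j] e //=; rewrite e ltnn.
  case: j => [|j] [h1 h2]; first by move: h1; rewrite leqn0 => /eqP.
  by apply/eqP; rewrite eqn_leq h1 ltnNge; apply/negP.
apply: measurableD; first exact: m1.
by case: j => [|j]; [exact: measurable0|exact: m1].
Qed.

(** Means over lists of different lengths become integrals over one and the same probability space,
    where dominated convergence applies. *)
Lemma integral_step (N : nat) (a : nat -> R) : (0 < N)%N ->
  (\int[unif01]_x (a (Num.truncn (N%:R * x)))%:E = (N%:R^-1 * \sum_(j < N) a j)%:E)%E.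
Proof.
move=> N0.
have N0' : 0 < N%:R :> R by rewrite ltr0n.
pose I (j : nat) : set R := `[j%:R / N%:R, j.+1%:R / N%:R[%classic.
transitivity (\int[unif01]_x (\sum_(j < N) a j * \1_(I j) x)%:E)%E.
  apply: ae_eq_integral => //.
  - apply/measurable_EFinP; apply: (measurableT_comp (f := a)) => //; exact: measurable_truncn.
  - apply/measurable_EFinP; apply: measurable_sum => j.
    by apply: measurable_funM => //; apply: measurable_indic; exact: measurable_itv.
  exists (~` `[0, 1[%classic); split; [exact: measurableC|exact: unif01_itvcoC|].
  move=> x /= H x01; apply: H => _; congr EFin.
  move: x01; rewrite /= in_itv/= => /andP[x0 x1].
  have y0 : 0 <= N%:R * x by rewrite mulr_ge0// ltW.
  have jN : (Num.truncn (N%:R * x) < N)%N by rewrite truncn_lt_nat// gtr_pMr.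
  have xI (j : nat) : (x \in I j) = (j == Num.truncn (N%:R * x)).
    rewrite mem_setE /= in_itv /= ler_pdivrMr// ltr_pdivlMr// mulrC.
    by rewrite [j == _]eq_sym truncn_eq.
  rewrite (bigD1 (Ordinal jN))//= indicE xI eqxx mulr1 big1 ?addr0// => j jn.
  rewrite indicE xI (_ : (_ == _ :> nat) = false) ?mulr0//.
  by apply/negbTE; move: jn; rewrite -val_eqE.
under eq_integral do rewrite -sumEFin.
have ii (j : 'I_N) : unif01.-integrable setT (fun x => (\1_(I j) x)%:E).
  by apply: integrable_indic => //; exact: measurable_itv.
rewrite integral_sum//=; last first.
  by move=> j; exact: (integrableZl measurableT (a j) (ii j)).
rewrite mulr_sumr -sumEFin; apply: eq_bigr => j _.
under eq_integral do rewrite EFinM.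
rewrite (integralZl measurableT (ii j)).
have -> : (\int[unif01]_x (\1_(I j) x)%:E = unif01 (I j))%E.
  by rewrite integral_indic ?setIT//; exact: measurable_itv.
rewrite unif01_itvco.
- by rewrite -EFinM; congr EFin; rewrite -mulrBl -natr1 addrAC subrr add0r mul1r mulrC.
- by rewrite divr_ge0// ltW.
- by rewrite ler_pM2r ?invr_gt0// ler_nat.
- by rewrite ler_pdivrMr// mul1r ler_nat.
Qed.

End unit_interval.

(** * Convergent subsequences of empirical measures *)

Section selection.
Context {R : realType}.
Local Notation C := R[i].
Local Notation normc := Normc.normc.

Lemma ReB (z w : C) : Re (z - w) = Re z - Re w.
Proof. by case: z w => a b []. Qed.

Lemma ImB (z w : C) : Im (z - w) = Im z - Im w.
Proof. by case: z w => a b []. Qed.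

Definition seq_mean (phi : C -> R) (s : seq C) : R :=
  (size s)%:R^-1 * \sum_(z <- s) phi z.

Lemma cvg_plane_comp (phi : C -> R) (u : nat -> C) z : continuous phi ->
  Re (u n) @[n --> \oo] --> Re z -> Im (u n) @[n --> \oo] --> Im z ->
  phi (u n) @[n --> \oo] --> phi z.
Proof.
move=> cphi cR cI; apply/cvgrPdist_lt => e e0.
have [d d0 dP] := (continuous_normcP phi z).1 (cphi z) e e0.
have d2 : 0 < d / 2 by rewrite divr_gt0.
near=> n; rewrite distrC; apply: dP.
apply: le_lt_trans (normc_le_ReIm _) _; rewrite [d]splitr; apply: ltrD.
  by rewrite ReB distrC; near: n; move/cvgrPdist_lt : cR; exact.
by rewrite ImB distrC; near: n; move/cvgrPdist_lt : cI; exact.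
Unshelve. all: by end_near. Qed.

Lemma continuous_bounded_ball (phi : C -> R) (M : R) : continuous phi ->
  exists K : R, forall z, normc z <= M -> `|phi z| <= K.
Proof.
move=> cphi.
have cB : compact [set z : C | normc z <= M].
  by apply: (@bounded_closed_plane_compact _ M) => //; exact: closed_normc_ball.
have := compact_bounded (continuous_compact (continuous_subspaceT cphi) cB).
move=> [K [_ KP]]; exists (K + 1) => z zM.
by apply: (KP (K + 1)); [rewrite ltrDl|exists z].
Qed.

(* Listing the points of each tuple in the order of their dyadic codes turns the
   empirical measures into images of Lebesgue measure under step functions of
   uniformly bounded complexity; along a subsequence these converge off a
   countable set. *)
Lemma seq_mean_selection (s : nat -> seq C) (M : R) :
  (forall k, (0 < size (s k))%N) -> (forall k z, z \in s k -> normc z <= M) ->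
  exists (e : nat -> nat) (tau : probability C R),
    [/\ forall k, (k <= e k)%N,
        forall A, measurable A -> (forall z, A z -> M < normc z) -> tau A = 0%E &
        forall phi : C -> R, continuous phi ->
          (seq_mean phi (s (e k)))%:E @[k --> \oo] --> (\int[tau]_z (phi z)%:E)%E].
Proof.
move=> s_gt0 sM.
have M0 : 0 <= M.
  move: (s_gt0 0%N) (sM 0%N); case: (s 0%N) => [//|z r] _ /(_ z).
  by rewrite inE eqxx => /(_ isT); exact: le_trans (normc_ge0 z).
pose M' := M + 1.
have M'0 : 0 < M' by rewrite ltr_wpDl.
pose N k := size (s k).
have N0 k : 0 < (N k)%:R :> R by rewrite ltr0n s_gt0.
pose lec k (z w : C) := (code M' k z <= code M' k w)%N.
pose t k := sort (lec k) (s k).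
have lec_tr k : transitive (lec k) by move=> y x z; exact: leq_trans.
have tsorted k : sorted (lec k) (t k) by apply: sort_sorted => x y; exact: leq_total.
have tperm k : perm_eq (t k) (s k) by rewrite perm_sort.
have tsize k : size (t k) = N k by rewrite size_sort.
pose q k (x : R) : C := nth 0 (t k) (Num.truncn ((N k)%:R * x)).
(* The proportion of points whose code at level [j.1] is below [j.2]. By sortedness it is the
   threshold in the unit interval before which [q k] takes exactly those points. *)
pose B k (j : nat * nat) : R := (count (fun z => (code M' j.1 z < j.2)%N) (s k))%:R / (N k)%:R.
have B01 k j : 0 <= B k j <= 1.
  by rewrite /B divr_ge0//= ler_pdivrMr// mul1r ler_nat count_size.
have [b [e [ek eb]]] := bounded_diagonal B01.
have qmem k x : 0 <= x < 1 -> q k x \in s k.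
  move=> /andP[x0 x1]; rewrite -(perm_mem (tperm k)); apply: mem_nth.
  by rewrite tsize truncn_lt_nat ?mulr_ge0 ?gtr_pMr// ltW.
have qM k x : 0 <= x < 1 -> normc (q k x) <= M by move=> x01; exact: (sM k _ (qmem k x x01)).
have qcode k i w x : (i <= k)%N -> 0 <= x < 1 -> (code M' i (q k x) < w)%N = (x < B k (i, w)).
  move=> ik /andP[x0 x1].
  have y0 : 0 <= (N k)%:R * x by rewrite mulr_ge0// ltW.
  rewrite /q (@nth_sorted_prefix _ (lec k) (fun z => (code M' i z < w)%N)) //; last 2 first.
  - by move=> z v zv; apply: leq_ltn_trans; exact: leq_code zv.
  - by rewrite tsize truncn_lt_nat// gtr_pMr.
  rewrite truncn_lt_nat// ltr_pdivlMr// mulrC.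
  by have /permP -> := tperm k.
(* Away from the limit thresholds every comparison of [x] with [B (e k) j] is eventually constant in
   [k]; the discarded values are countable, hence null. *)
pose G : set R := `[0, 1[%classic `\` range b.
have cb : countable (range b) by apply: sub_countable (card_image_le _ _) _.
have mb : measurable (range b) by apply: countable_measurable.
have mG : measurable G by apply: measurableD.
have PG : unif01 (~` G) = 0%E.
  rewrite /G setCD; apply/eqP; rewrite -measure_le0.
  apply: le_trans (measureU2 _ _ _) _ => //; first exact: measurableC.
  have Pb : unif01 (range b) = 0%E.
    rewrite unif01E//; apply: countable_lebesgue_measure0.
    by apply: sub_countable cb; apply: subset_card_le; exact: subIsetl.
  by rewrite -[leRHS]adde0; apply: leeD; [rewrite -unif01_itvcoC|rewrite -Pb].
have G01 x : G x -> 0 <= x < 1 by move=> []; rewrite /= in_itv.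
(* The value 0 off [G] makes both coordinates converge everywhere, so that the limit map is defined
   and measurable on the whole line. *)
pose h k (x : R) : C := if x \in G then q (e k) x else 0.
have hM k x : normc (h k x) <= M.
  rewrite /h; case: ifPn => [|_]; last by rewrite Normc.normc0.
  by rewrite inE => /G01; exact: qM.
have hcode x i : G x -> exists K, forall k k', (K <= k)%N -> (K <= k')%N ->
    code M' i (h k x) = code M' i (h k' x).
  move=> Gx; have x01 := G01 _ Gx.
  have ev w : exists K, forall k, (K <= k)%N -> (x < B (e k) (i, w)) = (x < b (i, w)).
    have xb : x != b (i, w).
      by apply/eqP => xb; case: Gx => _; apply; exists (i, w).
    have d0 : 0 < `|x - b (i, w)| by rewrite normr_gt0 subr_eq0.
    have /cvgrPdist_lt /(_ _ d0) [K _ KP] := eb (i, w).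
    exists K => k /KP /= hk.
    have [xlt|xge] := ltP x (b (i, w)).
      have de : `|x - b (i, w)| = b (i, w) - x by rewrite ltr0_norm ?subr_lt0// opprB.
      by move: hk; rewrite de ltr_distlC subKr => /andP[].
    have de : `|x - b (i, w)| = x - b (i, w) by rewrite ger0_norm ?subr_ge0.
    move: hk; rewrite de ltr_distlC => /andP[_].
    by rewrite addrC subrK => h2; apply/negbTE; rewrite -leNgt ltW.
  have [K KP] := choice ev.
  (* Codes at level [i] are below [4 ^ i], so finitely many thresholds determine them. Taking [K0]
     at least [i] ensures that the lists are sorted at a level finer than [i]. *)
  pose K0 := maxn i (\max_(w < (4 ^ i).+1) K w).
  exists K0 => k k' Kk Kk'.
  have hE j : h j x = q (e j) x by rewrite /h mem_set.
  have lt_eq w : (w <= 4 ^ i)%N -> (code M' i (h k x) < w)%N = (code M' i (h k' x) < w)%N.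
    move=> w4; rewrite !hE.
    have Kw : (K w <= K0)%N.
      apply: leq_trans (leq_maxr _ _).
      have w4' : (w < (4 ^ i).+1)%N by [].
      exact: (leq_bigmax (Ordinal w4')).
    have iK : (i <= K0)%N by exact: leq_maxl.
    rewrite !qcode//; last 2 first.
    - exact: leq_trans (leq_trans iK Kk') (ek _).
    - exact: leq_trans (leq_trans iK Kk) (ek _).
    by rewrite !KP//; exact: leq_trans Kw _.
  apply/eqP; rewrite eqn_leq; apply/andP; split.
    by have := lt_eq _ (code_lt M' i (h k' x)); rewrite ltnSn ltnS.
  by have := lt_eq _ (code_lt M' i (h k x)); rewrite ltnSn ltnS => /esym.
have hnear x i : G x -> exists K, forall k k', (K <= k)%N -> (K <= k')%N ->
    `|Re (h k x) - Re (h k' x)| <= 2 * M' / 2 ^+ i /\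
    `|Im (h k x) - Im (h k' x)| <= 2 * M' / 2 ^+ i.
  move=> Gx; have [K KP] := hcode x i Gx; exists K => k k' Kk Kk'.
  apply: code_near => //; try by apply: le_lt_trans (hM _ _) _; rewrite ltrDl.
  exact: KP.
have small (d : R) : 0 < d -> exists i : nat, 2 * M' / 2 ^+ i < d.
  move=> d0.
  have c0 : (2 * M') / 2 ^+ i @[i --> \oo] --> (0 : R).
    rewrite -[X in _ --> X](mulr0 (2 * M')); apply: cvgMr.
    under eq_cvg do rewrite -exprVn.
    by apply: cvg_expr; rewrite ger0_norm; lra.
  have /cvgrPdist_lt /(_ _ d0) [i _ /(_ i) /=] := c0.
  rewrite leqnn sub0r normrN => /(_ isT) iP; exists i; exact: le_lt_trans (ler_norm _) iP.
have cauchy_lim (u : nat -> R) : (forall i, exists K, forall k k', (K <= k)%N -> (K <= k')%N ->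
    `|u k - u k'| <= 2 * M' / 2 ^+ i) -> cvgn u.
  move=> H; apply/cauchy_cvgP; apply: cauchy_exP => d d0.
  have [i id] := small d d0; have [K KP] := H i.
  exists (u K); exists K => // k /= Kk; rewrite -ball_normE /=.
  by apply: le_lt_trans id; exact: KP.
have cR x : cvgn (fun k => Re (h k x)).
  have [Gx|nG] := pselect (G x).
    by apply: cauchy_lim => i; have [K KP] := hnear x i Gx; exists K => k k' Kk Kk';
      case: (KP k k' Kk Kk').
  by rewrite /h memNset//; exact: is_cvg_cst.
have cI x : cvgn (fun k => Im (h k x)).
  have [Gx|nG] := pselect (G x).
    by apply: cauchy_lim => i; have [K KP] := hnear x i Gx; exists K => k k' Kk Kk';
      case: (KP k k' Kk Kk').
  by rewrite /h memNset//; exact: is_cvg_cst.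
pose H (x : R) : C := Complex (limn (fun k => Re (h k x))) (limn (fun k => Im (h k x))).
have mq k : measurable_fun setT (fun x => Re (q k x)) /\ measurable_fun setT (fun x => Im (q k x)).
  have mt := @measurable_truncn R (N k)%:R.
  split.
    exact: (measurableT_comp (f := fun n => Re (nth 0 (t k) n)) _ mt).
  exact: (measurableT_comp (f := fun n => Im (nth 0 (t k) n)) _ mt).
have hrE k : (fun x => Re (h k x)) = (fun x => \1_G x * Re (q (e k) x)).
  by apply/funext => x; rewrite /h indicE; case: (x \in G); rewrite ?mul1r ?mul0r.
have hiE k : (fun x => Im (h k x)) = (fun x => \1_G x * Im (q (e k) x)).
  by apply/funext => x; rewrite /h indicE; case: (x \in G); rewrite ?mul1r ?mul0r.
have mhr k : measurable_fun setT (fun x => Re (h k x)).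
  by rewrite hrE; apply: measurable_funM => //; exact: (mq (e k)).1.
have mhi k : measurable_fun setT (fun x => Im (h k x)).
  by rewrite hiE; apply: measurable_funM => //; exact: (mq (e k)).2.
have mH : measurable_fun setT H.
  apply: measurable_fun_plane.
    by apply: (measurable_fun_cvg mhr) => x _; exact: cR.
  by apply: (measurable_fun_cvg mhi) => x _; exact: cI.
have mh k : measurable_fun setT (h k) by exact: measurable_fun_plane.
have chH (phi : C -> R) x : continuous phi -> phi (h k x) @[k --> \oo] --> phi (H x).
  by move=> cphi; apply: cvg_plane_comp.
have HM x : normc (H x) <= M.
  apply: (cvgr_to_le (chH (@Normc.normc R : C -> R) x continuous_normc)).
  by apply: nearW => k; exact: hM.
have mH' : @measurable_fun _ _ (measurableTypeR R) C setT H by exact: mH.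
pose Hf : {mfun (measurableTypeR R) >-> C} := HB.pack H (isMeasurableFun.Build _ _ (measurableTypeR
  R) C H mH').
exists e, (distribution unif01 Hf); split=> //.
  move=> A mA AM.
  have e0 : H @^-1` A = set0.
    by apply/seteqP; split=> // x /= /AM; rewrite ltNge HM.
  transitivity (unif01 (H @^-1` A)); first by [].
  by rewrite e0; exact: measure0.
move=> phi cphi.
have [K KP] := continuous_bounded_ball M cphi.
have mphi : measurable_fun setT phi by exact: measurable_fun_continuous.
have mean_int k : (seq_mean phi (s (e k)))%:E = (\int[unif01]_x (phi (h k x))%:E)%E.
  have -> : (seq_mean phi (s (e k)))%:E =
      (\int[unif01]_x (phi (nth 0 (t (e k)) (Num.truncn ((N (e k))%:R * x))))%:E)%E.
    rewrite (@integral_step R (N (e k)) (fun n => phi (nth 0 (t (e k)) n)) (s_gt0 _)).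
    congr (_ * _)%:E; rewrite -(perm_big _ (tperm (e k))) /= (big_nth 0) tsize.
    by rewrite big_mkord.
  apply: ae_eq_integral => //.
  - apply/measurable_EFinP.
    exact: (measurableT_comp (f := fun n => phi (nth 0 (t (e k)) n)) _ (@measurable_truncn R _)).
  - by apply/measurable_EFinP; exact: (measurableT_comp mphi (mh k)).
  - exists (~` G); split; [exact: measurableC|exact: PG|].
    by move=> x /= nE Gx; apply: nE => _; rewrite /h mem_set.
under eq_cvg do rewrite mean_int.
have ib : unif01.-integrable setT (EFin \o (phi \o H)).
  apply: (@bounded_integrable _ _ _ _ _ K); first exact: (measurableT_comp mphi mH).
  by move=> x /=; exact: KP.
rewrite integral_distribution//; last exact/measurable_EFinP.
have [|||||_ _ //] := @dominated_convergence _ _ _ unif01 setT measurableT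
  (fun k x => (phi (h k x))%:E) (fun x => (phi (H x))%:E) (cst K%:E).
- by move=> k; apply/measurable_EFinP; exact: (measurableT_comp mphi (mh k)).
- by apply/measurable_EFinP; exact: (measurableT_comp mphi mH).
- apply: aeW => x _; apply: cvg_EFin; first exact: nearW.
  exact: chH.
- exact: finite_measure_integrable_cst.
- by apply: aeW => x k _; rewrite lee_fin; exact: KP.
Qed.

End selection.

(** * The equilibrium potential on E *)

Section convex_combination.
Local Open Scope ereal_scope.
Context d (T : measurableType d) {R : realType}.

Lemma ge0_integral_mrestr (tau : {measure set T -> \bar R}) (B : set T)
    (mB : measurable B) (f : T -> \bar R) :
  measurable_fun setT f -> (forall x, 0 <= f x) ->
  \int[mrestr tau mB]_x f x = \int[tau]_(x in B) f x.
Proof.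
move=> mf f0.
have mCB : measurable (~` B) by exact: measurableC.
rewrite -(setUv B) ge0_integral_setU//; last 2 first.
- by rewrite setUv.
- exact/disj_setPCl.
rewrite [X in _ + X](_ : _ = 0) ?adde0; last first.
  apply: null_set_integral => //; first exact: measurable_funTS.
  by rewrite /= /mrestr setICl measure0.
apply: eq_measure_integral => A mA AB; rewrite /= /mrestr.
by congr (tau _); exact/setIidPl.
Qed.

(** Serves twice: [s = 1] gives the normalised restriction of [tau] to [B], and small [s] gives the
    variations of [mu] towards it. *)
Lemma convex_restriction (mu tau : probability T R) (B : set T) (s : R) :
  (0 <= s <= 1)%R -> measurable B -> 0 < tau B ->
  exists nu : probability T R, forall f : T -> \bar R,
    measurable_fun setT f -> (forall x, 0 <= f x) ->
    \int[nu]_x f x = (1 - s)%:E * \int[mu]_x f x + (s / fine (tau B))%:E * \int[tau]_(x in B) f x.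
Proof.
move=> /andP[s0 s1] mB tB.
have tBfin : tau B \is a fin_num by exact: fin_num_measure.
have p0 : (0 < fine (tau B))%R by rewrite fine_gt0// tB ltey_eq tBfin.
have a0 : (0 <= 1 - s)%R by rewrite subr_ge0.
have b0 : (0 <= s / fine (tau B))%R by rewrite divr_ge0// ltW.
pose m1 : {measure set T -> \bar R} := mscale (NngNum a0) mu.
pose m2 : {measure set T -> \bar R} := mscale (NngNum b0) (mrestr tau mB).
pose m : {measure set T -> \bar R} := measure_add m1 m2.
have mT : m setT = 1.
  transitivity (m1 setT + m2 setT); first exact: measure_addE.
  rewrite /m1 /m2 /= /mscale /= /mrestr setTI measure_probT mule1.
  rewrite -{2}(fineK tBfin) -EFinM divfK ?gt_eqF// -EFinD; congr EFin; ring.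
pose nu : probability T R := HB.pack (Measure.sort m) (Measure.class m)
  (Measure_isProbability.Build _ _ _ (Measure.sort m) mT).
exists nu => f mf f0.
rewrite -[LHS]/(\int[m]_x f x) ge0_integral_measure_add// !ge0_integral_mscale//.
congr (_ + _ * _).
by rewrite ge0_integral_mrestr.
Qed.

End convex_combination.

(** * Variation of the equilibrium measure *)

Section frostman.
Context {R : realType}.
Local Notation C := R[i].
Local Notation normc := Normc.normc.
Local Open Scope ereal_scope.
Implicit Types (nu tau : probability C R) (z t : C).

Lemma bounded_lnw_integrable nu (M : R) (A : set C) : measurable A ->
  nu (~` A) = 0 -> (forall z, A z -> normc z <= M)%R -> lnw_integrable nu.
Proof.
move=> mA A0 AM.
have [K KP] := continuous_bounded_ball M (@continuous_lnw R).
apply: (ae_bounded_integrable (M := K) mA A0).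
  by apply: measurable_fun_continuous; exact: continuous_lnw.
by move=> z /AM; exact: KP.
Qed.

Context (E : set C) (mu : probability C R) (M V : R).
Hypotheses (mE : measurable E) (EM : forall z, E z -> (normc z <= M)%R)
  (mu_E : probabilities_on E mu) (robin_V : robin E = V%:E)
  (energy_V : energy mu = V%:E).

Lemma probabilities_on_lnw nu : probabilities_on E nu -> lnw_integrable nu.
Proof. by move=> nuE; apply: (bounded_lnw_integrable mE nuE EM). Qed.

Lemma robin_le nu : probabilities_on E nu -> V%:E <= energy nu.
Proof. by move=> nuE; rewrite -robin_V; apply: ereal_inf_lbound; exists nu. Qed.

Lemma chord_energy_equilibrium :
  chord_energy mu mu = (V + (lnw_mean mu + lnw_mean mu))%:E.
Proof.
have := energy_V; rewrite (energyE (probabilities_on_lnw mu_E)).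
move=> e; rewrite EFinD -e subeK//.
Qed.

(** If [B] had positive mass, its normalised restriction [sigma] would have finite energy, and
    moving mass [s] of [mu] onto [sigma] would change the energy by at most [- 2 * eta * s] plus a
    multiple of [s ^+ 2], contradicting minimality for small [s]. *)
Lemma equilibrium_pot_ge tau (eta : R) (B : set C) : (0 < eta)%R ->
  lnw_integrable tau -> chord_energy tau tau < +oo ->
  measurable B -> B `<=` E -> (forall z, B z -> log_pot mu z <= (V - eta)%:E) ->
  tau B = 0.
Proof.
move=> eta0 itau tau_fin mB BE Blt.
have imu := probabilities_on_lnw mu_E.
apply/eqP; apply: contrapT => /negP/negbTE tB0.
have tB : 0 < tau B by rewrite lt0e tB0 measure_ge0.
have tBfin : tau B \is a fin_num by exact: fin_num_measure.
set p := fine (tau B); have p0 : (0 < p)%R by rewrite fine_gt0// tB ltey_eq tBfin.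
have Bsub (f : C -> \bar R) : measurable_fun setT f -> (forall z, 0 <= f z) ->
    \int[tau]_(z in B) f z <= \int[tau]_z f z.
  by move=> mf f0; apply: ge0_subset_integral.
have [sigma sP] := convex_restriction mu (s := 1) (B := B) (tau := tau) (ltac:(by rewrite ler01
  lexx)) mB tB.
have {}sP (f : C -> \bar R) : measurable_fun setT f -> (forall z, 0 <= f z) ->
    \int[sigma]_z f z = (p^-1)%:E * \int[tau]_(z in B) f z.
  by move=> mf f0; rewrite sP// subrr mul0e add0e mul1r.
have on_B nu (D : set C) : measurable D -> D `&` B = set0 -> mu D = 0 ->
    (exists s : R, forall f : C -> \bar R, measurable_fun setT f -> (forall z, 0 <= f z) ->
      \int[nu]_z f z = (1 - s)%:E * \int[mu]_z f z + (s / p)%:E * \int[tau]_(z in B) f z) ->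
    nu D = 0.
  move=> mD DB muD [s H].
  have -> : nu D = \int[nu]_z (\1_D z)%:E by rewrite integral_indic// setIT.
  rewrite H//; last by apply/measurable_EFinP.
  have muD' : (mu : {measure set C -> \bar R}) D = 0 by exact: muD.
  by rewrite !integral_indic// setIT muD' mule0 add0e DB measure0 mule0.
have muCE : mu (~` E) = 0 by exact: mu_E.
have CEB : ~` E `&` B = set0.
  by apply/seteqP; split=> // z [nEz Bz]; apply: nEz; exact: BE.
have sE : probabilities_on E sigma.
  apply: on_B => //; first exact: measurableC.
  by exists 1%R => f mf f0; rewrite sP// subrr mul0e add0e mul1r.
have isg := probabilities_on_lnw sE.
have mcp nu := @measurable_chord_pot R nu.
have cp0 nu := @chord_pot_ge0 R nu.
have s_le_t (f : C -> \bar R) : measurable_fun setT f -> (forall z, 0 <= f z) ->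
    \int[sigma]_z f z <= (p^-1)%:E * \int[tau]_z f z.
  by move=> mf f0; rewrite sP//; apply: lee_wpmul2l; [rewrite lee_fin invr_ge0 ltW|exact: Bsub].
(* Nonnegativity of the chordal kernel allows [sigma] to be bounded by [tau] over [p] in one
   variable, then in the other. *)
have css : chord_energy sigma sigma < +oo.
  rewrite -integral_chord_pot; apply: le_lt_trans (s_le_t _ (mcp _) (cp0 _)) _.
  rewrite integral_chord_pot chord_energyC -integral_chord_pot.
  apply: le_lt_trans (_ : (p^-1)%:E * ((p^-1)%:E * chord_energy tau tau) < +oo).
    apply: lee_wpmul2l; first by rewrite lee_fin invr_ge0 ltW.
    by rewrite -integral_chord_pot; exact: s_le_t.
  have : chord_energy tau tau \is a fin_num by rewrite ge0_fin_numE// chord_energy_ge0.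
  by move=> /fineK <-; rewrite -!EFinM ltry.
have cms : chord_energy sigma mu <= (V - eta + lnw_mean mu + lnw_mean sigma)%:E.
  rewrite -integral_chord_pot.
  have -> : (V - eta + lnw_mean mu + lnw_mean sigma)%:E =
      \int[sigma]_z (V - eta + lnw_mean mu + lnw z)%:E.
    under eq_integral do rewrite EFinD.
    rewrite integralD//=; last exact: finite_measure_integrable_cst.
    by rewrite integral_cst// measure_probT mule1 EFinD (EFin_lnw_mean isg).
  have sCB : (sigma : {measure set C -> \bar R}) (~` B) = 0.
    have -> : (sigma : {measure set C -> \bar R}) (~` B) = \int[sigma]_z (\1_(~` B) z)%:E.
      by rewrite integral_indic ?setIT//; exact: measurableC.
    rewrite sP//; last by apply/measurable_EFinP; apply: measurable_indic; exact: measurableC.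
    by rewrite integral_indic//; [rewrite setICl measure0 mule0|exact: measurableC].
  have aeB (P : C -> Prop) : (forall z, B z -> P z) -> {ae sigma, forall z, P z}.
    move=> BP; exists (~` B); split=> //; first exact: measurableC.
    by move=> z /= nP Bz; apply: nP; exact: BP.
  have mlnw : measurable_fun setT (@lnw R).
    by apply: measurable_fun_continuous; exact: continuous_lnw.
  pose g z : R := (V - eta + lnw_mean mu + lnw z)%R.
  have mg : measurable_fun setT g by exact: measurable_funD.
  have gB z : B z -> chord_pot mu z <= (g z)%:E.
    move=> /Blt; rewrite log_potE// leeBlDr// -EFinD; congr (_ <= _%:E).
    by rewrite /g; ring.
  (* [g] dominates the chordal potential on [B] only and may be negative elsewhere; its positive
     part agrees with it [sigma]-almost everywhere and is admissible in the monotonicity of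
     nonnegative integrals. *)
  apply: le_trans (_ : \int[sigma]_z (Num.max 0 (g z))%:E <= _).
    apply: ae_ge0_le_integral => //.
    - by move=> z _; rewrite lee_fin le_max lexx.
    - by apply/measurable_EFinP; exact: measurable_maxr.
    - by apply: aeB => z /gB h _; apply: le_trans h _; rewrite lee_fin le_max lexx orbT.
  rewrite (ae_eq_integral (fun z => (g z)%:E))//.
  - by apply/measurable_EFinP; exact: measurable_maxr.
  - exact/measurable_EFinP.
  - apply: aeB => z /gB h _; congr EFin; apply/max_idPr.
    by rewrite -lee_fin (le_trans _ h)// chord_pot_ge0.
have [c cE] : exists c, chord_energy sigma sigma = c%:E.
  exists (fine (chord_energy sigma sigma)); rewrite fineK//.
  by rewrite ge0_fin_numE// chord_energy_ge0.
have [b bE] : exists b, chord_energy sigma mu = b%:E.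
  exists (fine (chord_energy sigma mu)); rewrite fineK//.
  by rewrite ge0_fin_numE ?chord_energy_ge0//; apply: le_lt_trans cms _; rewrite ltry.
move: cms; rewrite bE lee_fin => bV.
set Lm := lnw_mean mu in bV *; set Ls := lnw_mean sigma in bV *.
(* The coefficient of [s ^+ 2] in the energy along the segment from [mu] to [sigma]; the means of
   [lnw] contribute only linearly. *)
pose D := (V + 2 * Lm - 2 * b + c)%R.
have var (s : R) : (0 <= s <= 1)%R -> (0 <= s * (- (2 * eta)) + s ^+ 2 * D)%R.
  move=> s01; have /andP[s0 s1] := s01.
  have [nu nuP] := convex_restriction mu s01 mB tB.
  have {}nuP (f : C -> \bar R) : measurable_fun setT f -> (forall z, 0 <= f z) ->
      \int[nu]_z f z = (1 - s)%:E * \int[mu]_z f z + s%:E * \int[sigma]_z f z.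
    by move=> mf f0; rewrite nuP// sP// muleA -EFinM.
  have nuE : probabilities_on E nu.
    apply: on_B => //; first exact: measurableC.
    by exists s => f mf f0; rewrite nuP// sP// muleA -EFinM.
  have inu := probabilities_on_lnw nuE.
  have Lnu : lnw_mean nu = ((1 - s) * Lm + s * Ls)%R.
    apply: EFin_inj; rewrite EFinD 2!EFinM (EFin_lnw_mean inu) (EFin_lnw_mean imu) (EFin_lnw_mean
      isg).
    apply: nuP; last by move=> z; rewrite lee_fin lnw_ge0.
    by apply/measurable_EFinP; apply: measurable_fun_continuous; exact: continuous_lnw.
  have pE (rho : probability C R) : chord_energy nu rho =
      (1 - s)%:E * chord_energy mu rho + s%:E * chord_energy sigma rho.
    by rewrite -!integral_chord_pot; apply: nuP.
  have := robin_le nuE.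
  rewrite (energyE inu) pE chord_energyC pE (chord_energyC sigma nu) pE.
  rewrite chord_energy_equilibrium (chord_energyC mu sigma) bE cE Lnu.
  rewrite -?EFinM -?EFinD -?EFinM -?EFinD -?EFinB lee_fin -/Lm.
  move=> h; rewrite /D.
  have : (0 <= s * (2 * (b - V + - Lm - Ls)) + s ^+ 2 * (V + 2 * Lm - 2 * b + c))%R.
    rewrite -subr_ge0 in h; apply: le_trans h _; rewrite le_eqVlt; apply/orP; left; apply/eqP; ring.
  move=> h'; apply: le_trans h' _; rewrite lerD2r ler_wpM2l//; lra.
have D0 : (0 < `|D| + 1 + eta)%R by rewrite ltr_wpDl// addr_ge0.
(* This makes [s * D] at most [eta], which is less than [2 * eta]; the summand [eta] in the
   denominator keeps [s] at most 1. *)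
pose s := (eta / (`|D| + 1 + eta))%R.
have s0 : (0 < s)%R by rewrite divr_gt0.
have s1 : (s <= 1)%R by rewrite ler_pdivrMr// mul1r lerDr addr_ge0.
have := var s; rewrite (ltW s0) s1 => /(_ isT).
rewrite expr2 -mulrA -mulrDr pmulr_rge0//.
have : (s * D <= s * (`|D| + 1 + eta))%R.
  rewrite ler_pM2l//; apply: le_trans (ler_norm _) _; rewrite -addrA lerDl addr_ge0// ltW//.
rewrite {2}/s divfK ?gt_eqF//; lra.
Qed.

Lemma equilibrium_pot_ae_ge tau : lnw_integrable tau -> chord_energy tau tau < +oo ->
  tau (E `&` [set z | log_pot mu z < V%:E]) = 0.
Proof.
move=> itau tau_fin.
have imu := probabilities_on_lnw mu_E.
pose F n := E `&` [set z | log_pot mu z <= (V - n.+1%:R^-1)%:E].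
have mF n : measurable (F n).
  exact: (emeasurable_fun_infty_c mE (measurable_funTS (measurable_log_pot imu))).
have F0 n : tau (F n) = 0.
  apply: (@equilibrium_pot_ge _ n.+1%:R^-1) => //.
  - by move=> z [].
  - by move=> z [].
have -> : E `&` [set z | log_pot mu z < V%:E] = \bigcup_n F n.
  apply/seteqP; split=> [z [Ez /= zV]|z [n _ [Ez /= h]]]; last first.
    by split=> //=; apply: le_lt_trans h _; rewrite lte_fin ltrBlDr ltrDl invr_gt0.
  move: zV; case lE : (log_pot mu z) => [r| |] //.
    rewrite lte_fin => rV; have rV' : (0 < V - r)%R by rewrite subr_gt0.
    have [n _ /(_ n (leqnn n)) /= h] := near_infty_natSinv_lt (PosNum rV').
    exists n => //; split=> //=; rewrite lE lee_fin lerBrDr -lerBrDl; exact: ltW h.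
  by exists 0%N => //; split=> //=; rewrite lE leNye.
apply/(negligibleP _ (bigcup_measurable (fun n _ => mF n))).
by apply: negligible_bigcup => n; apply/negligibleP; [exact: mF|exact: F0].
Qed.

(** The energy of [mu] is finite, so the previous lemma applies to [mu] itself: U - V, written [W]
    through the chordal potential, is nonnegative [mu]-almost everywhere, and its integral is the
    energy minus V, that is 0. *)
Lemma equilibrium_pot_ae : {ae mu, forall z, log_pot mu z = V%:E}.
Proof.
have imu := probabilities_on_lnw mu_E.
have cmm : chord_energy mu mu < +oo by rewrite chord_energy_equilibrium ltry.
have := equilibrium_pot_ae_ge imu cmm.
pose W z := chord_pot mu z - (V + lnw_mean mu + lnw z)%:E.
have ic : mu.-integrable setT (EFin \o (fun z => V + lnw_mean mu + lnw z)%R).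
  exact: (integrableD measurableT (finite_measure_integrable_cst mu (V + lnw_mean mu) measurableT)
    imu).
have mW : measurable_fun setT W.
  apply: emeasurable_funB; first exact: measurable_chord_pot.
  by case/integrableP : ic.
have iW : \int[mu]_z W z = 0.
  rewrite integral_ge0B//; [|exact: measurable_chord_pot|by move=> z; exact: chord_pot_ge0].
  rewrite integral_chord_pot chord_energy_equilibrium.
  under eq_integral do rewrite EFinD.
  rewrite integralD//=; last exact: finite_measure_integrable_cst.
  rewrite integral_cst// measure_probT mule1 -(EFin_lnw_mean imu) -(EFinD (V + lnw_mean mu)) -EFinB.
  by congr EFin; ring.
move=> EV0.
have WV z : (0 <= W z) = (V%:E <= log_pot mu z).
  rewrite /W log_potE// sube_ge0// leeBrDr// -EFinD; congr (_%:E <= _); ring.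
have nV : mu.-negligible [set z | ~ (0 <= W z)].
  apply: (@negligibleS _ _ _ _ (~` E `|` (E `&` [set z | log_pot mu z < V%:E]))).
    move=> z /= nW; have [Ez|] := pselect (E z); [right|by left].
    by split=> //=; rewrite ltNge -WV; apply/negP.
  apply: negligibleU.
    by exists (~` E); split=> //; exact: measurableC.
  exists (E `&` [set z | log_pot mu z < V%:E]); split=> //.
  exact: (emeasurable_fun_infty_o mE (measurable_funTS (measurable_log_pot imu))).
have aeW : {ae mu, forall z, `|W z| = W z}.
  by apply: negligibleS nV => z /= h h0; apply: h; exact: gee0_abs.
have : \int[mu]_z `|W z| = 0.
  rewrite -iW; apply: ae_eq_integral => //; first exact: measurableT_comp.
  by apply: filterS aeW => z ->.
move=> /(ae_eq_integral_abs mu measurableT mW).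
apply: filterS => z /(_ I) /= Wz.
rewrite log_potE//; move: Wz; rewrite /W; case: (chord_pot mu z) => [r| |] //.
by rewrite -!EFinB => -[h]; congr EFin; lra.
Qed.

End frostman.

(** * Discrete energies *)

Section mean_argument.
Context d (T : measurableType d) {R : realType}.
Local Open Scope ereal_scope.

(** Otherwise [W] would be positive almost everywhere with integral 0. This pigeonhole is how points
    are chosen in the greedy construction below. *)
Lemma exists_le_mean (mu : probability T R) (W : T -> \bar R) (P : T -> Prop) :
  measurable_fun setT W -> \int[mu]_x W x = 0 -> {ae mu, forall x, P x} ->
  exists2 x, P x & W x <= 0.
Proof.
move=> mW iW aeP; apply: contrapT => nex.
have Wpos : {ae mu, forall x, P x -> 0 < W x}.
  apply: aeW => x Px; rewrite ltNge; apply/negP => Wx; apply: nex; by exists x.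
have W0 : {ae mu, forall x, `|W x| = W x}.
  by apply: filterS2 aeP Wpos => x Px /(_ Px) Wx; rewrite gte0_abs.
have : \int[mu]_x `|W x| = 0.
  rewrite -iW; apply: ae_eq_integral => //; first exact: measurableT_comp.
  by apply: filterS W0 => x ->.
move=> /(ae_eq_integral_abs mu measurableT mW) aeW0.
have : {ae mu, forall x : T, False}.
  apply: filterS3 aeP Wpos aeW0 => x Px /(_ Px) + /(_ I) /= => /[swap] ->.
  by rewrite ltxx.
move=> [A [mA A0 TA]].
have AT : A = setT by apply/seteqP; split=> // x _; apply: TA.
by move: A0; rewrite AT measure_probT => /eqP; rewrite onee_eq0.
Qed.

Lemma integral_fun0_negligible (mu : probability T R) (phi : T -> R) :
  measurable_fun setT phi -> (forall x, 0 <= phi x)%R -> \int[mu]_x (phi x)%:E = 0 ->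
  mu [set x | 0 < phi x]%R = 0.
Proof.
move=> mphi phi0 iphi.
have mphi' : measurable_fun setT (EFin \o phi) by exact/measurable_EFinP.
have : \int[mu]_x `|(EFin \o phi) x| = 0.
  by rewrite -[RHS]iphi; apply: eq_integral => x _ /=; rewrite ger0_norm.
move=> /(ae_eq_integral_abs mu measurableT mphi') [A [mA A0 phiA]].
have mpos : measurable [set x | 0 < phi x]%R.
  have := mphi measurableT `]0%R, +oo[%classic (measurable_itv _).
  by rewrite setTI; congr measurable; apply/seteqP; split=> x; rewrite /preimage /= in_itv /= andbT.
apply: (subset_measure0 mpos mA _ A0) => x /= px; apply: phiA => /= /(_ I) [] e.
by move: px; rewrite e ltxx.
Qed.

End mean_argument.

Section triangular_sums.
Context {R : realType}.

Lemma sum_triangle n (g : nat -> nat -> R) : (forall i j, g i j = g j i) ->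
  \sum_(k < n) \sum_(j < n | (j < k)%N) g j k =
  2^-1 * (\sum_(k < n) \sum_(j < n) g j k - \sum_(k < n) g k k).
Proof.
move=> gC.
have tri : \sum_(k < n) \sum_(j < n | (k < j)%N) g j k =
           \sum_(k < n) \sum_(j < n | (j < k)%N) g j k.
  rewrite (exchange_big_dep xpredT)//=; apply: eq_bigr => k _.
  by apply: eq_bigr => j _; rewrite gC.
have -> : \sum_(k < n) \sum_(j < n) g j k = \sum_(k < n) \sum_(j < n | (j < k)%N) g j k +
   (\sum_(k < n) \sum_(j < n | (k < j)%N) g j k + \sum_(k < n) g k k).
  rewrite -!big_split /=; apply: eq_bigr => k _.
  rewrite (bigID (fun j : 'I_n => (j < k)%N))/=; congr (_ + _).
  rewrite (bigD1 k) ?ltnn//= addrC; congr (_ + _).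
  by apply: eq_bigl => j; rewrite -leqNgt ltn_neqAle eq_sym andbC.
by rewrite tri; field.
Qed.

Lemma cvg_sumr (I : Type) (r : seq I) (F : nat -> I -> R) (l : I -> R) :
  (forall i, F n i @[n --> \oo] --> l i) ->
  \sum_(i <- r) F n i @[n --> \oo] --> \sum_(i <- r) l i.
Proof.
move=> H; elim: r => [|i r ih].
  by under eq_cvg do rewrite big_nil; rewrite big_nil; exact: cvg_cst.
by under eq_cvg do rewrite big_cons; rewrite big_cons; exact: cvgD.
Qed.

End triangular_sums.

Section discrete_energies.
Context {R : realType}.
Local Notation C := R[i].
Implicit Types (s : seq C) (tau : probability C R).

(** The first [m] terms of the chordal energy of the empirical measure, diagonal pairs included: the
    truncation is what keeps them finite. *)
Definition seq_chord_energy m s : R :=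
  \sum_(k < m) kcoef k * \sum_(f : {ffun 'I_k.+1 -> 'I_4}) seq_mean (sphere_mono f) s ^+ 2.

Lemma seq_sumE (phi : C -> R) s : (0 < size s)%N ->
  \sum_(i < size s) phi s`_i = (size s)%:R * seq_mean phi s.
Proof.
move=> s0; rewrite /seq_mean mulrA mulfV ?mul1r ?pnatr_eq0 -?lt0n//.
by rewrite (big_nth 0) big_mkord.
Qed.

Lemma sum_chord_series m s : (0 < size s)%N ->
  \sum_(k < size s) \sum_(j < size s) chord_series m s`_j s`_k =
  (size s)%:R ^+ 2 * seq_chord_energy m s.
Proof.
move=> s0; rewrite /seq_chord_energy mulr_sumr /chord_series.
under eq_bigr do rewrite exchange_big /=.
rewrite exchange_big /=; apply: eq_bigr => l _.
transitivity (kcoef l * \sum_(k < size s) \sum_(j < size s) chord s`_j s`_k ^+ l.+1).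
  by rewrite mulr_sumr; apply: eq_bigr => k _; rewrite mulr_sumr.
rewrite mulrCA; congr (_ * _); rewrite mulr_sumr.
transitivity (\sum_(k < size s) \sum_(f : {ffun 'I_l.+1 -> 'I_4})
    \sum_(j < size s) sphere_mono f s`_j * sphere_mono f s`_k).
  apply: eq_bigr => k _; rewrite exchange_big /=.
  by apply: eq_bigr => j _; rewrite chordX.
rewrite exchange_big /=; apply: eq_bigr => f _.
transitivity ((\sum_(j < size s) sphere_mono f s`_j) * \sum_(k < size s) sphere_mono f s`_k).
  by rewrite mulr_sumr; apply: eq_bigr => k _; rewrite mulr_suml.
by rewrite seq_sumE// -expr2 exprMn.
Qed.

(** Truncating the series only lowers the kernel and makes it finite on the diagonal. The sum over
    pairs can then be completed to the full square, at the price of [\sum_(k < m) kcoef k] for each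
    diagonal term. *)
Lemma discrete_energy_ge m s : (1 < size s)%N ->
  ((((size s)%:R * seq_chord_energy m s - \sum_(k < m) kcoef k) / (size s).-1%:R
   - 2 * seq_mean (@lnw R) s)%:E <= discrete_energy s)%E.
Proof.
move=> s1; have s0 := ltnW s1.
set n := size s in s1 s0 *.
have n0 : n%:R != 0 :> R by rewrite pnatr_eq0 -lt0n.
have n1 : n.-1%:R != 0 :> R by rewrite pnatr_eq0 -lt0n -subn1 subn_gt0.
pose g (j k : nat) : R := chord_series m s`_j s`_k - (lnw s`_j + lnw s`_k).
have gle (j k : nat) : ((g j k)%:E <= log_kernel s`_j s`_k)%E.
  by rewrite log_kernelE EFinB leeD2r// chord_series_le.
have gC j k : g j k = g k j.
  by rewrite /g [lnw _ + _]addrC; congr (_ - _); apply: eq_bigr => l _; rewrite chordC.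
have e1 : \sum_(k < n) \sum_(j < n) g j k =
   n%:R ^+ 2 * seq_chord_energy m s - 2 * n%:R * (n%:R * seq_mean (@lnw R) s).
  under eq_bigr do rewrite sumrB.
  rewrite sumrB sum_chord_series//; congr (_ - _).
  under eq_bigr do rewrite big_split /= sumr_const card_ord seq_sumE//.
  rewrite big_split /= sumr_const card_ord sumrMnl seq_sumE// -/n.
  rewrite -[X in X + _]mulr_natl -mulr_natl; ring.
have e2 : \sum_(k < n) g k k = n%:R * (\sum_(k < m) kcoef k) - 2 * (n%:R * seq_mean (@lnw R) s).
  rewrite sumrB big_split /= seq_sumE// -/n; congr (_ - _); last by ring.
  rewrite (eq_bigr (fun=> \sum_(k < m) kcoef k)); first by rewrite sumr_const card_ord mulr_natl.
  by move=> k _; apply: eq_bigr => l _; rewrite chordzz expr1n mulr1.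
apply: (@le_trans _ _ ((2 / (n%:R * n.-1%:R)) * \sum_(k < n) \sum_(j < n | (j < k)%N) g j k)%:E).
  rewrite sum_triangle// e1 e2 lee_fin.
  have en : n%:R = n.-1%:R + 1 :> R by rewrite natr1 prednK.
  move: n0; rewrite le_eqVlt; move=> n0; apply/orP; left; apply/eqP.
  by move: n0; rewrite en => n0; field; rewrite n0 n1.
rewrite /discrete_energy EFinM; apply: lee_wpmul2l.
  by rewrite lee_fin divr_ge0.
rewrite -sumEFin; apply: lee_sum => k _; rewrite -sumEFin.
by apply: lee_sum => j _; exact: gle.
Qed.

Lemma cvg_seq_chord_energy (s : nat -> seq C) tau m :
  (forall k (f : {ffun 'I_k -> 'I_4}), seq_mean (sphere_mono f) (s n) @[n --> \oo] --> moment tau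
    f) ->
  seq_chord_energy m (s n) @[n --> \oo] --> \sum_(k < m) kcoef k * pair_moment tau tau k.+1.
Proof.
move=> H; rewrite /seq_chord_energy; apply: cvg_sumr => k.
apply: cvgMr; rewrite /pair_moment; apply: cvg_sumr => f.
by rewrite -expr2; apply: (@cvg_comp _ _ _ _ (fun x : R => x ^+ 2) _ _ _ (H _ f));
  exact: exprn_continuous.
Qed.

Lemma limit_chord_energy (s : nat -> seq C) tau (dd : nat -> R) (W L : R) m :
  (forall k (f : {ffun 'I_k -> 'I_4}), seq_mean (sphere_mono f) (s n) @[n --> \oo] --> moment tau
    f) ->
  seq_mean (@lnw R) (s n) @[n --> \oo] --> L ->
  (forall n, (n.+1 < size (s n))%N) ->
  (forall n, (discrete_energy (s n) <= (dd n)%:E)%E) -> dd n @[n --> \oo] --> W ->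
  \sum_(k < m) kcoef k * pair_moment tau tau k.+1 <= W + 2 * L.
Proof.
move=> Hm HL Hs Hd dW.
pose H := \sum_(k < m) kcoef k : R.
have H0 : 0 <= H by apply: sumr_ge0 => k _; exact: kcoef_ge0.
have c1 : dd n + (2 * seq_mean (@lnw R) (s n) + H * n.+1%:R^-1) @[n --> \oo] --> W + (2 * L + H *
  0).
  apply: cvgD => //; apply: cvgD; first exact: cvgMr.
  by apply: cvgMr; exact: cvg_harmonic.
have := ler_cvg_to (@cvg_seq_chord_energy s tau m Hm) c1.
rewrite mulr0 addr0; apply; apply: nearW => n.
have s1 : (1 < size (s n))%N by apply: leq_ltn_trans (Hs n).
have := le_trans (discrete_energy_ge m s1) (Hd n); rewrite lee_fin lerBlDr => h.
rewrite addrA -lerBlDr; apply: le_trans h.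
set N := size (s n) in s1 *; have nN : (n.+1 < N)%N by exact: Hs.
have p0 : 0 < N.-1%:R :> R by rewrite ltr0n -subn1 subn_gt0.
have S0 : 0 <= seq_chord_energy m (s n).
  by apply: sumr_ge0 => k _; rewrite mulr_ge0 ?kcoef_ge0//; apply: sumr_ge0 => f _; exact: sqr_ge0.
rewrite mulrBl; apply: lerB.
  by rewrite ler_pdivlMr// mulrC ler_wpM2r// ler_nat leq_pred.
apply: ler_wpM2l => //; rewrite lef_pV2 ?posrE ?ltr0n//; last first.
  by move: nN; case: (N) => [|[|]].
by rewrite ler_nat; move: nN; case: (N).
Qed.

(** Lower semicontinuity of the energy. For fixed [m] only finitely many moments occur and the
    diagonal correction is divided by a size tending to infinity; [m] grows afterwards. *)
Lemma limit_energy_le (s : nat -> seq C) tau (dd : nat -> R) (W : R) :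
  lnw_integrable tau ->
  (forall k (f : {ffun 'I_k -> 'I_4}), seq_mean (sphere_mono f) (s n) @[n --> \oo] --> moment tau
    f) ->
  seq_mean (@lnw R) (s n) @[n --> \oo] --> lnw_mean tau ->
  (forall n, (n.+1 < size (s n))%N) ->
  (forall n, (discrete_energy (s n) <= (dd n)%:E)%E) -> dd n @[n --> \oo] --> W ->
  (energy tau <= W%:E)%E.
Proof.
move=> itau Hm HL Hs Hd dW; rewrite energyE// leeBlDr//.
apply: lime_le.
  apply: is_cvg_nneseries => k _ _; by rewrite lee_fin mulr_ge0 ?kcoef_ge0 ?pair_moment_ge0.
apply: nearW => m; rewrite big_mkord sumEFin lee_fin.
apply: le_trans (@limit_chord_energy s tau dd W _ m Hm HL Hs Hd dW) _; rewrite lerD2l; lra.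
Qed.

Lemma continuous_ball_bump (z : C) (r : R) :
  continuous (fun t => Num.max 0 (r - Normc.normc (t - z))).
Proof.
apply: lip_continuous => t w /=.
have h : `|Normc.normc (w - z) - Normc.normc (t - z)| <= Normc.normc (w - t).
  have h1 := normc_distD t w z; have h2 := normc_distD w t z.
  rewrite (normc_distC t w) in h1.
  by rewrite ler_norml; apply/andP; split; lra.
move: h; set a := Normc.normc (w - z); set b := Normc.normc (t - z); set c := Normc.normc (w - t).
rewrite !ler_norml => /andP[h1 h2].
by apply/andP; split; rewrite !maxEle; do 2 case: ifPn => ?; lra.
Qed.

(** The test function is a cone, positive exactly on the ball and dominated by a multiple of its
    indicator. *)
Lemma limit_ball_null (s : nat -> seq C) tau (z : C) (r : R) :
  (forall phi : C -> R, continuous phi -> (exists K, forall z, `|phi z| <= K) ->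
    (seq_mean phi (s n))%:E @[n --> \oo] --> (\int[tau]_z (phi z)%:E)%E) ->
  seq_mean (fun t => (Normc.normc (t - z) < r)%R%:R) (s n) @[n --> \oo] --> (0 : R) ->
  tau [set t | Normc.normc (t - z) < r] = 0%E.
Proof.
move=> Hphi H0.
pose phi (t : C) : R := Num.max 0 (r - Normc.normc (t - z)).
have phi0 t : 0 <= phi t by rewrite le_max lexx.
have phir t : phi t <= `|r| * (Normc.normc (t - z) < r)%R%:R.
  rewrite /phi ge_max mulr_ge0//=; have := normc_ge0 (t - z); have := ler_norm r.
  by case: ltP => /=; lra.
have iphi : (\int[tau]_t (phi t)%:E = 0)%E.
  have c1 : (seq_mean phi (s n))%:E @[n --> \oo] --> (\int[tau]_z (phi z)%:E)%E.
    apply: Hphi; first exact: continuous_ball_bump.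
    exists `|r| => t; rewrite ger0_norm//; apply: le_trans (phir t) _.
    by rewrite ler_piMr//; case: (_ < _).
  have c2 : seq_mean phi (s n) @[n --> \oo] --> (0 : R).
    apply: (@squeeze_cvgr _ _ _ _ (fun=> 0) (fun n => `|r| * seq_mean (fun t => (Normc.normc (t -
      z) < r)%R%:R) (s n))).
    - apply: nearW => n; apply/andP; split.
        by rewrite mulr_ge0 ?invr_ge0//; apply: sumr_ge0.
      by rewrite /seq_mean mulrCA ler_wpM2l ?invr_ge0// mulr_sumr; apply: ler_sum.
    - exact: cvg_cst.
    - by rewrite -[X in _ --> X](mulr0 `|r|); apply: cvgMr.
  apply: (cvg_unique _ c1); first exact: ereal_hausdorff.
  by apply: cvg_EFin c2; exact: nearW.
rewrite (_ : [set t | _] = [set t | 0 < phi t]).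
  apply: integral_fun0_negligible => //.
  by apply: measurable_fun_continuous; exact: continuous_ball_bump.
by apply/seteqP; split=> t /=; rewrite /phi lt_max ltxx subr_gt0.
Qed.

End discrete_energies.

(** * Maximum principle and interpolation for polynomials *)

Section polynomials.
Context {R : realType}.
Local Notation C := R[i].
Local Notation normc := Normc.normc.
Implicit Types (p : {poly C}) (z w h : C).

Lemma horner_bounded p : exists2 B, 0 <= B & forall h, normc h <= 1 -> normc p.[h] <= B.
Proof.
elim/poly_ind: p => [|p c [B B0 Bp]].
  by exists 0 => // h _; rewrite horner0 Normc.normc0.
exists (B + normc c); first by rewrite addr_ge0// normc_ge0.
move=> h h1; rewrite hornerMXaddC; apply: le_trans (le_normcD _ _) _.
rewrite lerD2r Normc.normcM; apply: le_trans (ler_piMr _ h1) (Bp h h1).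
exact: normc_ge0.
Qed.

Lemma horner_lipschitz0 p : exists2 B, 0 <= B &
  forall h, normc h <= 1 -> normc (p.[h] - p.[0]) <= B * normc h.
Proof.
elim/poly_ind: p => [|p c _].
  by exists 0 => // h _; rewrite !horner0 subrr Normc.normc0 mul0r.
have [B B0 Bp] := horner_bounded p.
exists B => // h h1; rewrite !hornerMXaddC mulr0 add0r addrK Normc.normcM.
by rewrite ler_wpM2r ?normc_ge0// Bp.
Qed.

Lemma continuous_normc_horner p : continuous (fun z => normc p.[z]).
Proof.
move=> z; apply/continuous_normcP => e e0.
have [B B0 Bp] := horner_lipschitz0 (p \Po ('X + z%:P)).
have B1 : 0 < B + 1 by rewrite ltr_wpDl.
exists (Num.min 1 (e / (B + 1))); first by rewrite lt_min ltr01 divr_gt0.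
move=> w; rewrite lt_min => /andP[w1 w2].
have := Bp (w - z) (ltW w1); rewrite !horner_comp !hornerE subrK => h.
have h1 := normc_distD p.[w] p.[z] 0; have h2 := normc_distD p.[z] p.[w] 0.
rewrite !subr0 in h1 h2; rewrite normc_distC in h2.
have h3 : B * normc (w - z) < e.
  apply: le_lt_trans (_ : (B + 1) * normc (w - z) < e).
    by rewrite ler_wpM2r ?normc_ge0// lerDl.
  by rewrite mulrC -ltr_pdivlMr.
by rewrite ltr_norml; apply/andP; split; lra.
Qed.

(** Near [z] a nonconstant polynomial is [a + h ^+ m * g.[h]] with [g.[0] = c] nonzero. Along
    [zeta], an [m]-th root of [a / c], the second term points in the direction of [a] and increases
    the modulus. *)
Lemma horner_local_max p z (r : R) : 0 < r -> p.[z] != 0 ->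
  (forall w, normc (w - z) < r -> normc p.[w] <= normc p.[z]) -> (size p <= 1)%N.
Proof.
move=> r0 pz pmax; rewrite leqNgt; apply/negP => sp.
pose q := p \Po ('X + z%:P); pose a := p.[z].
have qE h : q.[h] = p.[h + z] by rewrite horner_comp !hornerE.
have q0 : q - a%:P != 0.
  apply/eqP => /subr0_eq qa; have := size_comp_poly2 p (size_XaddC z).
  rewrite -/q qa => e; move: sp; rewrite -e size_polyC.
  by case: (a != 0).
have [m [g]] := multiplicity_XsubC (q - a%:P) 0.
rewrite q0 /= => g0; rewrite polyC0 subr0 => qE2.
have m0 : (0 < m)%N.
  case: m qE2 => // e; move: g0; rewrite expr0 mulr1 in e.
  by rewrite /root -e !hornerE qE add0r subrr eqxx.
pose c := g.[0].
have c0 : c != 0 by move: g0; rewrite /root.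
pose zeta : C := m.-root (a / c).
have zm : zeta ^+ m = a / c by rewrite rootCK.
have [B B0 Bg] := horner_lipschitz0 g.
have nc0 : 0 < normc c by rewrite lt_neqAle normc_ge0 andbT;
  apply: contra c0 => /eqP/esym/Normc.eq0_normc/eqP.
have na0 : 0 < normc a by rewrite lt_neqAle normc_ge0 andbT;
  apply: contra pz => /eqP/esym/Normc.eq0_normc/eqP.
pose N := normc zeta + 1.
have N0 : 0 < N by rewrite ltr_wpDl// normc_ge0.
have Nz : normc zeta < N by rewrite ltrDl.
(* With [d] equal to [Num.min r 1 / D], the point [h] has modulus below [r] and below 1, and
   [B * normc h] is below half of [normc c]; hence [u] lies within 1/2 of 1. *)
pose D := N * (2 * B / normc c + 1).
have D1 : 0 < 2 * B / normc c + 1 by rewrite ltr_wpDl// divr_ge0 ?normc_ge0// mulr_ge0.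
pose d := Num.min r 1 / D.
have D0 : 0 < D by rewrite mulr_gt0.
have d0 : 0 < d by rewrite divr_gt0// lt_min r0 ltr01.
pose h : C := d%:C%C * zeta.
have nh : normc h = d * normc zeta.
  by rewrite Normc.normcM; congr (_ * _); rewrite /= expr0n addr0 sqrtr_sqr ger0_norm// ltW.
have hD : normc h * (2 * B / normc c + 1) < Num.min r 1.
  rewrite nh; apply: lt_le_trans (_ : d * D <= _); last by rewrite /d divfK ?gt_eqF.
  by rewrite -(mulrA d) (ltr_pM2l d0) (ltr_pM2r D1).
have h_le : normc h <= normc h * (2 * B / normc c + 1).
  by rewrite ler_peMr ?normc_ge0// lerDr divr_ge0 ?normc_ge0// mulr_ge0.
have hr : normc h < r by apply: le_lt_trans h_le _; apply: lt_le_trans hD _; rewrite ge_min lexx.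
have h1 : normc h < 1 by apply: le_lt_trans h_le _; apply: lt_le_trans hD _;
  rewrite ge_min lexx orbT.
have hB : B * normc h < normc c / 2.
  have : normc h * (2 * B / normc c) < 1.
    apply: lt_le_trans (_ : Num.min r 1 <= 1); last by rewrite ge_min lexx orbT.
    by apply: le_lt_trans hD; rewrite ler_wpM2l ?normc_ge0// lerDl.
  rewrite mulrA ltr_pdivrMr// mul1r ltr_pdivlMr// => H; apply: le_lt_trans H; rewrite le_eqVlt;
    apply/orP; left; apply/eqP; ring.
pose u := g.[h] / c.
have uE : q.[h] = a * (1 + (d ^+ m)%:C%C * u).
  have := congr1 (fun P => P.[h]) qE2; rewrite hornerD hornerN hornerC hornerM horner_exp hornerX.
  move=> /(canRL (subrK _)) ->.
  rewrite /h exprMn zm -rmorphXn /u; field; exact: c0.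
have Reu : 1 / 2 < Re u.
  have : normc (u - 1) < 1 / 2.
    have -> : u - 1 = (g.[h] - c) / c by rewrite mulrBl mulfV.
    rewrite Normc.normcM Normc.normcV ltr_pdivrMr// [_ / 2 * _]mulrC mulrA mulr1.
    exact: le_lt_trans (Bg h (ltW h1)) hB.
  move=> /(le_lt_trans (Re_le_normc _));
    rewrite ReB ltr_norml (_ : Re (1 : C) = 1)// => /andP[+ _]; lra.
have := pmax (h + z); rewrite addrK -qE => /(_ hr).
rewrite uE Normc.normcM -/a -[leRHS]mulr1 ler_pM2l// leNgt => /negP; apply.
apply: lt_le_trans (le_trans (ler_norm _) (Re_le_normc _)).
have -> : Re (1 + (d ^+ m)%:C%C * u) = 1 + d ^+ m * Re u.
  by case: (u) => x y /=; rewrite mul0r subr0.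
by rewrite ltrDl mulr_gt0 ?exprn_gt0//; lra.
Qed.

(** At a maximum point of the modulus off [E] the polynomial either vanishes or is constant; the
    point [e0] of [E] settles both cases. *)
Lemma poly_max_principle p (K E : set C) (B : R) e0 : compact K -> E `<=` K -> E e0 ->
  (forall z, K z -> ~ E z -> exists2 r, 0 < r & forall w, normc (w - z) < r -> K w) ->
  (forall z, E z -> normc p.[z] <= B) -> forall z, K z -> normc p.[z] <= B.
Proof.
move=> cK EK Ee0 Kint EB z Kz.
have [|z1] := compact_EVT_max _ cK (continuous_subspaceT (@continuous_normc_horner p)).
  by exists z.
rewrite inE => Kz1 z1max.
apply: le_trans (z1max z _) _; first by rewrite inE.
have [/EB//|nEz1] := pselect (E z1).
have [r r0 rK] := Kint z1 Kz1 nEz1.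
have [->|pz1] := eqVneq p.[z1] 0.
  by rewrite Normc.normc0; apply: le_trans (normc_ge0 _) (EB e0 Ee0).
have /size1_polyC pc : (size p <= 1)%N.
  by apply: (horner_local_max r0 pz1) => w wr; apply: z1max; rewrite inE; exact: rK.
by have := EB e0 Ee0; rewrite pc !hornerC.
Qed.

(** The sum minus 1 is a polynomial of degree at most [n] vanishing at the [n.+1] nodes. *)
Lemma lagrange_one (K : fieldType) n (F : 'I_n.+1 -> K) (x : K) : injective F ->
  \sum_i \prod_(j | j != i) ((x - F j) / (F i - F j)) = 1.
Proof.
move=> Finj.
pose l (i : 'I_n.+1) : {poly K} := \prod_(j | j != i) ((F i - F j)^-1 *: ('X - (F j)%:P)).
have lE i (w : K) : (l i).[w] = \prod_(j | j != i) ((w - F j) / (F i - F j)).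
  by rewrite horner_prod; apply: eq_bigr => j _; rewrite hornerZ hornerXsubC mulrC.
have ldiag i : (l i).[F i] = 1.
  rewrite lE big1// => j ji; rewrite mulfV// subr_eq0; apply: contra ji => /eqP /Finj ->//.
have loff i k : k != i -> (l i).[F k] = 0.
  by move=> ki; rewrite lE (bigD1 k)//= subrr !mul0r.
pose L := \sum_i l i - 1.
suff L0 : L = 0.
  have := congr1 (fun P => P.[x]) L0; rewrite horner0 hornerD hornerN hornerC horner_sum.
  by move=> /subr0_eq h; rewrite -[RHS]h; apply: eq_bigr => i _; rewrite lE.
apply/eqP; apply: contraT => L0.
have sL : (size L <= n.+1)%N.
  apply: leq_trans (size_polyD _ _) _; rewrite geq_max size_polyN size_poly1 andbT.
  apply: leq_trans (size_sum _ _ _) _; apply/bigmax_leqP => i _.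
  apply: leq_trans (size_poly_prod_leq _ _) _.
  rewrite cardC1 card_ord leq_subLR.
  apply: (@leq_trans (\sum_(j | j != i) 2).+1).
    rewrite ltnS; apply: leq_sum => j _; apply: leq_trans (size_scale_leq _ _) _.
    by rewrite size_XsubC.
  by rewrite sum_nat_const cardC1 card_ord /=; lia.
have roots : all (root L) [seq F i | i <- enum 'I_n.+1].
  apply/allP => _ /mapP[k _ ->]; rewrite /root hornerD hornerN hornerC horner_sum (bigD1 k)//=.
  by rewrite ldiag big1 ?addr0 ?subrr// => i ik; apply: loff; rewrite eq_sym.
have un : uniq [seq F i | i <- enum 'I_n.+1] by rewrite map_inj_uniq ?enum_uniq.
have := max_poly_roots L0 roots un; rewrite size_map size_enum_ord => h.
by have := leq_trans h sL; rewrite ltnn.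
Qed.

End polynomials.

(** * Almost minimal configurations *)

Section log_sums.
Context {R : realType}.
Local Notation C := R[i].
Local Notation normc := Normc.normc.
Implicit Types (s t : seq C) (z w : C).

(* On the diagonal ln 0 = 0, so that the sums below skip coinciding points. *)
Definition lk z w : R := - ln (normc (z - w)).

Definition log_sum s z : R := \sum_(w <- s) lk z w.

(** Ordered pairs are counted, whence the factor 2 each time a point is added or removed. *)
Definition pair_sum s : R := \sum_(z <- s) log_sum s z.

Lemma lkzz z : lk z z = 0.
Proof. by rewrite /lk subrr Normc.normc0 ln0 ?oppr0. Qed.

Lemma lkC z w : lk z w = lk w z.
Proof. by rewrite /lk normc_distC. Qed.

Lemma normc_gt0 z : (0 < normc z) = (z != 0).
Proof.
apply/idP/idP => [|z0]; first by apply: contraTneq => ->; rewrite Normc.normc0 ltxx.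
by rewrite lt_neqAle normc_ge0 andbT; apply: contra z0 => /eqP/esym/Normc.eq0_normc/eqP.
Qed.

Lemma lk_ge z w B : 1 <= B -> normc (z - w) <= B -> - ln B <= lk z w.
Proof.
move=> B1 zB; rewrite lerN2; have [->|zw] := eqVneq z w.
  by rewrite subrr Normc.normc0 ln0 ?ln_ge0.
by rewrite ler_ln ?posrE ?normc_gt0 ?subr_eq0//; lra.
Qed.

Lemma log_sum_cons w s z : log_sum (w :: s) z = lk z w + log_sum s z.
Proof. by rewrite /log_sum big_cons. Qed.

Lemma pair_sum_cons z s : pair_sum (z :: s) = pair_sum s + 2 * log_sum s z.
Proof.
rewrite /pair_sum big_cons log_sum_cons lkzz add0r.
under eq_bigr do rewrite log_sum_cons.
rewrite big_split /= /log_sum.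
under [X in _ + (X + _)]eq_bigr do rewrite lkC.
ring.
Qed.

Lemma perm_log_sum s t z : perm_eq s t -> log_sum s z = log_sum t z.
Proof. by move=> st; apply: perm_big. Qed.

Lemma perm_pair_sum s t : perm_eq s t -> pair_sum s = pair_sum t.
Proof.
move=> st; rewrite /pair_sum (perm_big _ st) /=.
by apply: eq_bigr => z _; exact: perm_log_sum.
Qed.

Lemma log_sum_rem w s z : w \in s -> log_sum s z = lk z w + log_sum (rem w s) z.
Proof. by move=> ws; rewrite (perm_log_sum _ (perm_to_rem ws)) log_sum_cons. Qed.

Lemma pair_sum_rem w s : w \in s -> pair_sum s = pair_sum (rem w s) + 2 * log_sum s w.
Proof.
move=> ws; rewrite (perm_pair_sum (perm_to_rem ws)) pair_sum_cons.
by rewrite (log_sum_rem _ ws) lkzz add0r.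
Qed.

Lemma log_sum_seq_mean s z : (0 < size s)%N ->
  log_sum s z = (size s)%:R * seq_mean (lk z) s.
Proof.
by move=> s0; rewrite /seq_mean mulrA mulfV ?mul1r// pnatr_eq0 -lt0n.
Qed.

Lemma discrete_energy_uniq s : uniq s -> (1 < size s)%N ->
  discrete_energy s = (pair_sum s / ((size s)%:R * (size s).-1%:R))%:E.
Proof.
move=> us s1; rewrite /discrete_energy.
rewrite (eq_bigr (fun k : 'I_(size s) => (\sum_(j < size s | (j < k)%N) lk s`_j s`_k)%:E));
  last first.
  move=> k _; rewrite -sumEFin; apply: eq_bigr => j jk; rewrite log_kernel_real//.
  by rewrite nth_uniq// ltn_eqF.
rewrite sumEFin -EFinM (@sum_triangle _ _ (fun j k => lk s`_j s`_k)); last by move=> *; exact: lkC.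
rewrite [X in _ - X]big1 => [|k _]; last exact: lkzz.
rewrite /pair_sum (big_nth 0) big_mkord subr0; congr (_%:E).
rewrite mulrA [_ / _ * 2^-1]mulrAC mulfV ?mul1r// mulrC; congr (_ / _).
apply: eq_bigr => k _; rewrite /log_sum (big_nth 0) big_mkord.
by apply: eq_bigr => j _; exact: lkC.
Qed.

Lemma normc_prod_log_sum s z : z \notin s ->
  normc (\prod_(w <- s) (z - w)) = expR (- log_sum s z).
Proof.
elim: s => [|w s ih]; first by rewrite /log_sum !big_nil Normc.normc1 oppr0 expR0.
rewrite in_cons negb_or => /andP[zw /ih {}ih].
rewrite big_cons Normc.normcM ih log_sum_cons opprD expRD; congr (_ * _).
by rewrite /lk opprK lnK// posrE normc_gt0 subr_eq0.
Qed.

Lemma lagrange_seq s z : uniq s -> (0 < size s)%N ->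
  \sum_(a <- s) (\prod_(b <- rem a s) (z - b)) / (\prod_(b <- rem a s) (a - b)) = 1.
Proof.
case: s => // x s us _; set t := x :: s.
pose F (i : 'I_(size s).+1) := t`_i.
have Finj : injective F by move=> i j /eqP; rewrite nth_uniq// => /eqP/val_inj.
rewrite -[RHS](lagrange_one z Finj) (big_nth 0) big_mkord; apply: eq_bigr => i _.
have remE (g : C -> C) : \prod_(b <- rem t`_i t) g b = \prod_(j | j != i) g (F j).
  rewrite rem_filter// big_filter (big_nth 0) big_mkord; apply: eq_bigl => j.
  by rewrite /= nth_uniq.
by rewrite prodf_div !remE.
Qed.

End log_sums.

(** * Greedy and almost minimal configurations *)

Section fekete.
Context {R : realType}.
Local Notation C := R[i].
Local Notation normc := Normc.normc.
Implicit Types (tau : probability C R) (s : seq C) (z w : C).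

Lemma chord_log_diag z : chord_log z z = +oo%E.
Proof.
have := log_kernelE z z; rewrite /log_kernel subrr Normc.normc0 le0_lneNy//.
by case: (chord_log z z) (chord_log_ge0 z z).
Qed.

Lemma chord_log_real z w : z != w -> chord_log z w = (lk z w + lnw z + lnw w)%:E.
Proof.
move=> zw; have := log_kernelE z w; rewrite log_kernel_real// -/(lk z w).
case: (chord_log z w) (chord_log_ge0 z w) => // r _; rewrite -EFinB => -[->].
by congr EFin; ring.
Qed.

Context (E : set C) (mu : probability C R) (M V : R).
Hypotheses (mE : measurable E) (EM : forall z, E z -> normc z <= M)
  (mu_E : probabilities_on E mu) (robin_V : robin E = V%:E)
  (energy_V : energy mu = V%:E).

(** The [mu]-mean of the total kernel of [s] is the sum of the values of U at its points, namely
    [(size s)%:R * V]; some good point does not exceed this mean. The sum being finite there, the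
    new point differs from all old ones. *)
Lemma exists_small_log_sum s : (forall w, w \in s -> log_pot mu w = V%:E) ->
  exists z, [/\ E z, log_pot mu z = V%:E, z \notin s & log_sum s z <= (size s)%:R * V].
Proof.
move=> sV; have imu : lnw_integrable mu := probabilities_on_lnw mE EM mu_E.
pose c : R := \sum_(w <- s) lnw w + (size s)%:R * V; pose n : R := (size s)%:R.
pose f z : \bar R := (\sum_(w <- s) chord_log w z)%E.
(* Off [s] this is [log_sum s z - (size s)%:R * V], expressed by nonnegative chordal terms; on [s]
   it is infinite. *)
pose W z : \bar R := (f z - (c + n * lnw z)%:E)%E.
have f0 z : (0 <= f z)%E by apply: sume_ge0 => w _; exact: chord_log_ge0.
have mf : measurable_fun setT f by apply: emeasurable_sum => w; exact: measurable_chord_log.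
have i1 : mu.-integrable setT (fun z => (n%:E * (lnw z)%:E)%E) by exact: (integrableZl measurableT
  n imu).
have i2 := integrableD measurableT (finite_measure_integrable_cst mu c measurableT) i1.
have mW : measurable_fun setT W.
  by apply: emeasurable_funB => //; case/integrableP: i2.
have iW : (\int[mu]_z W z = 0)%E.
  rewrite integral_ge0B// ge0_integral_sum//; last 2 first.
  - by move=> w; exact: measurable_chord_log.
  - by move=> w z _; exact: chord_log_ge0.
  transitivity ((c + n * lnw_mean mu)%:E - (c + n * lnw_mean mu)%:E)%E;
    last by rewrite -EFinB subrr.
  congr (_ - _)%E.
    rewrite big_seq (eq_bigr (fun w => (lnw w + (V + lnw_mean mu))%:E)); last first.
      move=> w ws; rewrite integral_chord_log; have := log_potE w imu; rewrite sV//.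
      case: (chord_pot mu w) (chord_pot_ge0 mu w) => // r _; rewrite -EFinB => -[->].
      by congr EFin; ring.
    rewrite -big_seq sumEFin big_split /= big_const_seq count_predT iter_addr_0 -mulr_natl.
    by congr EFin; rewrite /c /n; ring.
  under eq_integral do rewrite EFinD EFinM.
  rewrite integralD//=; last exact: finite_measure_integrable_cst.
  rewrite integral_cst// measure_probT mule1 integralZl//.
  by rewrite -EFin_lnw_mean.
have aeP : {ae mu, forall z, E z /\ log_pot mu z = V%:E}.
  have aeE : {ae mu, forall z, E z}.
    by exists (~` E); split=> //; exact: measurableC.
  have := equilibrium_pot_ae mE EM mu_E robin_V energy_V.
  by apply: filterS2 aeE => z.
have [z [Ez zV] Wz] := exists_le_mean mW iW aeP.
have fz : (f z <= (c + n * lnw z)%:E)%E by move: Wz; rewrite /W leeBlDr// add0e.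
have zs : z \notin s.
  apply/negP => zs; move: fz; rewrite /f (big_rem z zs)/= chord_log_diag addye ?leye_eq//.
  by rewrite gt_eqF//; apply: lt_le_trans ltNy0 _; apply: sume_ge0 => w _; exact: chord_log_ge0.
exists z; split=> //; move: fz.
rewrite /f (eq_big_seq (fun w => (lk z w + lnw w + lnw z)%:E)); last first.
  move=> w ws; have wz : w != z by apply: contraNneq zs => <-.
  by rewrite (chord_log_real wz) (lkC w); congr (_%:E); ring.
rewrite sumEFin lee_fin !big_split /= big_const_seq count_predT iter_addr_0 -mulr_natl.
rewrite -/(log_sum s z) /c -/n; lra.
Qed.

Definition admissible n s := [/\ uniq s, size s = n & forall z, z \in s -> E z].

(** Points are added one by one, the [n]-th addition costing at most [2 * n%:R * V]. All of them are
    kept in the set where U equals V, so that the mean argument can be repeated. *)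
Lemma greedy_admissible n : exists2 s, admissible n s &
  pair_sum s <= n%:R * (n%:R - 1) * V.
Proof.
suff [s [ns _ h]] : exists s, [/\ admissible n s, forall w, w \in s -> log_pot mu w = V%:E &
    pair_sum s <= n%:R * (n%:R - 1) * V] by exists s.
elim: n => [|n [s [[us sn sE] sV sle]]].
  by exists [::]; split=> //; rewrite /pair_sum big_nil !mul0r.
have [z [Ez zV zs zle]] := exists_small_log_sum sV.
exists (z :: s); split.
- split; [by rewrite /= zs|by rewrite /= sn|].
  by move=> w; rewrite in_cons => /orP[/eqP ->|/sE].
- by move=> w; rewrite in_cons => /orP[/eqP ->|/sV].
- rewrite pair_sum_cons; rewrite sn in zle.
  rewrite -(natr1 n) addrK; apply: le_trans (lerD sle (ler_wpM2l _ zle)) _ => //.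
  by rewrite le_eqVlt; apply/orP; left; apply/eqP; ring.
Qed.

(** Configurations within 1 of the infimum suffice, since errors are divided by the number of
    points; attainment is not discussed. *)
Let sigma n := inf [set pair_sum s | s in admissible n].

Lemma has_inf_pair_sum n : has_inf [set pair_sum s | s in admissible n].
Proof.
split; first by have [s ns _] := greedy_admissible n; exists (pair_sum s), s.
pose B := 2 * `|M| + 1.
have B1 : 1 <= B by rewrite lerDr mulr_ge0.
exists (- (n%:R * (n%:R * ln B))) => _ [s [us sn sE] <-].
have h (a : R) (g : C -> R) : (forall w, w \in s -> a <= g w) -> n%:R * a <= \sum_(w <- s) g w.
  move=> ag; rewrite -sn mulr_natl -iter_addr_0 -(count_predT s) -big_const_seq.
  by rewrite big_seq [leRHS]big_seq; apply: ler_sum.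
rewrite -mulrN; apply: (h) => z zs; rewrite -mulrN; apply: h => w ws.
apply: lk_ge => //; have := normc_distD z 0 w; rewrite subr0 add0r normcN.
have := EM (sE _ zs); have := EM (sE _ ws); have := ler_norm M; rewrite /B; lra.
Qed.

Lemma sigma_le n s : admissible n s -> sigma n <= pair_sum s.
Proof.
move=> ns; apply: ge_inf; last by exists s.
by case: (has_inf_pair_sum n).
Qed.

(** If all increments from [N] on were larger, [sigma] would grow quadratically with factor
    [V + eta], against the greedy bound [n%:R * (n%:R - 1) * V]. *)
Lemma sigma_growth (eta : R) N : 0 < eta ->
  exists2 n, (N <= n)%N & sigma n.+1 - sigma n <= 2 * n%:R * (V + eta).
Proof.
move=> eta0; apply: contrapT => nex.
have grow n : (N <= n)%N -> sigma n + 2 * n%:R * (V + eta) <= sigma n.+1.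
  move=> Nn; rewrite -lerBrDl leNgt; apply/negP => h; apply: nex.
  by exists n => //; exact: ltW.
have low k : sigma N + (V + eta) * ((N + k)%:R * ((N + k)%:R - 1) - N%:R * (N%:R - 1)) <= sigma (N
  + k)%N.
  elim: k => [|k ih]; first by rewrite addn0 subrr mulr0 addr0.
  rewrite addnS; apply: le_trans (grow _ (leq_addr _ _)).
  apply: le_trans (lerD ih (lexx _)); rewrite -(natr1 (N + k)) le_eqVlt; apply/orP; left;
    apply/eqP; ring.
have up n : sigma n <= n%:R * (n%:R - 1) * V.
  by have [s ns sle] := greedy_admissible n; apply: le_trans sle; exact: sigma_le.
pose a := (V + eta) * (N%:R * (N%:R - 1)) - sigma N.
have bd k : eta * k%:R <= a.
  have := le_trans (low k.+2) (up _); rewrite /a natrD -(natr1 k.+1) -(natr1 k).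
  have x0 : 0 <= N%:R :> R by [].
  have y0 : 0 <= k%:R :> R by [].
  set x := N%:R in x0 *; set y := k%:R in y0 *; set S := sigma N => h.
  have hy : y <= (x + (y + 1 + 1)) * (x + (y + 1 + 1) - 1).
    have := mulr_ge0 x0 x0; have := mulr_ge0 x0 y0; have := mulr_ge0 y0 y0; lra.
  have := ler_wpM2l (ltW eta0) hy; lra.
have := bd (Num.truncn (a / eta)).+1; rewrite leNgt => /negP; apply.
by rewrite mulrC -ltr_pdivrMr// truncnS_gt.
Qed.

(** For a configuration within 1 of the infimum: removing a point leaves at least [sigma n], which
    bounds [log_sum] at every point by the increment of [sigma]; replacing [a] by [z] lowers
    [pair_sum] by at most 1. *)
Lemma near_minimizer (eta : R) N : 0 < eta -> exists n s,
  [/\ (N <= n)%N, admissible n.+1 s, pair_sum s <= n.+1%:R * n%:R * V + 1,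
      forall z, z \in s -> log_sum s z <= n%:R * (V + eta) + 1 &
      forall a z, a \in s -> E z -> z \notin rem a s -> log_sum s a - 1 <= log_sum (rem a s) z].
Proof.
move=> eta0; have [n Nn hn] := sigma_growth N eta0.
have [_ [s ns <-] slt] := inf_adherent ltr01 (has_inf_pair_sum n.+1).
rewrite -/(sigma n.+1) in slt.
have [us sn sE] := ns.
have rem_ok a : a \in s -> admissible n (rem a s).
  move=> as_; split; first exact: rem_uniq.
    by rewrite size_rem// sn.
  by move=> z /mem_rem/sE.
have [u un ule] := greedy_admissible n.+1.
have := sigma_le un => su.
exists n, s; split=> //.
- have -> : n%:R = n.+1%:R - 1 :> R by rewrite -natr1 addrK.
  lra.
- move=> z zs; have := pair_sum_rem zs; have := sigma_le (rem_ok z zs); lra.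
- move=> a z as_ Ez zs; have [ur sr rE] := rem_ok a as_.
  have : admissible n.+1 (z :: rem a s).
    split; [by rewrite /= zs|by rewrite /= sr|].
    by move=> w; rewrite in_cons => /orP[/eqP ->|/rE].
  move=> /sigma_le; rewrite pair_sum_cons; have := pair_sum_rem as_; lra.
Qed.

End fekete.

(** * Identification of weak limits *)

Section equilibrium_limits.
Context {R : realType}.
Local Notation C := R[i].
Local Notation normc := Normc.normc.
Implicit Types (tau : probability C R) (s : nat -> seq C) (z w : C).

Lemma seq_mean_moment s tau :
  (forall phi : C -> R, continuous phi -> (exists K, forall z, `|phi z| <= K) ->
    (seq_mean phi (s n))%:E @[n --> \oo] --> (\int[tau]_z (phi z)%:E)%E) ->
  forall k (f : {ffun 'I_k -> 'I_4}),
    seq_mean (sphere_mono f) (s n) @[n --> \oo] --> moment tau f.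
Proof.
move=> H k f; have := H _ (@continuous_sphere_mono R k f).
rewrite -EFin_moment => c; apply: fine_cvg (c _).
by exists 1 => z; exact: sphere_mono_bound.
Qed.

Lemma seq_mean_lnw s tau : lnw_integrable tau ->
  (seq_mean (@lnw R) (s n))%:E @[n --> \oo] --> (\int[tau]_z (lnw z)%:E)%E ->
  seq_mean (@lnw R) (s n) @[n --> \oo] --> lnw_mean tau.
Proof. by move=> itau; rewrite -EFin_lnw_mean// => c; exact: fine_cvg c. Qed.

Lemma eq_seq_mean (phi psi : C -> R) (u : seq C) :
  (forall z, z \in u -> phi z = psi z) -> seq_mean phi u = seq_mean psi u.
Proof. by move=> h; rewrite /seq_mean (eq_big_seq _ h). Qed.

Lemma open_normc_ball z (r : R) : open [set w | normc (w - z) < r].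
Proof.
rewrite openE => w /= wr; apply/nbhs_normcP; exists (r - normc (w - z)); first by rewrite subr_gt0.
by move=> t tw /=; have := normc_distD t w z; lra.
Qed.

Lemma measurable_normc_ball z (r : R) : measurable [set w | normc (w - z) < r].
Proof. exact: measurable_plane_open (@open_normc_ball z r). Qed.

Lemma continuous_trunc_lk z (d : R) : 0 < d ->
  continuous (fun w => - ln (Num.max d (normc (z - w)))).
Proof.
move=> d0.
have c1 : continuous (fun w => Num.max d (normc (z - w))).
  apply: lip_continuous => w t /=.
  have h : `|normc (z - t) - normc (z - w)| <= normc (t - w).
    have h1 := normc_distD z w t; have h2 := normc_distD z t w.
    rewrite (normc_distC w t) in h1.
    by rewrite ler_norml; apply/andP; split; lra.
  move: h; set a := normc (z - t); set b := normc (z - w); set c := normc (t - w).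
  rewrite !ler_norml => /andP[h1 h2].
  by apply/andP; split; rewrite !maxEle; do 2 case: ifPn => ?; lra.
move=> w.
have h : {for w, continuous (@ln R \o (fun w => Num.max d (normc (z - w))))}.
  apply: continuous_comp; first exact: c1.
  by apply: continuous_ln; rewrite lt_max d0.
exact: cvgN h.
Qed.

Lemma measurable_log_kernel z : measurable_fun setT (log_kernel z).
Proof.
rewrite (_ : log_kernel z = fun t => chord_log z t - (lnw z + lnw t)%:E)%E; last first.
  by apply/funext => t; exact: log_kernelE.
apply: emeasurable_funB; first exact: measurable_chord_log.
apply/measurable_EFinP; apply: measurable_funD => //.
by apply: measurable_fun_continuous; exact: continuous_lnw.
Qed.

Context (E : set C) (mu : probability C R) (M V : R).
Hypotheses (mE : measurable E) (EM : forall z, E z -> normc z <= M)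
  (mu_E : probabilities_on E mu) (robin_V : robin E = V%:E)
  (energy_V : energy mu = V%:E).
Hypothesis E_closed : forall z, ~ E z ->
  exists2 r, 0 < r & forall w, normc (w - z) < r -> ~ E w.

Let imu : lnw_integrable mu := probabilities_on_lnw mE EM mu_E.

(** Integrating the almost everywhere bound shows that the mutual energy is at least [V], the
    condition under which energies at most [V] force equality. *)
Lemma equilibrium_characterization tau : lnw_integrable tau ->
  (energy tau <= V%:E)%E -> {ae tau, forall z, (V%:E <= log_pot mu z)%E} ->
  forall A, measurable A -> tau A = mu A.
Proof.
move=> itau eV aeV; apply: (eq_measure_energy (V := V)) => //; first by rewrite energy_V.
pose g z := V + lnw_mean mu + lnw z.
have ig : tau.-integrable setT (EFin \o g).
  exact: (integrableD measurableT (finite_measure_integrable_cst tau (V + lnw_mean mu) measurableT)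
    itau).
have potE z : (chord_pot mu z - (g z)%:E = log_pot mu z - V%:E)%E.
  rewrite log_potE//; case: (chord_pot mu z) (chord_pot_ge0 mu z) => // r _.
  by rewrite -!EFinB; congr EFin; rewrite /g; ring.
have mW : measurable_fun setT (fun z => chord_pot mu z - (g z)%:E)%E.
  by apply: emeasurable_funB; [exact: measurable_chord_pot|case/integrableP: ig].
have : (0 <= \int[tau]_z (chord_pot mu z - (g z)%:E))%E.
  rewrite (_ : (\int[tau]_z _)%E = \int[tau]_z `|chord_pot mu z - (g z)%:E|)%E.
    exact: integral_ge0.
  apply: ae_eq_integral => //; first exact: measurableT_comp.
  by apply: filterS aeV => z Vz _; rewrite gee0_abs// potE sube_ge0.
rewrite integral_ge0B//; [|exact: measurable_chord_pot|by move=> z; exact: chord_pot_ge0].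
rewrite integral_chord_pot integral_log_pot// /g.
under eq_integral do rewrite EFinD.
rewrite integralD//=; last exact: finite_measure_integrable_cst.
rewrite integral_cst// measure_probT mule1 -EFin_lnw_mean//.
case: (chord_energy tau mu) => [r| |]; rewrite ?leey// -?EFinD -?EFinB ?lee_fin; lra.
Qed.

Lemma limit_supported s tau :
  (forall n z, z \in s n -> E z) ->
  (forall phi : C -> R, continuous phi -> (exists K, forall z, `|phi z| <= K) ->
    (seq_mean phi (s n))%:E @[n --> \oo] --> (\int[tau]_z (phi z)%:E)%E) ->
  tau (~` E) = 0%E.
Proof.
move=> sE H; apply: negligible_local; first exact: measurableC.
move=> z /E_closed[r r0 rE]; exists r => //.
exists [set w | normc (w - z) < r]; last by [].
split; first exact: measurable_normc_ball.
apply: (limit_ball_null H).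
rewrite (_ : (fun n => _) = fun=> 0); first exact: cvg_cst.
apply/funext => n; rewrite (eq_seq_mean (psi := fun=> 0)) /seq_mean ?big1 ?mulr0// => w ws.
by case: ltP => // /rE; case; exact: sE ws.
Qed.

(** The limit is carried by [E] and has energy at most [V]; being of finite energy, it does not
    charge the part of [E] where the potential is below [V]. *)
Lemma limit_equilibrium s tau (dd : nat -> R) :
  (forall n z, z \in s n -> E z) ->
  (forall phi : C -> R, continuous phi ->
    (seq_mean phi (s n))%:E @[n --> \oo] --> (\int[tau]_z (phi z)%:E)%E) ->
  (forall n, (n.+1 < size (s n))%N) ->
  (forall n, (discrete_energy (s n) <= (dd n)%:E)%E) -> dd n @[n --> \oo] --> V ->
  forall A, measurable A -> tau A = mu A.
Proof.
move=> sE H ss sd dV.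
have H' (phi : C -> R) : continuous phi -> (exists K, forall z, `|phi z| <= K) ->
  (seq_mean phi (s n))%:E @[n --> \oo] --> (\int[tau]_z (phi z)%:E)%E by move=> + _; exact: H.
have tE := limit_supported sE H'.
have itau : lnw_integrable tau := probabilities_on_lnw mE EM tE.
have eV : (energy tau <= V%:E)%E.
  apply: (limit_energy_le itau _ _ ss sd dV); first exact: seq_mean_moment.
  by apply: seq_mean_lnw => //; apply: H; exact: continuous_lnw.
apply: equilibrium_characterization => //.
have cfin : (chord_energy tau tau < +oo)%E.
  by move: eV; rewrite energyE// leeBlDr// -EFinD => /le_lt_trans; apply; rewrite ltry.
have := equilibrium_pot_ae_ge mE EM mu_E robin_V energy_V itau cfin => t0.
apply: (@negligibleS _ _ _ _ (~` E `|` (E `&` [set z | log_pot mu z < V%:E]%E))).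
  move=> z /= nV; have [Ez|] := pselect (E z); [right|by left].
  by split=> //=; rewrite ltNge; apply/negP.
apply: negligibleU; first by exists (~` E); split=> //; exact: measurableC.
exists (E `&` [set z | log_pot mu z < V%:E]%E); split=> //.
exact: (emeasurable_fun_infty_o mE (measurable_funTS (measurable_log_pot imu))).
Qed.

(** The kernel at a point off the closed set [E] agrees on [E] with its truncation at distance [r],
    which is continuous on the whole plane. *)
Lemma log_pot_limit s z : ~ E z -> (forall n w, w \in s n -> E w) ->
  (forall phi : C -> R, continuous phi ->
    (seq_mean phi (s n))%:E @[n --> \oo] --> (\int[mu]_z (phi z)%:E)%E) ->
  exists2 L, log_pot mu z = L%:E & seq_mean (lk z) (s n) @[n --> \oo] --> L.
Proof.
move=> /E_closed[r r0 rE] sE H.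
pose phi w := - ln (Num.max r (normc (z - w))).
have phiE w : E w -> phi w = lk z w.
  move=> Ew; rewrite /phi /lk max_r// leNgt normc_distC; apply/negP => /rE; exact.
have cphi : continuous phi by exact: continuous_trunc_lk.
have zE w : E w -> z != w.
  by move=> Ew; apply/eqP => zw; apply: (rE w) Ew; rewrite zw subrr Normc.normc0.
have ip : log_pot mu z = (\int[mu]_w (phi w)%:E)%E.
  apply: ae_eq_integral => //; first exact: measurable_log_kernel.
    by apply/measurable_EFinP; exact: measurable_fun_continuous.
  exists (~` E); split=> //; first exact: measurableC.
  move=> w /= nw Ew; apply: nw => _.
  by rewrite log_kernel_real ?zE// phiE.
have iphi : mu.-integrable setT (EFin \o phi).
  have [K KP] := continuous_bounded_ball M cphi.
  apply: (ae_bounded_integrable mE mu_E (M := K)); first exact: measurable_fun_continuous.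
  by move=> w /EM; exact: KP.
have fin := integrable_fin_num measurableT iphi.
exists (fine (\int[mu]_w (phi w)%:E)); first by rewrite ip fineK.
have := H phi cphi; rewrite -(fineK fin) => c.
have -> : (fun n => seq_mean (lk z) (s n)) = fun n => seq_mean phi (s n).
  by apply/funext => n; apply: eq_seq_mean => w /sE/phiE.
exact: fine_cvg c.
Qed.

End equilibrium_limits.

(** * Bounds for the potential off E *)

Section fekete_potential.
Context {R : realType}.
Local Notation C := R[i].
Local Notation normc := Normc.normc.
Implicit Types (s : seq C) (z w : C).
Context (E : set C) (mu : probability C R) (M V : R).
Hypotheses (mE : measurable E) (EM : forall z, E z -> normc z <= M)
  (mu_E : probabilities_on E mu) (robin_V : robin E = V%:E)
  (energy_V : energy mu = V%:E).
Hypothesis E_closed : forall z, ~ E z ->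
  exists2 r, 0 < r & forall w, normc (w - z) < r -> ~ E w.

(** One parameter bounds the size from below and the tolerance from above, so the property decreases
    in [k] and survives the selection of indices [e k] with [k <= e k]. *)
Definition almost_fekete k s := exists2 n, (k < n)%N &
  [/\ admissible E n.+1 s, pair_sum s <= n.+1%:R * n%:R * V + 1,
      forall z, z \in s -> log_sum s z <= n%:R * (V + k.+1%:R^-1) + 1 &
      forall a z, a \in s -> E z -> z \notin rem a s -> log_sum s a - 1 <= log_sum (rem a s) z].

Lemma harmonic_ge0 k : 0 <= k.+1%:R^-1 :> R.
Proof. by rewrite invr_ge0. Qed.

Lemma almost_fekete_leq k l s : (k <= l)%N -> almost_fekete l s -> almost_fekete k s.
Proof.
move=> kl [n ln [ns ps b c]]; exists n; first exact: leq_ltn_trans ln.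
split=> // z /b h; apply: le_trans h _.
by rewrite lerD2r ler_wpM2l// lerD2l lef_pV2 ?posrE ?ltr0n// ler_nat.
Qed.

Lemma discrete_energy_admissible n s : (0 < n)%N -> admissible E n.+1 s ->
  discrete_energy s = (pair_sum s / (n.+1%:R * n%:R))%:E.
Proof. by move=> n0 [us sn sE]; rewrite discrete_energy_uniq// sn. Qed.

Lemma almost_fekete_cvg : exists2 s : nat -> seq C, forall k, almost_fekete k (s k) &
  forall phi : C -> R, continuous phi ->
    (seq_mean phi (s n))%:E @[n --> \oo] --> (\int[mu]_z (phi z)%:E)%E.
Proof.
have : forall k, exists s, almost_fekete k s.
  move=> k; have k0 : 0 < k.+1%:R^-1 :> R by rewrite invr_gt0.
  have [n [s [kn ns a b c]]] := near_minimizer mE EM mu_E robin_V energy_V k.+1 k0.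
  by exists s, n.
move=> /choice[u fu].
have uE k z : z \in u k -> E z by have [n _ [[_ _ h] _ _ _]] := fu k; exact: h.
have [||e [tau [ek _ H]]] := @seq_mean_selection R u M.
- by move=> k; have [n _ [[_ -> _] _ _ _]] := fu k.
- by move=> k z /uE; exact: EM.
pose s k := u (e k).
have fs k : almost_fekete k (s k) by apply: almost_fekete_leq (fu (e k)); exact: ek.
exists s => // phi cphi; rewrite -(@eq_measure_integral _ _ _ _ mu tau); first exact: H.
move=> A mA _.
apply: (@limit_equilibrium R E mu M V mE EM mu_E robin_V energy_V E_closed s tau (fun k => V +
  k.+1%:R^-1)) => //.
- by move=> n z; exact: uE.
- by move=> k; have [n kn [[_ -> _] _ _ _]] := fs k; rewrite ltnS.
- move=> k; have [n kn [ns ps _ _]] := fs k.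
  have n0 : (0 < n)%N by exact: leq_ltn_trans kn.
  rewrite (discrete_energy_admissible n0 ns) lee_fin ler_pdivrMr ?mulr_gt0 ?ltr0n//.
  apply: le_trans ps _; rewrite mulrDl [V * _]mulrC lerD2l.
  by rewrite mulrC ler_pdivlMr ?ltr0n// mul1r -natrM ler_nat; nia.
- by rewrite -[X in _ --> X]addr0; apply: cvgD; [exact: cvg_cst|exact: cvg_harmonic].
Qed.

Lemma normc_sum (I : Type) (r : seq I) (f : I -> C) :
  normc (\sum_(i <- r) f i) <= \sum_(i <- r) normc (f i).
Proof.
elim: r => [|i r ih]; first by rewrite !big_nil Normc.normc0.
by rewrite !big_cons; apply: le_trans (le_normcD _ _) _; rewrite lerD2l.
Qed.

(** The [n.+1] Lagrange basis polynomials sum to 1 at [z], so one of them has modulus at least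
    [n.+1%:R^-1] there. Its logarithm compares [log_sum] at a node [a] with the sum at [z] over the
    other nodes, and the former is at most about [n%:R * V]. *)
Lemma log_pot_le z : ~ E z -> (log_pot mu z <= V%:E)%E.
Proof.
move=> nEz; have [s fs sphi] := almost_fekete_cvg.
have sE k w : w \in s k -> E w by have [n _ [[_ _ h] _ _ _]] := fs k; exact: h.
have [L -> cL] := log_pot_limit mE EM mu_E E_closed nEz sE sphi.
have [r r0 rE] := E_closed nEz.
rewrite lee_fin; apply/ler_addgt0Pr => e e0.
pose c := 2 + `|ln r| + `|V| + `|ln e|.
have bd k : seq_mean (lk z) (s k) <= V + e + c * k.+1%:R^-1.
  have [n kn [[us sn _] _ b _]] := fs k.
  have N0 : 0 < n.+1%:R :> R by rewrite ltr0n.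
  have zs : z \notin s k by apply/negP => /sE.
  have [a as_ ha] : exists2 a, a \in s k &
      - ln n.+1%:R <= log_sum (s k) a - log_sum (rem a (s k)) z.
    apply: contrapT => nex.
    have lt1 a : a \in s k -> normc ((\prod_(b <- rem a (s k)) (z - b)) / (\prod_(b <- rem a (s k))
      (a - b))) < n.+1%:R^-1.
      move=> ak; rewrite Normc.normcM Normc.normcV !normc_prod_log_sum; last 2 first.
      - by rewrite mem_rem_uniq// !inE eqxx.
      - by apply: contra zs => /mem_rem.
      rewrite -expRN -expRD opprK -[n.+1%:R]lnK ?posrE// -expRN ltr_expR ltNge.
      apply/negP => h; apply: nex; exists a => //; apply: le_trans h _.
      by rewrite (log_sum_rem _ ak) lkzz add0r addrC.
    have := lagrange_seq z us; rewrite sn => /(_ isT) e1.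
    have : 1 < 1 :> R; last by rewrite ltxx.
    rewrite -[X in X < _](Normc.normc1 R) -[X in normc X]e1.
    apply: le_lt_trans (normc_sum _ _) _.
    rewrite -[ltRHS](@mulfV _ n.+1%:R) ?gt_eqF// -sn mulr_natl -iter_addr_0 -(count_predT (s k)).
    rewrite -big_const_seq big_seq [ltRHS]big_seq; apply: ltr_sum; last by move=> a;
      rewrite count_predT sn; exact: lt1.
    by apply/hasP; move: sn; case: (s k) => // x t _; exists x; rewrite inE eqxx.
  have ls : log_sum (s k) z <= - ln r + ln n.+1%:R + n%:R * (V + k.+1%:R^-1) + 1.
    have za : lk z a <= - ln r.
      rewrite lerN2 ler_ln ?posrE// ?normc_gt0 ?subr_eq0.
        by rewrite leNgt normc_distC; apply/negP => /rE; apply; exact: sE as_.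
      by apply/eqP => za; apply: nEz; rewrite za; exact: sE as_.
    by rewrite (log_sum_rem z as_); have := b _ as_; move: ha za; set y := n%:R * _;
      set l := ln n.+1%:R; lra.
  (* The inequality [ln x < x] at [x = e * n.+1%:R]: the logarithmic loss costs only [e] per
     point. *)
  have lnN : ln n.+1%:R <= e * n.+1%:R + `|ln e|.
    have := ln_sublinear (mulr_gt0 e0 N0); rewrite lnM ?posrE//.
    have := ler_norm (- ln e); rewrite normrN; lra.
  have h1 : k.+1%:R^-1 * n.+1%:R >= 1 :> R.
    by rewrite mulrC ler_pdivlMr ?ltr0n// mul1r ler_nat ltnW.
  rewrite log_sum_seq_mean sn// in ls.
  have n1 : n%:R = n.+1%:R - 1 :> R by rewrite -natr1 addrK.
  rewrite -(ler_pM2l N0); move: ls lnN h1; rewrite n1.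
  have h0 := harmonic_ge0 k.
  set S := _ * seq_mean _ _; set h := k.+1%:R^-1 in h0 *; set x := n.+1%:R in N0 *.
  move=> ls lnN h1; apply: le_trans ls _.
  have : 0 <= (h * x - 1) * (`|ln r| + `|V| + `|ln e| + 1).
    by rewrite mulr_ge0 ?subr_ge0 ?addr_ge0.
  have := ler_norm (- ln r); have := ler_norm (- V); rewrite !normrN /c; nra.
have c2 : V + e + c * k.+1%:R^-1 @[k --> \oo] --> V + e + c * 0.
  by apply: cvgD; [exact: cvg_cst|apply: cvgMr; exact: cvg_harmonic].
by have := ler_cvg_to cL c2; rewrite mulr0 addr0; apply; apply: nearW; exact: bd.
Qed.

(** Let [a] be a point whose [log_sum] is at least the average. Almost minimality bounds on [E] the
    polynomial vanishing at the other points, and the maximum principle extends the bound to [z].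
    Hence the discrete energy is at most the mean kernel at [z] up to a vanishing error, and in the
    limit the energy of [mu] is at most U at [z]. *)
Lemma log_pot_ge (K : set C) z : compact K -> E `<=` K ->
  (forall z, K z -> ~ E z -> exists2 r, 0 < r & forall w, normc (w - z) < r -> K w) ->
  K z -> ~ E z -> (V%:E <= log_pot mu z)%E.
Proof.
move=> cK EK Kint Kz nEz; have [s fs sphi] := almost_fekete_cvg.
have sE k w : w \in s k -> E w by have [n _ [[_ _ h] _ _ _]] := fs k; exact: h.
have [L -> cL] := log_pot_limit mE EM mu_E E_closed nEz sE sphi.
pose D := normc z + `|M| + 1.
have D1 : 1 <= D by rewrite /D; have := normc_ge0 z; have := normr_ge0 M; lra.
pose c := ln D + 1.
have c0 : 0 <= c by rewrite addr_ge0// ln_ge0.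
pose S k := seq_mean (lk z) (s k).
(* The average of [log_sum] is at most [n.+1%:R * S k + c]; dividing by [n%:R] instead of [n.+1%:R]
   leaves an error of order [n%:R^-1], where [n] exceeds [k]. *)
pose dd k := S k + (`|S k| + c) * k.+1%:R^-1.
rewrite -energy_V; have imu := probabilities_on_lnw mE EM mu_E.
apply: (@limit_energy_le R s mu dd L imu).
- by apply: seq_mean_moment => phi cphi _; exact: sphi.
- by apply: seq_mean_lnw => //; apply: sphi; exact: continuous_lnw.
- by move=> k; have [n kn [[_ -> _] _ _ _]] := fs k; rewrite ltnS.
- move=> k; have [n kn [ns _ _ cmin]] := fs k; have [us sn _] := ns.
  have n0 : (0 < n)%N by exact: leq_ltn_trans kn.
  have N0 : 0 < n.+1%:R :> R by rewrite ltr0n.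
  have [e1 e1s] : exists w, w \in s k.
    by move: sn; case: (s k) => // x t _; exists x; rewrite inE eqxx.
  rewrite (discrete_energy_admissible n0 ns) lee_fin.
  have [a as_ ha] : exists2 a, a \in s k & pair_sum (s k) <= n.+1%:R * log_sum (s k) a.
    apply: contrapT => nex.
    have : pair_sum (s k) < pair_sum (s k); last by rewrite ltxx.
    rewrite -(ltr_pM2l N0) [ltLHS]mulr_sumr.
    rewrite -[X in _ < X%:R * _]sn [ltRHS]mulr_natl -[ltRHS]iter_addr_0 -(count_predT (s k))
      -big_const_seq.
    rewrite big_seq [ltRHS]big_seq; apply: ltr_sum; first by apply/hasP; exists e1.
    by move=> w ws; rewrite ltNge; apply/negP => h; apply: nex; exists w.
  have zs : z \notin rem a (s k) by apply/negP => /mem_rem/sE.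
  pose p : {poly C} := \prod_(w <- rem a (s k)) ('X - w%:P).
  have pE w : p.[w] = \prod_(t <- rem a (s k)) (w - t).
    by rewrite horner_prod; apply: eq_bigr => t _; rewrite hornerXsubC.
  have pB w : E w -> normc p.[w] <= expR (1 - log_sum (s k) a).
    move=> Ew; rewrite pE; have [ws|ws] := boolP (w \in rem a (s k)).
      by rewrite (big_rem w ws) /= subrr mul0r Normc.normc0 expR_ge0.
    by rewrite normc_prod_log_sum// ler_expR; have := cmin a w as_ Ew ws; lra.
  have := poly_max_principle cK EK (sE _ _ as_) Kint pB Kz.
  rewrite pE normc_prod_log_sum// ler_expR => hz.
  have ls : log_sum (s k) a <= log_sum (s k) z + c.
    have : - ln D <= lk z a.
      apply: lk_ge => //; have := normc_distD z 0 a; rewrite subr0 add0r normcN.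
      by have := EM (sE _ _ as_); have := ler_norm M; rewrite /D; lra.
    by rewrite (log_sum_rem z as_) /c; lra.
  have lsS : log_sum (s k) z = n.+1%:R * S k by rewrite log_sum_seq_mean ?sn.
  rewrite ler_pdivrMr ?mulr_gt0 ?ltr0n//; apply: le_trans ha _.
  rewrite lsS in ls; rewrite mulrCA ler_pM2l// /dd; apply: le_trans ls _.
  have h1 : k.+1%:R^-1 * n%:R >= 1 :> R.
    by rewrite mulrC ler_pdivlMr ?ltr0n// mul1r ler_nat.
  rewrite -natr1; have := ler_norm (S k); have := normr_ge0 (S k).
  move: h1; set h := k.+1%:R^-1; set x := n%:R; set S0 := S k => h1 S1 S2.
  have : 0 <= (h * x - 1) * (`|S0| + c) by apply: mulr_ge0; [rewrite subr_ge0|exact: addr_ge0].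
  nra.
- rewrite -[X in _ --> X]addr0 -(mulr0 (`|L| + c)); apply: cvgD => //.
  apply: cvgM; last exact: cvg_harmonic.
  by apply: cvgD; [exact: cvg_norm|exact: cvg_cst].
Qed.

End fekete_potential.

(** * The outer domain and its Green function *)

Section outer_domains.
Context {R : realType}.
Local Notation C := R[i].
Local Notation normc := Normc.normc.
Implicit Types (E : set C) (z w : C).

Let sphere := one_point_compactification C.

Lemma connected_segment z w (I : interval R) :
  connected ((fun t : R => Some (z + t%:C%C * w) : sphere) @` [set` I]).
Proof.
apply: connected_continuous_connected; first exact/connected_intervalP/interval_is_interval.
apply: continuous_subspaceT => t.
apply: (@continuous_comp _ _ _ (fun t : R => z + t%:C%C * w) (Some : C -> sphere)); last first.
  exact: one_point_compactification_some_continuous.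
move=> U /= /nbhs_normcP[e e0 eU].
have d0 : 0 < e / (normc w + 1) by rewrite divr_gt0// ltr_wpDl// normc_ge0.
apply/nbhs_ballP; exists (e / (normc w + 1)) => // s /= ts; apply: eU.
rewrite opprD addrACA subrr add0r -mulrBl -rmorphB Normc.normcM.
have -> : normc (s - t)%:C%C = `|s - t| by rewrite /= expr0n addr0 sqrtr_sqr.
move: ts; rewrite /ball /= distrC ltr_pdivlMr ?ltr_wpDl ?normc_ge0// => ts.
by apply: le_lt_trans ts; rewrite ler_wpM2l// lerDl.
Qed.

Lemma outer_domain_disjoint E z : outer_domain E (Some z) -> ~ E z.
Proof. by move=> /connected_component_sub /= h Ez; apply: h; exists z. Qed.

(** The ray from [z] away from the origin is connected and misses [E], and its closure in the sphere
    contains infinity. *)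
Lemma outer_domain_far E M z : (forall w, E w -> normc w <= M) -> 0 <= M -> M < normc z ->
  outer_domain E (Some z).
Proof.
move=> EM M0 Mz.
have z0 : 0 < normc z by exact: le_lt_trans Mz.
pose A := (fun t : R => Some (0 + t%:C%C * z) : sphere) @` [set` `[1, +oo[].
have A1 t : 1 <= t -> A (Some (0 + t%:C%C * z)).
  by move=> t1; exists t => //=; rewrite in_itv/= t1.
have nA t : 1 <= t -> normc (0 + t%:C%C * z) = t * normc z.
  move=> t1; rewrite add0r Normc.normcM; congr (_ * _).
  by rewrite /= expr0n addr0 sqrtr_sqr ger0_norm//; lra.
apply: (@connected_component_max _ _ (closure A)).
- move=> U [K [cK _] KU].
  have [B KB] := compact_plane_bounded cK.
  pose t := Num.max 1 ((`|B| + 1) / normc z).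
  have t1 : 1 <= t by rewrite le_max lexx.
  exists (Some (0 + t%:C%C * z)); split; first exact: A1.
  apply: KU; left; exists (0 + t%:C%C * z) => //= /KB; rewrite nA//.
  have : (`|B| + 1) / normc z <= t by rewrite le_max lexx orbT.
  by rewrite ler_pdivrMr//; have := ler_norm B; lra.
- move=> x clx [e Ee ex]; move: clx; rewrite -ex => clx.
  have : nbhs (Some e : sphere) (Some @` [set w | normc (w - 0) < normc z]).
    apply: one_point_compactification_some_nbhs; apply: open_nbhs_nbhs; split.
      exact: open_normc_ball.
    by rewrite /= subr0; exact: le_lt_trans (EM _ Ee) Mz.
  move=> /clx[_ [[t /= t1 <-] [w /= wz [wt]]]]; move: t1; rewrite in_itv /= andbT => t1.
  move: wz; rewrite subr0 wt nA// ltNge => /negP; apply.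
  by rewrite ler_peMl// ltW.
- apply: connected_closure; exact: connected_segment.
- apply: subset_closure; rewrite -[z]mul1r -[1 * z]add0r; exact: (A1 1).
Qed.

(** The segment between the two points stays in the ball. In particular, off [E] both the outer
    domain and its complement are open. *)
Lemma outer_domain_ball E c z w r : (forall t, normc (t - c) < r -> ~ E t) ->
  normc (z - c) < r -> normc (w - c) < r ->
  outer_domain E (Some z) -> outer_domain E (Some w).
Proof.
move=> rE zr wr zE; apply: connected_component_trans zE _.
apply: (@connected_component_max _ _ ((fun t : R => Some (z + t%:C%C * (w - z)) : sphere) @` [set`
  `[0, 1]])).
- by exists 0; rewrite ?mul0r ?addr0//= in_itv /= lexx ler01.
- move=> _ [t /= + <-] [e Ee [et]]; rewrite in_itv /= => /andP[t0 t1].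
  apply: (rE e) Ee; rewrite et.
  have -> : z + t%:C%C * (w - z) - c = (1 - t)%:C%C * (z - c) + t%:C%C * (w - c).
    by rewrite rmorphB rmorph1; ring.
  apply: le_lt_trans (le_normcD _ _) _; rewrite !Normc.normcM.
  have nR (x : R) : 0 <= x -> normc x%:C%C = x.
    by move=> x0; rewrite /= expr0n addr0 sqrtr_sqr ger0_norm.
  rewrite !nR ?subr_ge0//.
  have [->|t10] := eqVneq t 0; first by rewrite subr0 mul1r mul0r addr0.
  have tp : 0 < t by rewrite lt_neqAle eq_sym t10.
  have h1 : (1 - t) * normc (z - c) <= (1 - t) * r by rewrite ler_wpM2l ?subr_ge0// ltW.
  by have := wr; rewrite -(ltr_pM2l tp); lra.
- exact: connected_segment.
- by exists 1; rewrite ?mul1r ?subrKC//= in_itv /= lexx ler01.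
Qed.

End outer_domains.

(** * The Green function extended by zero *)

Section outer_green_function.
Context {R : realType}.
Local Notation C := R[i].
Local Notation normc := Normc.normc.
Implicit Types (s : seq C) (z w : C).

Lemma compact_plane_complement (E : set C) : compact E -> forall z, ~ E z ->
  exists2 r, 0 < r & forall w, normc (w - z) < r -> ~ E w.
Proof.
move=> /compact_plane_closed/closed_openC oE z Ez.
have /nbhs_normcP[r r0 rE] : nbhs z (~` E) by exact: open_nbhs_nbhs.
by exists r.
Qed.

Lemma seq_mean_ge0 (phi : C -> R) s : (forall z, 0 <= phi z) -> 0 <= seq_mean phi s.
Proof. by move=> phi0; rewrite mulr_ge0 ?invr_ge0// sumr_ge0. Qed.

Lemma ler_seq_mean (phi psi : C -> R) s :
  (forall z, z \in s -> phi z <= psi z) -> seq_mean phi s <= seq_mean psi s.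
Proof.
move=> h; rewrite ler_wpM2l ?invr_ge0// big_seq [leRHS]big_seq.
exact: ler_sum.
Qed.

Lemma seq_meanD (phi psi : C -> R) s :
  seq_mean (fun z => phi z + psi z) s = seq_mean phi s + seq_mean psi s.
Proof. by rewrite /seq_mean big_split /= mulrDr. Qed.

Lemma seq_meanZ (a : R) (phi : C -> R) s :
  seq_mean (fun z => a * phi z) s = a * seq_mean phi s.
Proof. by rewrite /seq_mean -mulr_sumr mulrCA. Qed.

Lemma seq_mean_cst (a : R) s : (0 < size s)%N -> seq_mean (fun=> a) s = a.
Proof.
move=> s0; rewrite /seq_mean big_const_seq count_predT iter_addr_0 -[a *+ _]mulr_natl mulrA.
by rewrite mulVf ?mul1r// pnatr_eq0 -lt0n.
Qed.

Lemma log_tailE s r : log_tail s r = seq_mean (fun z => if r <= normc z then ln (normc z) else 0) s.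
Proof. by rewrite /log_tail big_mkcond. Qed.

Context (E : set C) (mu : probability C R) (M V : R).
Hypotheses (cE : compact E) (M0 : 0 <= M) (EM : forall z, E z -> normc z <= M)
  (mu_E : probabilities_on E mu) (robin_V : robin E = V%:E)
  (energy_V : energy mu = V%:E).

Let mE : measurable E := measurable_plane_closed (compact_plane_closed cE).
Let E_closed := compact_plane_complement cE.
Let imu : lnw_integrable mu := probabilities_on_lnw mE EM mu_E.

(** The extension by 0 turns [green_mean] into the plain mean of a real function; the potential is
    finite off [E], so [fine] loses nothing on the outer domain. *)
Definition outer_green z : R :=
  if (Some z : one_point_compactification C) \in outer_domain E
  then V - fine (log_pot mu z) else 0.

Lemma equilibrium_support_neq0 : E !=set0.
Proof.
have [s fs _] := almost_fekete_cvg mE EM mu_E robin_V energy_V E_closed.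
have [n _ [[_ + sE] _ _ _]] := fs 0%N.
by case: (s 0%N) sE => // z t sE _; exists z; apply: sE; rewrite inE eqxx.
Qed.

Lemma log_pot_fin z : ~ E z -> log_pot mu z = (fine (log_pot mu z))%:E.
Proof.
move=> nEz; have [s fs sphi] := almost_fekete_cvg mE EM mu_E robin_V energy_V E_closed.
have sE k w : w \in s k -> E w by have [n _ [[_ _ h] _ _ _]] := fs k; exact: h.
by have [L -> _] := log_pot_limit mE EM mu_E E_closed nEz sE sphi.
Qed.

(* Potentials off E are limits of means of the kernel over points of E. *)
Lemma log_pot_ler z w a : ~ E z -> ~ E w -> (forall t, E t -> lk z t <= lk w t + a) ->
  fine (log_pot mu z) <= fine (log_pot mu w) + a.
Proof.
move=> nEz nEw h; have [s fs sphi] := almost_fekete_cvg mE EM mu_E robin_V energy_V E_closed.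
have sE k t : t \in s k -> E t by have [n _ [[_ _ h'] _ _ _]] := fs k; exact: h'.
have [L -> cL] := log_pot_limit mE EM mu_E E_closed nEz sE sphi.
have [L' -> cL'] := log_pot_limit mE EM mu_E E_closed nEw sE sphi.
have c2 : seq_mean (lk w) (s n) + a @[n --> \oo] --> L' + a by apply: cvgD => //; exact: cvg_cst.
have := ler_cvg_to cL c2; apply; apply: nearW => k.
have k0 : (0 < size (s k))%N by have [n _ [[_ -> _] _ _ _]] := fs k.
rewrite -[X in _ <= _ + X](seq_mean_cst a k0) -seq_meanD; apply: ler_seq_mean => t /sE; exact: h.
Qed.

Lemma log_pot_bounds z a b : ~ E z -> (forall t, E t -> a <= lk z t <= b) ->
  a <= fine (log_pot mu z) <= b.
Proof.
move=> nEz h; have [s fs sphi] := almost_fekete_cvg mE EM mu_E robin_V energy_V E_closed.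
have sE k t : t \in s k -> E t by have [n _ [[_ _ h'] _ _ _]] := fs k; exact: h'.
have [L -> cL] := log_pot_limit mE EM mu_E E_closed nEz sE sphi.
have k0 k : (0 < size (s k))%N by have [n _ [[_ -> _] _ _ _]] := fs k.
apply/andP; split.
  have := ler_cvg_to (cvg_cst a) cL; apply; apply: nearW => k.
  by rewrite -[X in X <= _](seq_mean_cst a (k0 k)); apply: ler_seq_mean => t /sE/h/andP[].
have := ler_cvg_to cL (cvg_cst b); apply; apply: nearW => k.
by rewrite -[X in _ <= X](seq_mean_cst b (k0 k)); apply: ler_seq_mean => t /sE/h/andP[].
Qed.

Lemma outer_green_ge0 z : 0 <= outer_green z.
Proof.
rewrite /outer_green; case: ifPn => // /set_mem/outer_domain_disjoint nEz.
have := log_pot_le mE EM mu_E robin_V energy_V E_closed nEz.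
by rewrite (log_pot_fin nEz) lee_fin subr_ge0.
Qed.

Lemma green_meanE s : green_mean E mu s = (seq_mean outer_green s)%:E.
Proof.
rewrite /green_mean /seq_mean EFinM; congr (_ * _)%E.
rewrite big_mkcond -sumEFin; apply: eq_bigr => z _; rewrite /outer_green.
case: ifPn => // /set_mem/outer_domain_disjoint nEz.
by rewrite /green robin_V -/(log_pot mu z) (log_pot_fin nEz).
Qed.

(** The complement [K] of the outer domain is compact and its points off [E] are interior, so the
    lower bound from the maximum principle excludes that [z] lies in [K]. *)
Lemma outer_green_gt0 z : ~ E z -> (log_pot mu z < V%:E)%E -> 0 < outer_green z.
Proof.
move=> nEz; rewrite /outer_green; case: ifPn => [_|].
  by rewrite (log_pot_fin nEz) lte_fin subr_gt0.
move=> /negP zO; rewrite ltNge => /negP; case.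
pose K := [set z : C | ~ outer_domain E (Some z)].
have Kopen w : ~ E w -> exists2 r, 0 < r & forall t u, normc (t - w) < r -> normc (u - w) < r ->
    outer_domain E (Some t) -> outer_domain E (Some u).
  by move=> /E_closed[r r0 rE]; exists r => // t u tw uw; exact: outer_domain_ball rE tw uw.
have ww w : normc (w - w) = 0 by rewrite subrr Normc.normc0.
apply: (@log_pot_ge R E mu M V mE EM mu_E robin_V energy_V E_closed K) => //.
- apply: (@bounded_closed_plane_compact R M).
    rewrite -[K]setCK; apply: open_closedC; rewrite openE => w /= /contrapT wO.
    have [r r0 rP] := Kopen w (outer_domain_disjoint wO).
    by apply/nbhs_normcP; exists r => // t tw nt; apply: nt; apply: rP wO; rewrite ?ww.
  by move=> w nw; rewrite leNgt; apply/negP => Mw; apply: nw; exact: outer_domain_far EM M0 Mw.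
- by move=> w Ew /outer_domain_disjoint.
- move=> w Kw /Kopen[r r0 rP]; exists r => // t tw tO; apply: Kw.
  by apply: rP tO; rewrite ?ww.
- by move=> zO'; apply: zO; apply/mem_set.
Qed.

(** For [w] this close to [z], distances to points of [E] shrink at most by the factor
    [expR (- (g / 2))], so the potential rises by at most [g / 2]. *)
Lemma outer_green_lsc z : ~ E z -> 0 < outer_green z ->
  exists2 r, 0 < r & forall w, normc (w - z) < r -> outer_green z / 2 <= outer_green w.
Proof.
move=> nEz gz; have [r r0 rE] := E_closed nEz.
have zO : outer_domain E (Some z).
  by move: gz; rewrite /outer_green; case: ifPn => [/set_mem//|]; rewrite ltxx.
set g := outer_green z in gz *.
have g1 : 0 < 1 - expR (- (g / 2)).
  by rewrite subr_gt0 -[ltRHS]expR0 ltr_expR oppr_lt0 divr_gt0.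
exists (r * (1 - expR (- (g / 2)))); first exact: mulr_gt0.
move=> w wz.
have wr : normc (w - z) < r.
  by apply: lt_le_trans wz _; rewrite ler_piMr ?(ltW r0)// gerBl expR_ge0.
have nEw := rE w wr.
have wO : outer_domain E (Some w).
  by apply: outer_domain_ball rE _ wr zO; rewrite subrr Normc.normc0.
have := log_pot_ler (z := w) (w := z) (a := g / 2) nEw nEz.
move=> H.
have : fine (log_pot mu w) <= fine (log_pot mu z) + g / 2.
  apply: H => t Et.
  have zt : r <= normc (z - t).
    by rewrite leNgt normc_distC; apply/negP => /rE.
  have h1 : normc (z - t) * expR (- (g / 2)) <= normc (w - t).
    have := normc_distD z w t; rewrite (normc_distC z w).
    have := ler_wpM2r (ltW g1) zt; move: wz; set e := expR _; lra.
  have e0 := expR_gt0 (- (g / 2)).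
  have p1 : 0 < normc (z - t) * expR (- (g / 2)) by rewrite mulr_gt0//; exact: lt_le_trans zt.
  have p2 := lt_le_trans p1 h1.
  have : ln (normc (z - t) * expR (- (g / 2))) <= ln (normc (w - t)) by rewrite ler_ln ?posrE.
  rewrite lnM ?posrE ?expRK//; last exact: lt_le_trans zt.
  by rewrite /lk; lra.
have -> : outer_green w = V - fine (log_pot mu w) by rewrite /outer_green (mem_set wO).
have : g = V - fine (log_pot mu z) by rewrite /g /outer_green (mem_set zO).
lra.
Qed.

(** Far out, distances to points of [E] lie between half of and twice [normc z], so the potential
    differs from [- ln (normc z)] by at most [ln 2]. *)
Lemma outer_green_far : exists2 r0, expR 1 <= r0 & forall z, r0 <= normc z ->
  ln (normc z) <= 2 * outer_green z /\ outer_green z <= 2 * ln (normc z).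
Proof.
(* Once [ln (normc z)] exceeds [l], the error [ln 2] and [V] together make up at most half of it. *)
pose l := 2 * (ln 2 + `|V|).
have l0 : 0 <= l by rewrite mulr_ge0// addr_ge0// ln_ge0// ler1n.
exists (Num.max (2 * M + 1) (expR (l + 1))); first by rewrite le_max ler_expR; apply/orP; right;
  rewrite lerDr.
move=> z; rewrite ge_max => /andP[zM zl].
have z0 : 0 < normc z by apply: lt_le_trans zl; exact: expR_gt0.
have lz : l + 1 <= ln (normc z) by rewrite -[l + 1]expRK ler_ln ?posrE// expR_gt0.
have Mz : M < normc z by lra.
have nEz : ~ E z by move=> /EM; lra.
have zO := outer_domain_far EM M0 Mz.
have h2 : 0 < 2 * normc z by rewrite mulr_gt0.
have bounds t : E t -> - ln (2 * normc z) <= lk z t <= - ln (normc z / 2).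
  move=> /EM tM.
  have n1 : normc (z - t) <= 2 * normc z.
    by have := normc_distD z 0 t; rewrite subr0 add0r normcN; lra.
  have n2 : normc z / 2 <= normc (z - t).
    by have := normc_distD z t 0; rewrite !subr0; lra.
  have n0 : 0 < normc (z - t) by apply: lt_le_trans n2; rewrite divr_gt0.
  by rewrite !lerN2 !ler_ln ?posrE ?n1 ?n2// divr_gt0.
have := log_pot_bounds nEz bounds.
rewrite lnM ?posrE// ln_div ?posrE// => /andP[b1 b2].
rewrite /outer_green (mem_set zO).
by have := ler_norm V; have := ler_norm (- V); rewrite normrN /l in lz *; lra.
Qed.

End outer_green_function.

(** * Convergence of empirical measures *)

Section empirical_measures.
Context {R : realType}.
Local Notation C := R[i].
Local Notation normc := Normc.normc.
Implicit Types (s : seq C) (z w : C).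

Lemma cvgn_comp_ge (T : topologicalType) (u : nat -> T) (a : nat -> nat) (l : T) :
  (forall k, (k <= a k)%N) -> u n @[n --> \oo] --> l -> u (a k) @[k --> \oo] --> l.
Proof.
move=> ka ul; apply: (cvg_comp _ _ _ ul) => P [N _ NP].
by exists N => // n Nn; apply: NP; exact: leq_trans (ka n).
Qed.

(** The index bound [k.+1 < a k] provides the size condition of the energy estimates when [u] is
    computed on [n]-tuples. *)
Lemma cvgn_subsequences (u : nat -> R) (l : R) :
  (forall a : nat -> nat, (forall k, (k.+1 < a k)%N) ->
    exists2 b : nat -> nat, forall k, (k <= b k)%N & u (a (b k)) @[k --> \oo] --> l) ->
  u n @[n --> \oo] --> l.
Proof.
move=> H; apply/cvgrPdist_lt => e e0; apply: contrapT => nnear.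
have : forall k, exists n, (k.+1 < n)%N /\ e <= `|l - u n|.
  move=> k; apply: contrapT => nex; apply: nnear; exists k.+2 => // n /= kn.
  by rewrite ltNge; apply/negP => h; apply: nex; exists n.
move=> /choice[a aP]; have [|b kb cb] := H a; first by move=> k; have [] := aP k.
have [k _ /(_ k (leqnn k)) /=] := @cvgr_dist_lt _ _ _ _ _ _ _ cb _ e0.
by rewrite ltNge; have [_ ->] := aP (b k).
Qed.

Lemma integral_tau (phi : C -> R) s : measurable_fun setT phi ->
  (\int[tau s]_z (phi z)%:E = (seq_mean phi s)%:E)%E.
Proof.
move=> mphi.
have pos (f : C -> \bar R) (g : C -> R) : measurable_fun setT f -> (forall z, 0 <= f z)%E ->
    (forall z, f z = (g z)%:E) -> (\int[tau s]_z f z = (seq_mean g s)%:E)%E.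
  move=> mf f0 fg; rewrite /tau ge0_integral_mscale// ge0_integral_measure_sum//.
  rewrite /seq_mean EFinM (big_nth 0) big_mkord -sumEFin; congr (_ * _)%E.
  by apply: eq_bigr => k _; rewrite integral_dirac// diracT mul1e fg.
have mf : measurable_fun setT (EFin \o phi) by exact/measurable_EFinP.
rewrite integralE (pos _ (fun z => Num.max (phi z) 0)); last 3 first.
- exact: measurable_funepos.
- by move=> z; exact: funepos_ge0.
- by move=> z; rewrite funeposE EFin_max.
rewrite (pos _ (fun z => Num.max (- phi z) 0)); last 3 first.
- exact: measurable_funeneg.
- by move=> z; exact: funeneg_ge0.
- by move=> z; rewrite funenegE EFin_max.
rewrite -EFinB /seq_mean -mulrBr -sumrB; congr (_ * _)%:E; apply: eq_bigr => z _.
by rewrite !maxEle; do 2 case: ifPn; lra.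
Qed.

(** Remote points are moved to a fixed place instead of being dropped: the configuration becomes
    bounded and keeps its size. *)
Definition pull r e z : C := if normc z < r then z else e.

Lemma seq_mean_pull (psi : C -> R) s r e c :
  (forall z, r <= normc z -> `|psi z - psi e| <= c * ln (normc z)) ->
  `|seq_mean psi s - seq_mean psi (map (pull r e) s)| <= c * log_tail s r.
Proof.
move=> h; rewrite /seq_mean size_map big_map -mulrBr -sumrB normrM ger0_norm ?invr_ge0//.
rewrite /log_tail mulrCA ler_wpM2l ?invr_ge0//.
apply: le_trans (ler_norm_sum _ _ _) _; rewrite mulr_sumr [leRHS]big_mkcond /=.
apply: ler_sum => z _; rewrite /pull; case: leP => /= [/h//|_].
by rewrite subrr normr0.
Qed.

Lemma lnw_le_ln z : expR 1 <= normc z -> lnw z <= 2 * ln (normc z).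
Proof.
move=> ez; have e1 : 1 < expR 1 :> R by rewrite -[ltLHS]expR0 ltr_expR.
have z1 : 1 <= normc z by lra.
have -> : 2 * ln (normc z) = ln (normc z ^+ 4) / 2.
  by rewrite lnXn ?(lt_le_trans _ z1)// -mulr_natr; field.
rewrite /lnw ler_pM2r ?invr_gt0// ler_ln ?posrE ?nsq1_gt0 ?exprn_gt0//; last lra.
rewrite /nsq1 nsq_normc; set x := normc z in z1 *.
have x2 : 2 <= x ^+ 2.
  have h := expR_ge1Dx (1 : R); apply: (@le_trans _ _ x); first by move: ez; rewrite -/x; lra.
  by rewrite expr2 ler_peMl//; lra.
rewrite (_ : x ^+ 4 = x ^+ 2 * x ^+ 2); last by rewrite -exprD.
by have := ler_wpM2r (sqr_ge0 x) x2; lra.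
Qed.

Lemma log_tail_ge0 s r : expR 1 <= r -> 0 <= log_tail s r.
Proof.
move=> er; rewrite mulr_ge0 ?invr_ge0// sumr_ge0// => z rz; apply: ln_ge0.
by apply: le_trans rz; apply: le_trans er; rewrite -[leLHS]expR0 ler_expR.
Qed.

End empirical_measures.

(** * The two implications *)

Section main_results.
Context {R : realType}.
Local Notation C := R[i].
Local Notation normc := Normc.normc.
Implicit Types (s : seq C) (z w : C) (Z : forall n, n.-tuple C).
Context (E : set C) (mu : probability C R) (M V : R).
Hypotheses (cE : compact E) (M0 : 0 <= M) (EM : forall z, E z -> normc z <= M)
  (mu_E : probabilities_on E mu) (robin_V : robin E = V%:E)
  (energy_V : energy mu = V%:E).

Let mE : measurable E := measurable_plane_closed (compact_plane_closed cE).
Let E_closed := compact_plane_complement cE.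
Let imu : lnw_integrable mu := probabilities_on_lnw mE EM mu_E.
Let g := outer_green E mu V.
Let g_ge0 z : 0 <= g z := outer_green_ge0 cE EM mu_E robin_V energy_V z.

Lemma log_tail_le : exists2 r0, expR 1 <= r0 & forall r s, r0 <= r ->
  log_tail s r <= 2 * seq_mean g s.
Proof.
have [r0 er0 H] := outer_green_far cE M0 EM mu_E robin_V energy_V.
exists r0 => // r s r0r; rewrite log_tailE -seq_meanZ; apply: ler_seq_mean => z _.
case: ifPn => [rz|_]; last by rewrite mulr_ge0.
by have [] := H z (le_trans r0r rz).
Qed.

Lemma log_tail_vanishing Z : seq_mean g (Z n) @[n --> \oo] --> 0 -> log_tail_vanishes Z.
Proof.
move=> gZ; have [r0 er0 H] := log_tail_le.
have cv r : r0 <= r -> log_tail (Z n) r @[n --> \oo] --> 0.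
  move=> r0r; apply: (@squeeze_cvgr _ _ _ _ (fun=> 0) (fun n => 2 * seq_mean g (Z n))).
  - by apply: nearW => n; rewrite H// log_tail_ge0//; exact: le_trans r0r.
  - exact: cvg_cst.
  - by rewrite -[X in _ --> X](mulr0 2); apply: cvgMr.
split.
  exists r0; split; first exact: num_real.
  by move=> r /ltW r0r; apply/cvg_ex; exists 0; exact: cv.
apply/cvgrPdist_lt => e e0; exists r0; split; first exact: num_real.
by move=> r /ltW r0r; rewrite (cvg_lim _ (cv r r0r))// subrr normr0.
Qed.

(** On [E] finite energy suffices. Off [E], a point with U below V has a ball on which the Green
    function stays above a positive constant, and the proportion of points in that ball tends to 0
    with the Green means. *)
Lemma limit_log_pot_ge (t : nat -> seq C) tau : lnw_integrable tau ->
  (energy tau <= V%:E)%E ->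
  (forall phi : C -> R, continuous phi -> (exists K, forall z, `|phi z| <= K) ->
    (seq_mean phi (t n))%:E @[n --> \oo] --> (\int[tau]_z (phi z)%:E)%E) ->
  seq_mean g (t n) @[n --> \oo] --> 0 ->
  {ae tau, forall z, (V%:E <= log_pot mu z)%E}.
Proof.
move=> itau eV H gt.
have cfin : (chord_energy tau tau < +oo)%E.
  by move: eV; rewrite energyE// leeBlDr// -EFinD => /le_lt_trans; apply; rewrite ltry.
have t0 := equilibrium_pot_ae_ge mE EM mu_E robin_V energy_V itau cfin.
have mlow : measurable [set z | log_pot mu z < V%:E]%E.
  have := emeasurable_fun_infty_o measurableT (measurable_log_pot imu) (V%:E).
  by rewrite setTI.
apply: (@negligibleS _ _ _ _ ((~` E `&` [set z | log_pot mu z < V%:E]%E) `|` (E `&` [set z |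
  log_pot mu z < V%:E]%E))).
  move=> z /= nV; have lV : (log_pot mu z < V%:E)%E by rewrite ltNge; apply/negP.
  by have [Ez|] := pselect (E z); [right|left].
apply: negligibleU; last first.
  by exists (E `&` [set z | log_pot mu z < V%:E]%E); split=> //; exact: measurableI.
exists (~` E `&` [set z | log_pot mu z < V%:E]%E); split=> //.
  by apply: measurableI => //; exact: measurableC.
apply: negligible_local; first by apply: measurableI => //; exact: measurableC.
move=> z [nEz lV].
have gz : 0 < g z := outer_green_gt0 cE M0 EM mu_E robin_V energy_V nEz lV.
have [r r0 rg] := outer_green_lsc cE EM mu_E robin_V energy_V nEz gz.
exists r => //; exists [set w | normc (w - z) < r] => //.
split; first exact: measurable_normc_ball.
apply: (limit_ball_null H).
apply: (@squeeze_cvgr _ _ _ _ (fun=> 0) (fun n => (g z / 2)^-1 * seq_mean g (t n))).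
- apply: nearW => n; rewrite seq_mean_ge0//= -seq_meanZ; apply: ler_seq_mean => w _.
  case: ltP => [/rg wz|_] /=; last by rewrite mulr_ge0// invr_ge0 divr_ge0// ltW.
  by rewrite mulrC ler_pdivlMr ?divr_gt0// mul1r.
- exact: cvg_cst.
- by rewrite -[X in _ --> X](mulr0 (g z / 2)^-1); apply: cvgMr.
Qed.

(** Selection requires bounded configurations, so it is applied to the pulled points; the
    logarithmic tail measures the effect of pulling on every test function growing at most like the
    logarithm. *)
Lemma empirical_limit (t : nat -> seq C) (dd : nat -> R) :
  (forall k, (k.+1 < size (t k))%N) -> (forall k, (discrete_energy (t k) <= (dd k)%:E)%E) ->
  dd k @[k --> \oo] --> V -> seq_mean g (t k) @[k --> \oo] --> 0 ->
  exists2 e : nat -> nat, forall k, (k <= e k)%N &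
    forall phi : C -> R, continuous phi -> (exists K, forall z, `|phi z| <= K) ->
    seq_mean phi (t (e k)) @[k --> \oo] --> fine (\int[mu]_z (phi z)%:E)%E.
Proof.
move=> st dt dV gt; have [r0 er0 tail_le] := log_tail_le.
have r01 : 1 < r0 by apply: lt_le_trans er0; rewrite -[ltLHS]expR0 ltr_expR.
have [e0 Ee0] := equilibrium_support_neq0 cE EM mu_E robin_V energy_V.
pose M' := Num.max r0 M.
have [|k z|e [tau [ek tauM H]]] := @seq_mean_selection R (fun k => map (pull r0 e0) (t k)) M'.
- by move=> k; rewrite size_map; exact: leq_ltn_trans (st k).
- move=> /mapP[w _ ->]; rewrite /pull /M' le_max; case: ifPn => [/ltW ->//|_].
  by rewrite (EM Ee0) orbT.
exists e => //.
have mB : measurable [set z : C | normc z <= M'].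
  by exact: measurable_plane_closed (@closed_normc_ball R M').
have tauB : tau (~` [set z : C | normc z <= M']) = 0%E.
  by apply: tauM; [exact: measurableC|move=> z /= /negP; rewrite -ltNge].
have itau : lnw_integrable tau by apply: (@bounded_lnw_integrable R tau M' _ mB tauB).
have tail0 : log_tail (t (e k)) r0 @[k --> \oo] --> 0.
  apply: (@squeeze_cvgr _ _ _ _ (fun=> 0) (fun k => 2 * seq_mean g (t (e k)))).
  - by apply: nearW => k; rewrite tail_le// log_tail_ge0.
  - exact: cvg_cst.
  - by rewrite -[X in _ --> X](mulr0 2); apply: cvgMr; exact: (cvgn_comp_ge ek gt).
(* Covers bounded functions, because the logarithm is at least 1 beyond [r0], and also [lnw], whose
   convergence the energy estimate needs. *)
have lim (psi : C -> R) c : continuous psi ->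
    (forall z, r0 <= normc z -> `|psi z - psi e0| <= c * ln (normc z)) ->
    (seq_mean psi (t (e k)))%:E @[k --> \oo] --> (\int[tau]_z (psi z)%:E)%E.
  move=> cpsi hc.
  have ipsi : tau.-integrable setT (EFin \o psi).
    have [K KP] := continuous_bounded_ball M' cpsi.
    by apply: (ae_bounded_integrable mB tauB (M := K)) => //; exact: measurable_fun_continuous.
  have fin := integrable_fin_num measurableT ipsi.
  have := H psi cpsi; rewrite -(fineK fin) => /fine_cvg cH.
  have c0 : seq_mean psi (t (e k)) - seq_mean psi (map (pull r0 e0) (t (e k))) @[k --> \oo] --> 0.
    have ct : c * log_tail (t (e k)) r0 @[k --> \oo] --> 0.
      by rewrite -[X in _ --> X](mulr0 c); exact: cvgMr.
    apply: (@squeeze_cvgr _ _ _ _ (fun k => - (c * log_tail (t (e k)) r0))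
      (fun k => c * log_tail (t (e k)) r0)) => //; last by rewrite -oppr0; exact: cvgN.
    by apply: nearW => k; rewrite -ler_norml; exact: seq_mean_pull.
  have c1 : seq_mean psi (t (e k)) @[k --> \oo] --> fine (\int[tau]_z (psi z)%:E)%E.
    rewrite -[X in _ --> X]addr0 (_ : (fun k => seq_mean psi (t (e k))) =
      fun k => seq_mean psi (map (pull r0 e0) (t (e k))) +
        (seq_mean psi (t (e k)) - seq_mean psi (map (pull r0 e0) (t (e k))))).
      exact: cvgD cH c0.
    by apply/funext => k; rewrite addrC subrK.
  by apply: cvg_EFin c1; exact: nearW.
have limb (psi : C -> R) : continuous psi -> (exists K, forall z, `|psi z| <= K) ->
    (seq_mean psi (t (e k)))%:E @[k --> \oo] --> (\int[tau]_z (psi z)%:E)%E.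
  move=> cpsi [K KP]; apply: (lim _ (2 * K)) => // z rz.
  have lz : 1 <= ln (normc z).
    by rewrite -[leLHS]expRK ler_ln ?posrE ?expR_gt0 ?(le_trans er0 rz)//; lra.
  have K0 : 0 <= K := le_trans (normr_ge0 _) (KP z).
  apply: (@le_trans _ _ (2 * K)); last by rewrite ler_peMr// mulr_ge0.
  by apply: le_trans (ler_normB _ _) _; have := KP z; have := KP e0; lra.
have st' k : (k.+1 < size (t (e k)))%N by apply: leq_ltn_trans (st (e k)); rewrite ltnS.
(* The energies are those of the original points: pulled points may coincide and then have infinite
   discrete energy. *)
have eV : (energy tau <= V%:E)%E.
  apply: (limit_energy_le itau _ _ st' (fun k => dt (e k)) (cvgn_comp_ge ek dV)).
    exact: seq_mean_moment.
  apply: seq_mean_lnw => //; apply: (lim _ (2 + lnw e0)); first exact: continuous_lnw.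
  move=> z rz; have lz : 1 <= ln (normc z).
    by rewrite -[leLHS]expRK ler_ln ?posrE ?expR_gt0 ?(le_trans er0 rz)//; lra.
  have h1 := lnw_le_ln (le_trans er0 rz); have h2 := lnw_ge0 z; have h3 := lnw_ge0 e0.
  apply: le_trans (ler_normB _ _) _; rewrite !ger0_norm// mulrDl lerD//.
  by rewrite ler_peMr.
have tmu := equilibrium_characterization mE EM mu_E energy_V itau eV
  (limit_log_pot_ge itau eV limb (cvgn_comp_ge ek gt)).
move=> phi cphi bphi; rewrite -(@eq_measure_integral _ _ _ _ mu tau); last by move=> A mA _;
  exact: tmu.
have [K KP] := bphi.
have iphi : tau.-integrable setT (EFin \o phi).
  by apply: (@bounded_integrable _ _ _ tau phi K) => //; exact: measurable_fun_continuous.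
have fin := integrable_fin_num measurableT iphi.
by have := limb phi cphi bphi; rewrite -{1}(fineK fin) => /fine_cvg.
Qed.

Lemma weak_star_empirical Z : discrete_energy (Z n) @[n --> \oo] --> V%:E ->
  seq_mean g (Z n) @[n --> \oo] --> 0 -> weak_star_cvg (fun n => tau (Z n)) mu.
Proof.
move=> dZ gZ phi cphi /compact_plane_bounded[B supp].
have bphi : exists K, forall z, `|phi z| <= K.
  have [K KP] := continuous_bounded_ball B cphi.
  exists (Num.max 0 K) => z; rewrite le_max; have [->|pz] := eqVneq (phi z) 0.
    by rewrite normr0 lexx.
  by rewrite KP ?orbT//; apply: supp; apply: subset_closure => /=; exact/eqP/eqP.
have mphi := measurable_fun_continuous cphi.
have iphi : mu.-integrable setT (EFin \o phi).
  by have [K KP] := bphi; exact: (@bounded_integrable _ _ _ mu phi K).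
have fin := integrable_fin_num measurableT iphi.
rewrite -(fineK fin) (_ : (fun n => _) = fun n => (seq_mean phi (Z n))%:E); last first.
  by apply/funext => n; exact: integral_tau.
suff h : seq_mean phi (Z n) @[n --> \oo] --> fine (\int[mu]_z (phi z)%:E)%E.
  by apply: cvg_EFin h; exact: nearW.
(* Discrete energies are known to be finite only from [N] on, so all subsequences are shifted by
   [N]. *)
have [[N _ NZ] dV] := (fine_cvgP _ _).1 dZ.
apply: cvgn_subsequences => a ka.
have aN k : (k <= a (N + k))%N by apply: ltnW; apply: leq_trans (ka _);
  rewrite ltnW// ltnS ltnS leq_addl.
have [||||e ek H] := @empirical_limit (fun k => Z (a (N + k)%N))
  (fun k => fine (discrete_energy (Z (a (N + k)%N)))).
- by move=> k; rewrite size_tuple; apply: leq_ltn_trans (ka _); rewrite ltnS leq_addl.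
- move=> k; rewrite fineK//; apply: NZ => /=; apply: leq_trans (ltnW (ltnW (ka _))).
  exact: leq_addr.
- exact: cvgn_comp_ge aN dV.
- exact: cvgn_comp_ge aN gZ.
exists (fun k => (N + e k)%N); last exact: H.
by move=> k; apply: leq_trans (ek k) (leq_addl _ _).
Qed.

(* Truncating the chordal series gives continuous minorants of log_pot mu. *)
Let pot m z : R := \sum_(k < m) kcoef k * pot_moment mu k.+1 z - (lnw z + lnw_mean mu).

Lemma pot_le m z : ((pot m z)%:E <= log_pot mu z)%E.
Proof.
rewrite log_potE// /pot EFinB leeD2r// -sumEFin.
rewrite -(big_mkord xpredT (fun k => (kcoef k * pot_moment mu k.+1 z)%:E)).
by apply: nneseries_lim_ge => k _ _; rewrite lee_fin mulr_ge0 ?kcoef_ge0 ?pot_moment_ge0.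
Qed.

Lemma continuous_pot_sum m : continuous (fun z => \sum_(k < m) kcoef k * pot_moment mu k.+1 z).
Proof.
apply: continuous_plane_sum => k; apply: continuous_planeM; first exact: continuous_plane_cst.
exact: continuous_pot_moment.
Qed.

Lemma integral_pot m : (\int[mu]_z (V - pot m z)%:E =
  (V - (\sum_(k < m) kcoef k * pair_moment mu mu k.+1 - (lnw_mean mu + lnw_mean mu)))%:E)%E.
Proof.
pose f z := \sum_(k < m) kcoef k * pot_moment mu k.+1 z.
have mf : measurable_fun setT f by apply: measurable_fun_continuous; exact: continuous_pot_sum.
have i_f : mu.-integrable setT (EFin \o f).
  have [K KP] := continuous_bounded_ball M (@continuous_pot_sum m).
  apply: (ae_bounded_integrable mE mu_E (M := K)) => // z /EM; exact: KP.
have ifE : (\int[mu]_z (f z)%:E = (\sum_(k < m) kcoef k * pair_moment mu mu k.+1)%:E)%E.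
  under eq_integral do rewrite /f -sumEFin.
  rewrite ge0_integral_sum//; last 2 first.
  - move=> k; apply/measurable_EFinP; apply: measurable_funM => //.
    exact: measurable_pot_moment.
  - by move=> k z _; rewrite lee_fin mulr_ge0 ?kcoef_ge0 ?pot_moment_ge0.
  rewrite -sumEFin; apply: eq_bigr => k _.
  under eq_integral do rewrite EFinM.
  rewrite ge0_integralZl//.
  - by rewrite integral_pot_moment -EFinM.
  - by apply/measurable_EFinP; exact: measurable_pot_moment.
  - by move=> z _; rewrite lee_fin pot_moment_ge0.
  - by rewrite lee_fin kcoef_ge0.
have ic := finite_measure_integrable_cst mu (V + lnw_mean mu) measurableT.
have ig := integrableD measurableT ic imu.
rewrite (eq_integral (fun z => (V + lnw_mean mu)%:E + (lnw z)%:E - (f z)%:E)%E); last first.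
  by move=> z _; rewrite -(EFinD (V + lnw_mean mu)) -EFinB; congr EFin; rewrite /pot /f; ring.
rewrite integralB//= ifE integralD//= integral_cst// measure_probT mule1 -EFin_lnw_mean//.
by rewrite -(EFinD (V + lnw_mean mu)) -EFinB; congr EFin; ring.
Qed.

(** The integrals of the truncated potentials increase to the energy of [mu], which is [V]. *)
Lemma pot_mean_near (e : R) : 0 < e -> exists m,
  V - (\sum_(k < m) kcoef k * pair_moment mu mu k.+1 - (lnw_mean mu + lnw_mean mu)) < e.
Proof.
move=> e0; apply: contrapT => nex.
have := chord_energy_equilibrium mE EM mu_E energy_V.
have : (chord_energy mu mu <= (V + (lnw_mean mu + lnw_mean mu) - e)%:E)%E; last first.
  by move=> + ce; rewrite ce lee_fin; lra.
apply: lime_le.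
  by apply: is_cvg_nneseries => k _ _; rewrite lee_fin mulr_ge0 ?kcoef_ge0 ?pair_moment_ge0.
apply: nearW => m; rewrite big_mkord sumEFin lee_fin leNgt; apply/negP => h.
by apply: nex; exists m; lra.
Qed.

(** Inside radius [r] the Green function is below the positive part of [V - pot m z], made compactly
    supported by a cutoff so that weak convergence applies; beyond [r] it is at most twice the
    logarithm and is charged to the tail. *)
Lemma outer_green_mean_cvg0 Z : weak_star_cvg (fun n => tau (Z n)) mu ->
  log_tail_vanishes Z -> seq_mean g (Z n) @[n --> \oo] --> 0.
Proof.
move=> wZ [tailcvg tail0].
have [r0 er0 far] := outer_green_far cE M0 EM mu_E robin_V energy_V.
apply/cvgrPdist_lt => e e0; have e4 : 0 < e / 4 by rewrite divr_gt0.
have [m hm] := pot_mean_near e4.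
have := (cvgrPdist_lt _ _).1 tail0 _ e4.
move=> [r1 [_ r1P]]; have [r2 [_ r2P]] := tailcvg.
pose r := Num.max (Num.max r0 M) (Num.max r1 r2) + 1.
have [r0r Mr r1r r2r] : [/\ r0 <= r, M <= r, r1 < r & r2 < r].
  have h x : x <= Num.max (Num.max r0 M) (Num.max r1 r2) -> x < r.
    by move=> xr; apply: le_lt_trans xr _; rewrite ltrDl.
  by split; [apply: ltW|apply: ltW| |]; apply: h; rewrite !le_max lexx ?orbT.
have tl : `|limn (fun n => log_tail (Z n) r)| < e / 4.
  by have := r1P r r1r; rewrite sub0r normrN.
have tc : log_tail (Z n) r @[n --> \oo] --> limn (fun n => log_tail (Z n) r) by exact: r2P.
pose chi z := Num.max 0 (Num.min 1 (r + 1 - normc z)).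
pose psi z := Num.max 0 (V - pot m z) * chi z.
have chi0 z : 0 <= chi z by rewrite le_max lexx.
have chi1 z : normc z <= r -> chi z = 1.
  by move=> zr; rewrite /chi min_l ?max_r//; lra.
have cchi : continuous chi.
  apply: lip_continuous => w t /=; rewrite /chi.
  have h : `|normc t - normc w| <= normc (t - w).
    have h1 := normc_distD t w 0; have h2 := normc_distD w t 0.
    rewrite !subr0 in h1 h2; rewrite (normc_distC w t) in h2.
    by rewrite ler_norml; apply/andP; split; lra.
  have mx (a b : R) : `|Num.max 0 a - Num.max 0 b| <= `|a - b|.
    have := ler_norm (a - b); have := ler_norm (- (a - b)); rewrite normrN => ? ?.
    by rewrite ler_norml; apply/andP; split; rewrite !maxEle; do 2 case: ifPn => ?; lra.
  have mn (a b : R) : `|Num.min 1 a - Num.min 1 b| <= `|a - b|.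
    have := ler_norm (a - b); have := ler_norm (- (a - b)); rewrite normrN => ? ?.
    by rewrite ler_norml; apply/andP; split; rewrite !minEle; do 2 case: ifPn => ?; lra.
  apply: le_trans (mx _ _) _; apply: le_trans (mn _ _) _.
  by rewrite (_ : _ - _ = normc w - normc t) 1?distrC//; ring.
have cpot : continuous (fun z => V - pot m z).
  rewrite (_ : (fun z => V - pot m z) = fun z => -1 * (\sum_(k < m) kcoef k * pot_moment mu k.+1 z)
    +
      (V + lnw_mean mu + lnw z)); last by apply/funext => z; rewrite /pot; ring.
  apply: continuous_planeD.
    by apply: continuous_planeM; [exact: continuous_plane_cst|exact: continuous_pot_sum].
  by apply: continuous_planeD; [exact: continuous_plane_cst|exact: continuous_lnw].
have cpsi : continuous psi.
  apply: continuous_planeM => //.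
  rewrite (_ : (fun z => _) = fun z => 2^-1 * ((V - pot m z) + `|V - pot m z|)); last first.
    by apply/funext => z; rewrite maxEle; case: (lerP 0 (V - pot m z)) => h; [rewrite ger0_norm//;
      field|rewrite ltr0_norm//; ring].
  apply: continuous_planeM; first exact: continuous_plane_cst.
  by apply: continuous_planeD => // z; exact: cvg_norm (cpot z).
have spsi : compact (closure [set z | psi z != 0]).
  apply: (@bounded_closed_plane_compact R (r + 1)); first exact: closed_closure.
  have sB : [set z | psi z != 0] `<=` [set z : C | normc z <= r + 1].
    move=> z /=; apply: contraNT; rewrite -ltNge => rz.
    have -> : psi z = 0; last by rewrite eqxx.
    rewrite /psi (_ : chi z = 0) ?mulr0// /chi max_l// ge_min; apply/orP; right; lra.
  by move=> z /(closureS sB); rewrite -(closure_id _).1//; exact: closed_normc_ball.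
have := wZ psi cpsi spsi.
rewrite (_ : (fun n => _) = fun n => (seq_mean psi (Z n))%:E); last first.
  by apply/funext => n; apply: integral_tau; exact: measurable_fun_continuous.
(* For [mu]-almost every point the cutoff is 1, as the point lies in [E], and [pot m] is at most U,
   which equals V; so neither the cutoff nor the positive part changes the integral. *)
have -> : (\int[mu]_z (psi z)%:E = \int[mu]_z (V - pot m z)%:E)%E.
  apply: ae_eq_integral => //.
  - by apply/measurable_EFinP; exact: measurable_fun_continuous.
  - by apply/measurable_EFinP; exact: measurable_fun_continuous.
  have aeE : {ae mu, forall z, E z} by exists (~` E); split=> //; exact: measurableC.
  apply: filterS2 aeE (equilibrium_pot_ae mE EM mu_E robin_V energy_V) => z Ez zV _.
  have := pot_le m z; rewrite zV lee_fin => pV.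
  by rewrite /psi chi1 ?mulr1 ?max_r ?subr_ge0//; exact: le_trans (EM Ez) Mr.
rewrite integral_pot => /fine_cvg /= cpsiZ.
have c3 : 2 * log_tail (Z n) r @[n --> \oo] --> 2 * limn (fun n => log_tail (Z n) r) by exact:
  cvgMr.
pose L := V - (\sum_(k < m) kcoef k * pair_moment mu mu k.+1 - (lnw_mean mu + lnw_mean mu)) +
  2 * limn (fun n => log_tail (Z n) r).
have c2 : seq_mean psi (Z n) + 2 * log_tail (Z n) r @[n --> \oo] --> L.
  by rewrite /L; apply: cvgD; [exact: cpsiZ|exact: c3].
have lt_e : L < e by have := ler_norm (limn (fun n => log_tail (Z n) r)); rewrite /L; lra.
have [N _ HN] := cvgr_lt _ c2 _ lt_e; exists N => // n /HN /= ne.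
rewrite sub0r normrN ger0_norm; last exact: seq_mean_ge0.
apply: le_lt_trans ne; rewrite log_tailE -seq_meanZ -seq_meanD; apply: ler_seq_mean => z _.
have psi0 : 0 <= psi z by rewrite mulr_ge0// le_max lexx.
have gpot : g z <= Num.max 0 (V - pot m z).
  rewrite /g /outer_green; case: ifPn => [/set_mem/outer_domain_disjoint nEz|_];
    last by rewrite le_max lexx.
  have := pot_le m z; rewrite (log_pot_fin cE EM mu_E robin_V energy_V nEz) lee_fin => h.
  by rewrite le_max; apply/orP; right; lra.
case: ifPn => [rz|]; first by have [_ h] := far z (le_trans r0r rz); rewrite -[g z]add0r lerD.
by rewrite -ltNge mulr0 addr0 => /ltW rz; rewrite /psi chi1 ?mulr1.
Qed.

End main_results.

Local Open Scope ereal_scope.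

Theorem theorem1p1 (R : realType) (E : set R[i]) (muE : probability R[i] R)
    (compactE : compact E) (capE : 0 < capacity E)
    (muE_eq : equilibrium_measure E muE) :
  (forall Z : (forall n : nat, n.-tuple R[i]),
     discrete_energy (Z n) @[n --> \oo] --> robin E ->
     green_mean E muE (Z n) @[n --> \oo] --> 0 ->
     weak_star_cvg (fun n => tau (Z n)) muE /\ log_tail_vanishes Z) /\
  (forall Z : (forall n : nat, n.-tuple R[i]),
     weak_star_cvg (fun n => tau (Z n)) muE -> log_tail_vanishes Z ->
     green_mean E muE (Z n) @[n --> \oo] --> 0).
Proof.
have [mu_E energy_mu] := muE_eq.
have [M EM'] := compact_plane_bounded compactE.
pose M1 := Num.max 0%R M.
have M0 : (0 <= M1)%R by rewrite le_max lexx.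
have EM z : E z -> (Normc.normc z <= M1)%R by move=> /EM' h; rewrite le_max h orbT.
have mE : measurable E := measurable_plane_closed (compact_plane_closed compactE).
have imu : lnw_integrable muE := probabilities_on_lnw mE EM mu_E.
(* Positive capacity excludes [+oo]. The value [-oo] is excluded because the energy of [muE] is a
   nonnegative chordal energy minus a finite number. *)
have [V robin_V] : exists V, robin E = V%:E.
  have := energy_mu; rewrite (energyE imu).
  have := capE; rewrite /capacity; case: (robin E) => [V _ _|| _]; first by exists V.
    by rewrite /= ltxx.
  by case: (chord_energy muE muE) (chord_energy_ge0 muE muE).
have energy_V : energy muE = V%:E by rewrite energy_mu.
have gE := green_meanE compactE EM mu_E robin_V energy_V.
split=> Z.
  rewrite robin_V => dZ gZ.
  have gZ' : (seq_mean (outer_green E muE V) (Z n) @[n --> \oo] --> 0)%R.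
    by move: gZ; under eq_cvg do rewrite gE; exact: fine_cvg.
  split; first exact: (weak_star_empirical compactE M0 EM mu_E robin_V energy_V dZ gZ').
  exact: (log_tail_vanishing compactE M0 EM mu_E robin_V energy_V gZ').
move=> wZ tZ; under eq_cvg do rewrite gE.
have gZ := outer_green_mean_cvg0 compactE M0 EM mu_E robin_V energy_V wZ tZ.
by apply: cvg_EFin gZ; exact: nearW.
Qed.
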